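(* Let $\mathbf i$ be a reduced word for $w_0$ and $a\in[n-1]$. Then $$\varrho_{a,\mathbf i}=W_a\big|_{\widehat{\mathbb T}_{\mathbf i}}\circ\widehat{\mathrm{CA}}_{\mathbf i}.$$ Furthermore, the GHKK-potential $W|_{\widehat{\mathbb T}_{\mathbf i}}=\sum_{a\in[n-1]}\varrho_{a,\mathbf i}\circ(\widehat{\mathrm{CA}}_{\mathbf i})^{-1}$ is a Laurent polynomial (in the coordinates $x_v$, $v\in V(\mathcal T_{\mathbf i})$) without constant term, with coefficients in $\{0,1\}$ and exponents in $\{0,-1\}$.
   Context: Let $n\ge2$, $[m]=\{1,\dots,m\}$, $N=n(n-1)/2$, $\sigma_i=(i,i+1)\in\mathfrak S_n$, $w_0$ the longest element. **Tilings and reduced words.** A tiling is a tiling of the regular $2n$-gon $P_0$ of side length $1$ (with a unique lowest vertex $v_0$) by rhombi (tiles) of side length $1$. The left boundary runs clockwise from $v_0$ to the highest vertex; its edges are labelled $1,\dots,n$ clockwise from $v_0$, and parallel edges have equal labels. A vertex is written $v_S$ and identified with $S\subseteq[n]$, the set of labels of a minimal edge path from $v_0$ to it. For $s\ne t$ exactly one tile has edges labelled $s,t$, denoted $[s,t]=[s,t;S]$, with vertices $S,S\cup\{s\},S\cup\{t\},S\cup\{s,t\}$. For $T=[s,t;S]$, $s<t$: $u(T)=S$, $o(T)=S\cup\{s,t\}$, $\ell(T)=S\cup\{s\}$, $r(T)=S\cup\{t\}$. Define $\le_n$ on tiles: let $B_1$ be the left boundary; $\mathcal T_k$ is the set of tiles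 not in $\mathcal T_1\cup\dots\cup\mathcal T_{k-1}$ having two edges in $B_k$; $B_{k+1}$ arises from $B_k$ by replacing for each tile of $\mathcal T_k$ these two edges by its other two edges. $T\le_nT'$ iff there is a sequence of tiles from $T$ to $T'$, consecutive ones sharing an edge, along which the index $k$ strictly increases. A reduced word is $\mathbf i=(i_1,\dots,i_N)$ with $\sigma_{i_1}\cdots\sigma_{i_N}=w_0$; it gives the total order $\alpha_{i_1}\le_{\mathbf i}\sigma_{i_1}(\alpha_{i_2})\le_{\mathbf i}\cdots\le_{\mathbf i}\sigma_{i_1}\cdots\sigma_{i_{N-1}}(\alpha_{i_N})$ on positive roots of $\mathfrak{sl}_n$. $\mathcal T_{\mathbf i}$ is the unique tiling such that $\le_{\mathbf i}$ refines $\le_n$ when $[s,t]$ ($s<t$) is identified with $\epsilon_s-\epsilon_t$. Commutation moves do not change the tiling; braid moves flip (retile) a hexagon formed by three tiles $[s,t],[s,u],[t,u]$. **The functions $\varrho_{a,\mathbf i}$.** Transition maps $\phi^{\mathbf i}_{\mathbf j}:\mathbb N^{\mathcal T_{\mathbf i}}\to\mathbb N^{\mathcal T_{\mathbf j}}$: for a commutation move, $(\phi x)_{[s,t]}=x_{[s,t]}$; for a braid move with hexagon $[s,t],[s,u],[t,u]$ ($s<t<u$), $y=\phi x$ has $y_{[s,t]}=x_{[s,t]}+x_{[s,u]}-m$, $y_{[s,u]}=m$, $y_{[t,u]}=x_{[t,u]}+x_{[s,u]}-m$, $m=\min(x_{[s,t]},x_{[t,u]})$, other coordinates unchanged; in general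 compose. The operator $f_a^*$ on $\mathbb N^{\mathcal T_{\mathbf i}}$: if $i_N=n-a$ it increases $x_{[a,a+1]}$ by one; in general $f^*_a=\phi^{\mathbf j}_{\mathbf i}\circ f^*_a\circ\phi^{\mathbf i}_{\mathbf j}$. Put $\mathbf R_a^*(\mathcal T_{\mathbf i})=\{f_a^*x-x\mid x\in\mathbb N^{\mathcal T_{\mathbf i}}\}\subset\mathbb Z^{\mathcal T_{\mathbf i}}$. On the torus $\widehat{\mathbb L}_{\mathbf i}=\mathbb G_m^{\mathcal T_{\mathbf i}}$ let $\varrho_{a,\mathbf i}(x)=\sum_{y\in\mathbf R_a^*(\mathcal T_{\mathbf i})}\prod_{T}x_T^{y_T}$. **$\mathcal X$-tori and potential.** $V(\mathcal T_{\mathbf i})$ is the set of vertices not on the left boundary; those on the right boundary are frozen. $\widehat{\mathbb T}_{\mathbf i}=\mathbb G_m^{V(\mathcal T_{\mathbf i})}$ with coordinates $x_v=x_S$ ($v=v_S$). The exchange graph $Q_{\mathbf i}$ has vertex set $V(\mathcal T_{\mathbf i})$ and is built as follows: for each tile $T$ draw an arrow $\ell(T)\to r(T)$ (if $\ell(T)\in V(\mathcal T_{\mathbf i})$), and orient the edges of the tiling between vertices of $V(\mathcal T_{\mathbf i})$ so that for each tile one has oriented cycles $\ell\to r\to o\to\ell$ and $\ell\to r\to u\to\ell$; edges receiving conflicting orientations are deleted, and all arrows between boundary vertices are deleted. $\varepsilon_{i,k}$ is the (signed) number of arrows from $i$ to $k$. If $\mathcal T_{\mathbf j}$ arises from $\mathcal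 T_{\mathbf i}$ by flipping a hexagon with inner vertex $k$ (replaced by the new inner vertex, again labelled $k$), the $\mathcal X$-mutation $\widehat\mu^{\mathbf i}_{\mathbf j}:\widehat{\mathbb T}_{\mathbf i}\dashrightarrow\widehat{\mathbb T}_{\mathbf j}$ is $x_k\mapsto x_k^{-1}$, $x_i\mapsto x_i(1+x_k^{-\operatorname{sgn}\varepsilon_{i,k}})^{-\varepsilon_{i,k}}$ for $i\ne k$, with $\varepsilon$ taken in $Q_{\mathbf i}$; it is the identity for commutation moves, and composed in general. The GHKK (Gross–Hacking–Keel–Kontsevich) potential $W=\sum_{a\in[n-1]}W_a$ is the function on the $\mathcal X$-cluster variety (i.e. $W_a|_{\widehat{\mathbb T}_{\mathbf i}}=W_a|_{\widehat{\mathbb T}_{\mathbf j}}\circ\widehat\mu^{\mathbf i}_{\mathbf j}$ for all $\mathbf i,\mathbf j$) with $W_a|_{\widehat{\mathbb T}_{\mathbf i}}=x_{\{a+1,\dots,n\}}^{-1}$ whenever $i_N=n-a$. **The map.** $\widehat{\mathrm{CA}}_{\mathbf i}:\widehat{\mathbb L}_{\mathbf i}\to\widehat{\mathbb T}_{\mathbf i}$, $(\widehat{\mathrm{CA}}_{\mathbf i}x)_v=\prod_Tx_T^{\underline\epsilon(v,T)}$, where $\underline\epsilon(v,T)=-1$ if $v\in\{\ell(T),r(T)\}$, $1$ if $v\in\{o(T),u(T)\}$, $0$ else; it is an isomorphism of tori. *)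

(* Defs.v *)
From HB Require Import structures.
From mathcomp Require Import all_boot all_order all_algebra all_fingroup.
From mathcomp Require Import all_classical all_reals all_analysis.
From mathcomp Require mpoly.
(* the notations of mpoly clash with those of mathcomp-analysis *)
Import -(notations) mpoly.

Set Implicit Arguments.
Unset Strict Implicit.
Unset Printing Implicit Defensive.

Import Order.TTheory GRing.Theory Num.Theory.
Local Open Scope ring_scope.

(* Indices are shifted by one: the label s of [n] is the ordinal s - 1 of
   'I_n, and the letter (or colour) i of [n-1] is the ordinal i - 1 of
   'I_n.-1. *)

Section Words.
Variable n : nat.

Definition word := seq 'I_n.-1.

Fact hi_subproof (i : 'I_n.-1) : (i.+1 < n)%N.
Proof. by case: n i => [|m] [] //= i; rewrite ltnS. Qed.

Definition lo (i : 'I_n.-1) : 'I_n := widen_ord (leq_pred n) i.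
Definition hi (i : 'I_n.-1) : 'I_n := Ordinal (hi_subproof i).

Definition sigma (i : 'I_n.-1) : 'I_n -> 'I_n := tperm (lo i) (hi i).

(* sigma_(i_1) (sigma_(i_2) (... x)): the leftmost letter acts last *)
Definition wact (i : word) (x : 'I_n) : 'I_n := foldr sigma x i.

(* The longest element w_0 is rev_ord. *)
Definition reduced (i : word) : Prop :=
  size i = 'C(n, 2) /\ forall x, wact i x = rev_ord x.

(* The positive root epsilon_s - epsilon_t is the pair (s, t), s < t. *)
Definition proot := {p : 'I_n * 'I_n | (p.1 < p.2)%N}.

Definition simple_root (a : 'I_n.-1) : proot :=
  exist _ (lo a, hi a) (ltnSn a).

(* the sequence alpha_(i_1), sigma_(i_1)(alpha_(i_2)), ... *)
Fixpoint roots (i : word) : seq ('I_n * 'I_n) :=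
  if i is k :: i' then
    (lo k, hi k) :: [seq (sigma k p.1, sigma k p.2) | p <- roots i']
  else [::].

Definition root_le (i : word) (p q : proot) : bool :=
  (index (val p) (roots i) <= index (val q) (roots i))%N.

(* i_N = n - a *)
Definition ends_dual (i : word) (a : 'I_n.-1) : Prop :=
  exists i', i = rcons i' (rev_ord a).

Definition comm_move (i j : word) : Prop :=
  exists p q : word, exists l m : 'I_n.-1,
    [/\ (l.+1 < m)%N || (m.+1 < l)%N,
        i = p ++ [:: l; m] ++ q & j = p ++ [:: m; l] ++ q].

(* [st], [su], [tu] are the roots (s,t), (s,u), (t,u), s < t < u, labelling the
   tiles of the flipped hexagon: s, t, u are the images of three consecutive
   indices under the permutation of the common prefix p. *)
Definition braid_move (st su tu : proot) (i j : word) : Prop :=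
  exists p q : word, exists l m : 'I_n.-1,
    let s := wact p (lo l) in let t := wact p (hi l) in
    let u := wact p (hi m) in
    [/\ l.+1 = m :> nat,
        (i = p ++ [:: l; m; l] ++ q /\ j = p ++ [:: m; l; m] ++ q) \/
        (i = p ++ [:: m; l; m] ++ q /\ j = p ++ [:: l; m; l] ++ q),
        val st = (s, t), val su = (s, u) & val tu = (t, u)].

Definition move (i j : word) : Prop :=
  comm_move i j \/ exists st su tu, braid_move st su tu i j.

End Words.

Section Tilings.
Variable n : nat.

(* The tile [s,t;S] is ((s,t), S); a vertex v_S is the set S; an edge is the
   pair of its lower and upper vertices. *)
Definition vertex := {set 'I_n}.
Definition edge := (vertex * vertex)%type.
Definition tile := (proot n * vertex)%type.

Definition low (T : tile) : vertex := T.2.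
Definition left (T : tile) : vertex := (val T.1).1 |: T.2.
Definition right (T : tile) : vertex := (val T.1).2 |: T.2.
Definition top (T : tile) : vertex := (val T.1).1 |: ((val T.1).2 |: T.2).

Definition vertices (T : tile) : {set vertex} :=
  [set low T; left T; right T; top T].
Definition edges (T : tile) : {set edge} :=
  [set (low T, left T); (left T, top T); (low T, right T); (right T, top T)].

Definition left_boundary : {set vertex} :=
  [set [set s : 'I_n | (s < m)%N] | m : 'I_n.+1].
Definition right_boundary : {set vertex} :=
  [set [set s : 'I_n | (m <= s)%N] | m : 'I_n.+1].
Definition left_boundary_edges : {set edge} :=
  [set ([set x : 'I_n | (x < s)%N], [set x : 'I_n | (x <= s)%N]) | s : 'I_n].

Section Geometry.
Variable R : realType.

(* The s-th left edge of the regular 2n-gon of side length 1 with unique lowest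
   vertex v_0 = 0, clockwise from v_0: the n edge vectors lie in
   the upper half plane at successive angles pi / n, symmetric about the vertical
   axis, from left to right. *)
Definition dir (s : 'I_n) : 'rV[R]_2 :=
  let theta := pi - (s.*2.+1)%:R * pi / (n.*2)%:R in
  \row_j (if j == 0 then cos theta else sin theta).

Definition pos (S : vertex) : 'rV[R]_2 := \sum_(s in S) dir s.

Definition unit_itv (c : R) : Prop := 0 <= c /\ c <= 1.

(* The regular 2n-gon is centrally symmetric, hence the Minkowski sum of its
   left edges. *)
Definition polygon (p : 'rV[R]_2) : Prop :=
  exists c : 'I_n -> R,
    (forall s, unit_itv (c s)) /\ p = \sum_s c s *: dir s.

Definition in_tile (T : tile) (p : 'rV[R]_2) : Prop :=
  exists a b : R, [/\ unit_itv a, unit_itv b &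
    p = pos (low T) + a *: dir (val T.1).1 + b *: dir (val T.1).2].

Definition in_edge (e : edge) (p : 'rV[R]_2) : Prop :=
  exists c : R, unit_itv c /\ p = (1 - c) *: pos e.1 + c *: pos e.2.

(* Tilings by labelled tiles: the rhombi cover the 2n-gon, two of them meet
   along common faces only, and S is the set of labels of an edge path from v_0
   to v_S (distinct S can have the same [pos S], so S is not determined by the
   position alone, but it is by the tiling). *)
Definition is_tiling (P : {set tile}) : Prop :=
  [/\ forall T, T \in P -> (val T.1).1 \notin low T /\ (val T.1).2 \notin low T,
      forall p, polygon p <-> exists2 T, T \in P & in_tile T p,
      forall T T' p, T \in P -> T' \in P -> T != T' ->
        in_tile T p -> in_tile T' p ->
        (exists2 v, v \in vertices T :&: vertices T' & p = pos v) \/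
        (exists2 e, e \in edges T :&: edges T' & in_edge e p) &
      forall T v, T \in P -> v \in vertices T ->
        connect (fun x y => [exists T' in P, (x, y) \in edges T']) finset.set0 v].

End Geometry.

Section TileOrder.
Variable P : {set tile}.

Definition next_tiles (B : {set edge}) (U : {set tile}) : {set tile} :=
  [set T in P | (T \notin U) && (#|edges T :&: B| == 2)].

(* [sweep k] consists of B_(k+1) and of the union of the first k layers *)
Fixpoint sweep (k : nat) : {set edge} * {set tile} :=
  if k is k'.+1 then
    let: (B, U) := sweep k' in
    let L := next_tiles B U in
    ((B :\: (\bigcup_(T in L) edges T)) :|: \bigcup_(T in L) (edges T :\: B),
     U :|: L)
  else (left_boundary_edges, finset.set0).

Definition layer (k : nat) : {set tile} :=
  next_tiles (sweep k).1 (sweep k).2.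

Definition tile_step (T T' : tile) : Prop :=
  edges T :&: edges T' != finset.set0 /\
  exists k l : nat, [/\ (k < l)%N, T \in layer k & T' \in layer l].

Inductive tile_le : tile -> tile -> Prop :=
| TileLeRefl T : tile_le T T
| TileLeStep T T' T'' : tile_step T T' -> tile_le T' T'' -> tile_le T T''.

End TileOrder.

(* P is the tiling T_i *)
Definition is_tiling_of (R : realType) (i : word n) (P : {set tile}) : Prop :=
  is_tiling R P /\
  forall T T', T \in P -> T' \in P -> tile_le P T T' -> root_le i T.1 T'.1.

End Tilings.

Section RationalFunctions.
Variable k : fieldType.

Definition ratfun (I : finType) := {fraction (mpoly #|I| k)}.

Section Torus.
Variable I : finType.

Definition var (v : I) : ratfun I :=
  tofrac (mpolyX k (mnm1 (enum_rank v))).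

Definition const (c : k) : ratfun I := tofrac (mpolyC #|I| c).

Definition mono (e : {ffun I -> int}) : ratfun I := \prod_v var v ^ e v.

Definition laurent_expansion
    (f : ratfun I) (s : seq {ffun I -> int}) (c : {ffun I -> int} -> k) : Prop :=
  uniq s /\ f = \sum_(e <- s) const (c e) * mono e.

End Torus.

(* Substitution y in f, i.e. the composite of f with the rational map
   G_m^J --> G_m^I with components y; it is meaningful when the denominator of f
   does not vanish under the substitution, e.g. when the map is dominant. *)
Definition rcomp (I J : finType) (f : ratfun I) (y : I -> ratfun J) : ratfun J :=
  let ev := mmap (@const J) (fun m : 'I_#|I| => y (enum_val m)) in
  ev (frac (generic_quotient.repr f)).1 / ev (frac (generic_quotient.repr f)).2.

End RationalFunctions.

Section Rho.
Variable n : nat.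

(* N^(T_i); a tiling has exactly one tile [s,t] for each positive root *)
Definition nvec := {ffun proot n -> nat}.

Definition braid_map (st su tu : proot n) (x : nvec) : nvec :=
  let m := minn (x st) (x tu) in
  [ffun r => if r == st then (x st + x su - m)%N
             else if r == su then m
             else if r == tu then (x tu + x su - m)%N
             else x r].

(* y = phi^i_j x for words i, j related by one move *)
Definition transition (i j : word n) (x y : nvec) : Prop :=
  (comm_move i j /\ y = x) \/
  (exists st su tu, braid_move st su tu i j /\ y = braid_map st su tu x).

Definition incr (a : 'I_n.-1) (x : nvec) : nvec :=
  [ffun r => (x r + (r == simple_root a))%N].

(* y = f_a^* x in N^(T_i): conjugate by the transition maps, one move at a
   time, until a word ending with n - a is reached *)
Inductive fstar (a : 'I_n.-1) : word n -> nvec -> nvec -> Prop :=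
| FstarBase i x : ends_dual i a -> fstar a i x (incr a x)
| FstarMove i j x x' y' y :
    transition i j x x' -> fstar a j x' y' -> transition j i y' y ->
    fstar a i x y.

Definition Rstar (a : 'I_n.-1) (i : word n) : set {ffun proot n -> int} :=
  [set d | exists x y : nvec,
     fstar a i x y /\ d = [ffun r => (y r)%:Z - (x r)%:Z]]%classic.

(* Rstar a i is finite (the notation below gives 0 on infinite supports). *)
Definition rho (k : fieldType) (a : 'I_n.-1) (i : word n) :
    ratfun k (proot n) :=
  \sum_(d \in Rstar a i) mono k d.

End Rho.

Section XTori.
Variables (n : nat) (k : fieldType).
Implicit Types P : {set tile n}.

Definition Vset P : {set vertex n} :=
  (\bigcup_(T in P) vertices T) :\: left_boundary n.

Definition xvertex P := {v : vertex n | v \in Vset P}.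

(* x_S; the value 1 when v_S is not in V(P) is never used *)
Definition xcoord P (S : vertex n) : ratfun k (xvertex P) :=
  if insub S is Some v then var k (v : xvertex P) else 1.

(* orientation of the edges of T in the cycles l -> r -> o -> l and
   l -> r -> u -> l *)
Definition orients (T : tile n) (v w : vertex n) : bool :=
  (v, w) \in [set (right T, top T); (top T, left T);
                  (right T, low T); (low T, left T)].

Definition arrow P (v w : vertex n) : bool :=
  [&& v \in Vset P, w \in Vset P,
      ~~ ((v \in right_boundary n) && (w \in right_boundary n)) &
      [exists T in P, (v, w) == (left T, right T)] ||
      ([exists T in P, orients T v w] && ~~ [exists T in P, orients T w v])].

Definition exch P (v w : vertex n) : int := (arrow P v w)%:Z - (arrow P w v)%:Z.

(* The X-mutation from the torus of P to the torus of P', where P' = P or P'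
   arises from P by a flip: the old inner vertex w is the only vertex of P that
   is not a vertex of P', and the new one is the only vertex of P' that is not a
   vertex of P. *)
Definition mutation P P' (v : xvertex P') : ratfun k (xvertex P) :=
  if [pick w : xvertex P | val w \notin Vset P'] is Some w then
    if val v \in Vset P then
      let e := exch P (val v) (val w) in
      xcoord P (val v) * (1 + var k w ^ (- sgz e)) ^ (- e)
    else (var k w)^-1
  else xcoord P (val v).

(* W i a is the restriction of W_a to the torus of T i. Compatibility with the
   mutations along single moves amounts to compatibility with their composites. *)
Definition is_GHKK_potential (T : word n -> {set tile n})
    (W : forall i : word n, 'I_n.-1 -> ratfun k (xvertex (T i))) : Prop :=
  (forall i j a, reduced i -> reduced j -> move i j ->
     W i a = rcomp (W j a) (@mutation (T i) (T j))) /\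
  (forall i a, reduced i -> ends_dual i a ->
     W i a = (xcoord (T i) [set s : 'I_n | (a < s)%N])^-1).

Definition corner_sign (v : vertex n) (T : tile n) : int :=
  if v \in [set left T; right T] then -1
  else if v \in [set top T; low T] then 1 else 0.

Definition CA P (K : fieldType) (z : proot n -> K) (v : xvertex P) : K :=
  \prod_(T in P) z T.1 ^ corner_sign (val v) T.

Definition is_CA_inverse P (D : proot n -> ratfun k (xvertex P)) : Prop :=
  (forall v, CA D v = var k v) /\
  (forall r, rcomp (D r) (@CA P _ (@var k (proot n))) = var k r).

End XTori.

(* Main.v *)
(* Fix a. Call a set E of vertices a region if E meets the right boundary exactly
   in {a+1,...,n} and if, across every tile, membership in E propagates along the
   edges with labels > a upwards, along the other edges downwards, and from right
   to left if both labels are on the same side of a. Then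
     W_a = sum_E prod_(v in E) x_v^-1   and   f_a^* x = x + r_E,
   where E is the largest region that maximizes the function
   sum_T x_T ([r(T) in E] - [l(T) in E]), which is modular, and where r_E is the
   exponent of the pull-back of prod_(v in E) x_v^-1 under CA. Each of the two
   statements is invariant under the flip of a hexagon, because given the other
   vertices of a region, the possible memberships of the inner vertex obey a small
   case distinction; and both are clear if i_N = n - a, where {a+1,...,n} is the
   only region. Every region occurs as a maximizer, and E is determined by r_E.

   That T_i has the tiles [s,t;S] that are read off the prefixes of i is proved by
   sweeping a tiling from the left: points slightly to the right of an edge lie in
   exactly one tile, hence a path from the lowest to the highest vertex other than
   the right boundary has a tile on its right side that meets it in two edges. The
   layers order adjacent tiles from left to right, so that the order of T_i forces
   the sweep that follows i. *)
Require Import Defs.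
From mathcomp Require Import all_boot all_order all_algebra all_fingroup.
From mathcomp Require Import all_classical all_reals all_analysis.
From mathcomp Require Import fintype finset zify ring lra.
From mathcomp Require mpoly.
Import -(notations) mpoly.
Set Implicit Arguments.
Unset Strict Implicit.
Unset Printing Implicit Defensive.
Import Order.TTheory GRing.Theory Num.Theory.
Local Open Scope ring_scope.
Local Notation roots := Defs.roots.

(** * Words and chamber sets *)

(** Regions are closed under union and intersection and the weight is modular, so a largest
    maximizer makes sense. Largest rather than smallest is forced by the crystal: where the inner
    vertex of a hexagon is free, it is taken exactly if its contribution is nonnegative, and with
    this tie rule x and x + r_E lie on the same closed side of the wall where the minimum in the
    braid map switches, so that the braid map acts on both by one linear formula. Both [fstar] and W
    are given only along single moves. Everything therefore rests on a weak form of the theorem of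
    Matsumoto and Tits: any reduced word can be moved to one ending in n - a. That E is determined
    by r_E and that CA is invertible have one cause: a tile relation among four corners determines
    the value at the right corner, and the left boundary starts the recursion. [rcomp] evaluates
    numerator and denominator separately, so each substitution must be shown not to kill
    polynomials. This is done by exhibiting an inverse substitution, through a relation that makes
    sense before either map is known to be injective. *)

Section WordTheory.
Variable n : nat.
Implicit Types (p q i j : word n) (l m : 'I_n.-1) (x y s t : 'I_n).

Lemma sigmaE l x :
  sigma l x = (if x == l :> nat then l.+1
               else if x == l.+1 :> nat then l : nat else x) :> nat.
Proof.
rewrite /sigma; case: tpermP => [->|->|/eqP + /eqP] /=.
- by rewrite eqxx.
- by rewrite gtn_eqF // eqxx.
- by rewrite -!val_eqE /= => /negPf-> /negPf->.
Qed.

Lemma sigmaK l : involutive (sigma l).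
Proof. exact: tpermK. Qed.

Lemma sigma_lo l : sigma l (lo l) = hi l. Proof. exact: tpermL. Qed.
Lemma sigma_hi l : sigma l (hi l) = lo l. Proof. exact: tpermR. Qed.

Lemma wact_cat p q x : wact (p ++ q) x = wact p (wact q x).
Proof. by rewrite /wact foldr_cat. Qed.

Lemma wact_rcons p l x : wact (rcons p l) x = wact p (sigma l x).
Proof. by rewrite -cats1 wact_cat. Qed.

(** The inverse permutation of [wact p]: the height at which the label x occurs on the path reached
    after p. *)
Definition wpos p x : 'I_n := wact (rev p) x.

Lemma wpos_nil x : wpos [::] x = x. Proof. by []. Qed.

Lemma wpos_rcons p l x : wpos (rcons p l) x = sigma l (wpos p x).
Proof. by rewrite /wpos rev_rcons. Qed.

Lemma wactK p : cancel (wact p) (wpos p).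
Proof.
elim/last_ind: p => [|p l IH] x //.
by rewrite wpos_rcons wact_rcons IH sigmaK.
Qed.

Lemma wposK p : cancel (wpos p) (wact p).
Proof.
elim/last_ind: p => [|p l IH] x //.
by rewrite wpos_rcons wact_rcons sigmaK IH.
Qed.

Lemma eq_wpos p q : wact p =1 wact q -> wpos p =1 wpos q.
Proof. by move=> e x; apply: (can_inj (wactK q)); rewrite -e !wposK. Qed.

Lemma roots_cat p q :
  roots (p ++ q) = roots p ++ [seq (wact p r.1, wact p r.2) | r <- roots q].
Proof.
elim: p => [|l p IH] /=; first by rewrite (eq_map (g := id)) ?map_id // => -[].
by rewrite IH map_cat -map_comp.
Qed.

Lemma roots_rcons p l :
  roots (rcons p l) = rcons (roots p) (wact p (lo l), wact p (hi l)).
Proof. by rewrite -cats1 roots_cat /= cats1. Qed.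

Lemma size_roots i : size (roots i) = size i.
Proof. by elim: i => //= l i IH; rewrite size_map IH. Qed.

Lemma roots_split i r : r \in roots i ->
  exists p l q, i = p ++ l :: q /\ r = (wact p (lo l), wact p (hi l)).
Proof.
elim/last_ind: i => // i l IH; rewrite roots_rcons mem_rcons inE.
case/orP => [/eqP->|/IH [p [m [q [-> ->]]]]].
  by exists i, l, [::]; rewrite cats1.
by exists p, m, (rcons q l); rewrite rcons_cat.
Qed.

Lemma nth_roots p l q r0 :
  nth r0 (roots (p ++ l :: q)) (size p) = (wact p (lo l), wact p (hi l)).
Proof. by rewrite roots_cat nth_cat size_roots ltnn subnn. Qed.

(* i is a reduced expression, of an arbitrary permutation. *)
Definition asc i := all (fun r : 'I_n * 'I_n => r.1 < r.2)%N (roots i).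

Lemma asc_cat p q : asc (p ++ q) -> asc p.
Proof. by rewrite /asc roots_cat all_cat => /andP[]. Qed.

Lemma asc_rcons p l :
  asc (rcons p l) = (wact p (lo l) < wact p (hi l))%N && asc p.
Proof. by rewrite /asc roots_rcons all_rcons. Qed.

Lemma asc_step p l q : asc (p ++ l :: q) -> (wact p (lo l) < wact p (hi l))%N.
Proof. by rewrite -cat_rcons => /asc_cat; rewrite asc_rcons => /andP[]. Qed.

Lemma sigma_lt l x y : x != y ->
  (sigma l x < sigma l y)%N =
  (if (x == lo l) && (y == hi l) then false
   else if (x == hi l) && (y == lo l) then true else (x < y)%N).
Proof.
rewrite !sigmaE -!val_eqE /=; move: (nat_of_ord x) (nat_of_ord y) (nat_of_ord l).
move=> {}x {}y {}l; case: (ltngtP x l); case: (ltngtP y l); case: (ltngtP x l.+1);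
  case: (ltngtP y l.+1) => /= *; lia.
Qed.

Definition inv_set p : {set 'I_n * 'I_n} :=
  [set r : 'I_n * 'I_n | (r.1 < r.2)%N && (wpos p r.2 < wpos p r.1)%N].

(** The letter l exchanges the labels at two adjacent heights, so only the relative order of this
    one pair changes. *)
Lemma inv_rcons p l :
  inv_set (rcons p l) =
  if (wact p (lo l) < wact p (hi l))%N
  then (wact p (lo l), wact p (hi l)) |: inv_set p
  else inv_set p :\ (wact p (hi l), wact p (lo l)).
Proof.
have posE x y : (wpos p x == y) = (x == wact p y).
  by rewrite -[LHS](inj_eq (can_inj (wactK p))) wposK.
have lohi : (wact p (lo l) == wact p (hi l)) = false.
  rewrite (inj_eq (can_inj (wactK p))) -val_eqE /=; lia.
apply/setP=> -[s t]; rewrite inE /= !wpos_rcons.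
have [lt_st|] := ltnP s t; last first.
  move=> le_ts; case: (boolP (wact p (lo l) < wact p (hi l))%N) => lt; rewrite !inE /= -?[(s,
    t) == _]/((s == _) && (t == _)) ltnNge le_ts /= ?andbF ?orbF //.
  by apply/esym/negP => /andP[/eqP es /eqP et]; move: le_ts; rewrite es et leqNgt lt.
rewrite sigma_lt; last first.
  by rewrite (inj_eq (can_inj (wposK p))) -val_eqE /= gtn_eqF.
rewrite !posE /=.
case: (boolP (wact p (lo l) < wact p (hi l))%N) => lt; rewrite !inE /= -?[(s,
  t) == _]/((s == _) && (t == _)) lt_st /=.
  have -> : (t == wact p (lo l)) && (s == wact p (hi l)) = false.
    by apply/negP => /andP[/eqP et /eqP es]; move: lt_st; rewrite es et; lia.
  by rewrite andbC; case: (_ && _).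
have -> : (t == wact p (hi l)) && (s == wact p (lo l)) = false.
  by apply/negP => /andP[/eqP et /eqP es]; move: lt_st; rewrite es et; lia.
by rewrite andbC; case: (_ && _).
Qed.

(** A letter with a positive root creates at most one inversion and any other letter only removes
    one. For w_0, which inverts all pairs, the bound forces every root of a word of length 'C(n, 2)
    to be positive, see [reduced_asc]. *)
Lemma card_inv_set p :
  (#|inv_set p| <= count (fun r : 'I_n * 'I_n => r.1 < r.2)%N (roots p))%N.
Proof.
elim/last_ind: p => [|p l IH].
  by rewrite leqn0 cards_eq0; apply/eqP/setP=> -[s t]; rewrite !inE /= !wpos_nil; lia.
rewrite inv_rcons roots_rcons -cats1 count_cat /= addn0.
case: (boolP (wact p (lo l) < wact p (hi l))%N) => lt.
  by rewrite cardsU1 (leq_trans (leq_add (leq_b1 _) IH)) // addnC.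
by rewrite addn0 (leq_trans _ IH) // subset_leq_card // subsetDl.
Qed.

Lemma asc_inv i s t : asc i -> (s < t)%N ->
  ((s, t) \in roots i) = (wpos i t < wpos i s)%N.
Proof.
move=> + lt_st; have -> : (wpos i t < wpos i s)%N = ((s, t) \in inv_set i).
  by rewrite inE /= lt_st.
elim/last_ind: i => [|i l IH].
  by rewrite in_nil inE /= !wpos_nil; lia.
rewrite asc_rcons => /andP[lt /IH {}IH].
by rewrite roots_rcons mem_rcons inE IH inv_rcons lt in_setU1.
Qed.

Lemma asc_uniq i : asc i -> uniq (roots i).
Proof.
elim/last_ind: i => // i l IH.
rewrite asc_rcons roots_rcons rcons_uniq => /andP[lt ai].
by rewrite IH // andbT asc_inv // !wactK -leqNgt.
Qed.

Lemma card_pairs : #|[set r : 'I_n * 'I_n | (r.1 < r.2)%N]| = 'C(n, 2).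
Proof.
rewrite -sum1dep_card (eq_bigl (fun r : 'I_n * 'I_n => true && (r.1 < r.2)%N)) //.
rewrite -(pair_big_dep xpredT (fun a b : 'I_n => (a < b)%N) (fun _ _ => 1%N)) /=.
rewrite (exchange_big_dep xpredT) //= -triangular_sum big_mkord; apply: eq_bigr => t _.
by rewrite -(big_ord_widen n (fun=> 1%N) (ltnW (ltn_ord t))) sum1_card card_ord.
Qed.

Lemma reduced_asc i : reduced i -> asc i.
Proof.
case=> sz e; rewrite /asc all_count size_roots sz eqn_leq.
rewrite -{1}sz -{1}size_roots count_size /=.
apply: leq_trans (card_inv_set i); rewrite -card_pairs subset_leq_card //.
apply/subsetP => -[s t]; rewrite !inE /= => lt; rewrite lt /=.
have es x : wpos i x = rev_ord x.
  by apply: (can_inj (wactK i)); rewrite wposK e rev_ordK.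
by rewrite !es /=; have := ltn_ord t; lia.
Qed.

Lemma reduced_root i s t : reduced i -> (s < t)%N -> (s, t) \in roots i.
Proof.
move=> ri lt; rewrite asc_inv ?(reduced_asc ri) //.
have es x : wpos i x = rev_ord x.
  by apply: (can_inj (wactK i)); rewrite wposK ri.2 rev_ordK.
by rewrite !es /=; have := ltn_ord t; lia.
Qed.

Lemma asc_reduced i : asc i -> wact i =1 @rev_ord n -> reduced i.
Proof.
move=> ai e; split=> //; rewrite -size_roots -card_pairs.
have es x : wpos i x = rev_ord x.
  by apply: (can_inj (wactK i)); rewrite wposK e rev_ordK.
rewrite -(card_uniqP (asc_uniq ai)); apply: eq_card => -[s t].
rewrite inE /=; apply/idP/idP => [|lt].
  by move: ai => /allP h /h.
by rewrite asc_inv // !es /=; have := ltn_ord t; lia.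
Qed.

Lemma sigma_far l m : (l.+1 < m)%N || (m.+1 < l)%N ->
  (sigma l (lo m) = lo m) * (sigma l (hi m) = hi m).
Proof.
move=> far; split; apply/val_inj; rewrite /= sigmaE /=;
  by do ![case: eqP] => *; lia.
Qed.

Lemma sigma_comm l m : (l.+1 < m)%N || (m.+1 < l)%N ->
  forall x, sigma l (sigma m x) = sigma m (sigma l x).
Proof.
move=> far x; apply/val_inj; rewrite /= !sigmaE.
move: (nat_of_ord x) (nat_of_ord l) (nat_of_ord m) far => {}x {}l {}m far.
by do ![case: eqP] => *; lia.
Qed.

Lemma sigma_braid l m : l.+1 = m :> nat ->
  forall x, sigma l (sigma m (sigma l x)) = sigma m (sigma l (sigma m x)).
Proof.
move=> adj x; apply/val_inj; rewrite /= !sigmaE -adj; clear adj.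
move: (nat_of_ord x) (nat_of_ord l) => {}x {}l.
case: (ltngtP x l) => h1; case: (ltngtP x l.+1) => h2; case: (ltngtP x l.+2) => h3;
  try lia; by do ![case: eqP] => *; lia.
Qed.

Lemma adj_lo l m : l.+1 = m :> nat -> lo m = hi l.
Proof. by move=> adj; apply/val_inj. Qed.

Lemma sigma_adj l m : l.+1 = m :> nat ->
  ((lo m = hi l) * (sigma l (lo l) = hi l) * (sigma l (hi l) = lo l) *
   (sigma l (hi m) = hi m) * (sigma m (lo l) = lo l) * (sigma m (hi l) = hi m) *
   (sigma m (hi m) = hi l))%type.
Proof.
move=> adj; have e := adj_lo adj.
do !split; rewrite ?sigma_lo ?sigma_hi //; try by rewrite -e ?sigma_lo ?sigma_hi.
  by apply/val_inj; rewrite /= sigmaE /=; do ![case: eqP] => *; lia.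
by apply/val_inj; rewrite /= sigmaE /=; do ![case: eqP] => *; lia.
Qed.

Lemma roots_braid l m : l.+1 = m :> nat ->
  roots [:: l; m; l] = [:: (lo l, hi l); (lo l, hi m); (hi l, hi m)].
Proof. by move=> adj; rewrite /= !(sigma_adj adj). Qed.

Lemma roots_braid' l m : l.+1 = m :> nat ->
  roots [:: m; l; m] = [:: (hi l, hi m); (lo l, hi m); (lo l, hi l)].
Proof. by move=> adj; rewrite /= !(sigma_adj adj). Qed.

Lemma move_perm i j : move i j ->
  perm_eq (roots i) (roots j) /\ wact i =1 wact j.
Proof.
have catE p u v q : perm_eq (roots u) (roots v) -> wact u =1 wact v ->
    perm_eq (roots (p ++ u ++ q)) (roots (p ++ v ++ q)) /\
    wact (p ++ u ++ q) =1 wact (p ++ v ++ q).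
  move=> puv euv; split=> [|x]; last by rewrite !wact_cat euv.
  rewrite !roots_cat perm_cat2l perm_map //.
  have -> : [seq (wact u r.1, wact u r.2) | r <- roots q] =
            [seq (wact v r.1, wact v r.2) | r <- roots q].
    by apply: eq_map => r; rewrite !euv.
  by rewrite perm_cat2r.
case=> [[p [q [l [m [far -> ->]]]]]|[st [su [tu [p [q [l [m [adj eij _ _ _]]]]]]]]].
  apply: catE => [|x]; last by rewrite /= sigma_comm.
  have [e1 e2] := sigma_far far.
  have [e3 e4] := @sigma_far m l (etrans (orbC _ _) far).
  by rewrite /= e1 e2 e3 e4 (perm_catC [:: _] [:: _]).
have pe : perm_eq (roots [:: l; m; l]) (roots [:: m; l; m]).
  rewrite roots_braid // roots_braid' // -(perm_rev (_ :: _)) /=.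
  exact: perm_refl.
have ee x : wact [:: l; m; l] x = wact [:: m; l; m] x by rewrite /= sigma_braid.
case: eij => -[-> ->]; apply: catE => //; by rewrite perm_sym.
Qed.

Lemma move_rcons i j l : move i j -> move (rcons i l) (rcons j l).
Proof.
case=> [[p [q [a [b [far -> ->]]]]]|[st [su [tu [p [q [a [b [adj eij e1 e2 e3]]]]]]]]].
  by left; exists p, (rcons q l), a, b; rewrite -!rcons_cat.
right; exists st, su, tu, p, (rcons q l), a, b; split=> //.
by case: eij => -[-> ->]; [left|right]; rewrite -!rcons_cat.
Qed.

Lemma move_sym i j : move i j -> move j i.
Proof.
case=> [[p [q [a [b [far -> ->]]]]]|[st [su [tu [p [q [a [b [adj eij e1 e2 e3]]]]]]]]].
  by left; exists p, q, b, a; split; rewrite // orbC.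
right; exists st, su, tu, p, q, a, b; split=> //.
by case: eij => -[-> ->]; [right|left].
Qed.

Lemma move_asc i j : move i j -> asc i -> asc j.
Proof. by case/move_perm=> /perm_all e _; rewrite /asc e. Qed.

Lemma move_reduced i j : move i j -> reduced i -> reduced j.
Proof.
case/move_perm=> /perm_size; rewrite !size_roots => sz e [si ei].
by split=> [|x]; rewrite -?sz // -e.
Qed.

Lemma braid_asc p q l m : l.+1 = m :> nat ->
  asc (p ++ [:: l; m; l] ++ q) ->
  exists st su tu, braid_move st su tu (p ++ [:: l; m; l] ++ q)
                                       (p ++ [:: m; l; m] ++ q).
Proof.
move=> adj; rewrite /asc !roots_cat roots_braid // !all_cat /=.
case/and5P=> _ lt_st lt_su lt_tu _.
exists (exist _ (_, _) lt_st), (exist _ (_, _) lt_su), (exist _ (_, _) lt_tu).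
by exists p, q, l, m; split=> //; left.
Qed.

Lemma braid_asc' p q l m : l.+1 = m :> nat ->
  asc (p ++ [:: m; l; m] ++ q) ->
  exists st su tu, braid_move st su tu (p ++ [:: m; l; m] ++ q)
                                       (p ++ [:: l; m; l] ++ q).
Proof.
move=> adj; rewrite /asc !roots_cat roots_braid' // !all_cat /=.
case/and5P=> _ lt_tu lt_su lt_st _.
exists (exist _ (_, _) lt_st), (exist _ (_, _) lt_su), (exist _ (_, _) lt_tu).
by exists p, q, l, m; split=> //; right.
Qed.

Inductive moves : word n -> word n -> Prop :=
| MovesRefl i : moves i i
| MovesStep i j k : move i j -> moves j k -> moves i k.

Lemma moves_trans i j k : moves i j -> moves j k -> moves i k.
Proof. by elim=> // i1 j1 k1 ij _ IH jk; apply: MovesStep ij (IH jk). Qed.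

Lemma moves_rcons i j l : moves i j -> moves (rcons i l) (rcons j l).
Proof.
elim=> [k|i1 j1 k1 ij _ IH]; first exact: MovesRefl.
exact: MovesStep (move_rcons l ij) IH.
Qed.

Lemma moves_size i j : moves i j -> size i = size j.
Proof.
elim=> // i1 j1 k1 /move_perm[/perm_size + _] _ <-.
by rewrite !size_roots.
Qed.

Lemma moves_asc i j : moves i j -> asc i -> asc j /\ wact i =1 wact j.
Proof.
elim=> // i1 j1 k1 ij _ IH /(move_asc ij)/IH[ak e]; split=> // x.
by rewrite -e; have [_ ->] := move_perm ij.
Qed.

(** The exchange step of the theorem of Matsumoto and Tits, by induction on the length. Let c be the
    last letter. If c is far from b, the descent at b is already one of the word before c, and the
    two letters commute. If they are adjacent, the images of three consecutive indices are
    decreasing, so that the word can be moved to end in c b c, and a braid move produces the final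
    b. *)
Lemma moves_descent i b : asc i -> (wact i (hi b) < wact i (lo b))%N ->
  exists i', moves i (rcons i' b).
Proof.
have [N] := ubnP (size i); elim: N => // N IH in i b *.
case/lastP: i => [_ _ /=|v c]; first by lia.
rewrite size_rcons ltnS => szv; rewrite asc_rcons => /andP[lt_c av] desc.
have far_or : [\/ b = c, (b.+1 < c)%N || (c.+1 < b)%N, c.+1 = b :> nat | b.+1 = c :> nat].
  case: (ltngtP b c) => [lt|lt|/val_inj ->]; last by constructor 1.
    by case: (ltngtP b.+1 c) => h; [constructor 2|lia|constructor 4].
  by case: (ltngtP c.+1 b) => h; [constructor 2; rewrite orbT|lia|constructor 3].
case: far_or => [->|far|adj|adj]; first by exists v; apply: MovesRefl.
- have far' : (c.+1 < b)%N || (b.+1 < c)%N by rewrite orbC.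
  have [e1 e2] := sigma_far far'.
  rewrite !wact_rcons e1 e2 in desc.
  have [v' mv] := IH v b szv av desc; exists (rcons v' c).
  apply: moves_trans (moves_rcons c mv) (MovesStep _ (MovesRefl _)); left.
  by exists v', [::], b, c; rewrite far -!cats1 -!catA.
- have e := sigma_adj adj; rewrite !wact_rcons !e in desc.
  have [|v' mv] := IH v b szv av; first by rewrite !e; lia.
  have [] := moves_asc mv av; rewrite asc_rcons => /andP[_ av'] ev'.
  have szv' : (size v' < N)%N by have := moves_size mv; rewrite size_rcons; lia.
  (* Removing b from v has brought the smallest of the three labels next to the middle one, which is
     a descent at c. The induction applies since v' is shorter than v. *)
  have [|w mw] := IH v' c szv' av'.
    by move: (ev' (lo c)) (ev' (hi b)); rewrite !wact_rcons !e => <- <-.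
  have [] := moves_asc mw av'; rewrite asc_rcons => /andP[_ aw] ew.
  have mvw : moves (rcons v c) (w ++ [:: c; b; c] ++ [::]).
    have -> : w ++ [:: c; b; c] ++ [::] = rcons (rcons (rcons w c) b) c.
      by rewrite -!cats1 -!catA.
    by apply: moves_rcons; apply: moves_trans mv (moves_rcons b mw).
  have arc : asc (rcons v c) by rewrite asc_rcons lt_c.
  have [st [su [tu br]]] := braid_asc adj (moves_asc mvw arc).1.
  exists (w ++ [:: b; c]); apply: moves_trans mvw (MovesStep _ (MovesRefl _)).
  by rewrite -cats1 -catA; right; exists st, su, tu; rewrite cats0 in br *.
- have e := sigma_adj adj; rewrite !wact_rcons !e in desc lt_c.
  have [|v' mv] := IH v b szv av; first by lia.
  have [] := moves_asc mv av; rewrite asc_rcons => /andP[_ av'] ev'.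
  have szv' : (size v' < N)%N by have := moves_size mv; rewrite size_rcons; lia.
  have [|w mw] := IH v' c szv' av'.
    by move: (ev' (lo b)) (ev' (hi c)); rewrite !wact_rcons !e => <- <-.
  have [] := moves_asc mw av'; rewrite asc_rcons => /andP[_ aw] ew.
  have mvw : moves (rcons v c) (w ++ [:: c; b; c] ++ [::]).
    have -> : w ++ [:: c; b; c] ++ [::] = rcons (rcons (rcons w c) b) c.
      by rewrite -!cats1 -!catA.
    by apply: moves_rcons; apply: moves_trans mv (moves_rcons b mw).
  have arc : asc (rcons v c) by rewrite asc_rcons !e lt_c.
  have [st [su [tu br]]] := braid_asc' adj (moves_asc mvw arc).1.
  exists (w ++ [:: b; c]); apply: moves_trans mvw (MovesStep _ (MovesRefl _)).
  by rewrite -cats1 -catA; right; exists st, su, tu; rewrite cats0 in br *.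
Qed.

Lemma reduced_ends_dual i (a : 'I_n.-1) : reduced i ->
  exists2 j, moves i j & ends_dual j a.
Proof.
move=> ri; have [|i' mi] := moves_descent (b := rev_ord a) (reduced_asc ri).
  by rewrite !ri.2 /=; have := ltn_ord a; lia.
by exists (rcons i' (rev_ord a)) => //; exists i'.
Qed.

End WordTheory.

(** * Vertices and tiles read off the prefixes of a word *)

Section Chambers.
Variable n : nat.
Implicit Types (p q i j : word n) (l m : 'I_n.-1) (x y s t : 'I_n).
Implicit Types (S v : vertex n) (T : tile n).

(* The h-th vertex of the path from the lowest to the highest vertex that is
   reached from the left boundary by the flips of the letters of p. *)
Definition cham p h : vertex n := [set y | (wpos p y < h)%N].

Definition tile_at p l T : bool :=
  (val T.1 == (wact p (lo l), wact p (hi l))) && (low T == cham p l).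

Definition tiles i : {set tile n} :=
  [set T | `[< exists p l q, i = p ++ l :: q /\ tile_at p l T >]].

Lemma tilesP i T :
  reflect (exists p l q, i = p ++ l :: q /\ tile_at p l T) (T \in tiles i).
Proof. by rewrite inE; apply: asboolP. Qed.

Lemma tile_at_exists p l q : asc (p ++ l :: q) ->
  exists2 T, tile_at p l T & T \in tiles (p ++ l :: q).
Proof.
move=> /asc_step lt; pose T : tile n := (exist _ (_, _) lt, cham p l).
have tT : tile_at p l T by rewrite /tile_at !eqxx.
by exists T => //; apply/tilesP; exists p, l, q.
Qed.

Lemma eq_cham p q : wact p =1 wact q -> cham p =1 cham q.
Proof. by move=> e h; apply/setP=> y; rewrite !inE (eq_wpos e). Qed.

Lemma cham0 p : cham p 0 = set0.
Proof. by apply/setP=> y; rewrite !inE. Qed.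

Lemma cham_full p : cham p n = setT.
Proof. by apply/setP=> y; rewrite !inE ltn_ord. Qed.

Lemma chamS p x : cham p x.+1 = wact p x |: cham p x.
Proof.
apply/setP=> y; rewrite !inE ltnS leq_eqVlt; congr (_ || _).
by rewrite -(inj_eq (can_inj (wposK p))) wactK.
Qed.

Lemma cham_notin p x : wact p x \notin cham p x.
Proof. by rewrite inE wactK ltnn. Qed.

Lemma cham_rcons p l h : h != l.+1 -> cham (rcons p l) h = cham p h.
Proof.
move=> ne; apply/setP=> y; rewrite !inE wpos_rcons sigmaE.
by move: (nat_of_ord (wpos p y)) => z; case: eqP => [->|_]; [|case: eqP => [->|_ //]];
  apply/idP/idP => *; lia.
Qed.

Lemma cham_rcons_eq p l : cham (rcons p l) l.+1 = wact p (hi l) |: cham p l.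
Proof.
rewrite -[cham p l](@cham_rcons p l); last by rewrite ltn_eqF.
by rewrite (chamS _ (lo l)) wact_rcons sigma_lo.
Qed.

Lemma tile_atE p l T : tile_at p l T ->
  [/\ low T = cham p l, left T = cham p l.+1,
      right T = cham (rcons p l) l.+1 & Defs.top T = cham p l.+2].
Proof.
case/andP=> /eqP e /eqP f; rewrite /left /right /Defs.top e /= -!/(low T) f.
rewrite cham_rcons_eq (chamS p (lo l)); split=> //.
by rewrite setUCA -(chamS p (lo l)) -(chamS p (hi l)).
Qed.

Lemma card_cham p h : (h <= n)%N -> #|cham p h| = h.
Proof.
elim: h => [|h IH] lt; first by rewrite cham0 cards0.
rewrite (chamS p (Ordinal lt)) cardsU1 cham_notin /= IH //; exact: ltnW.
Qed.

(** A monovariant of the sweep: passing a tile [s,t] replaces its left corner by its right corner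
    and adds t - s > 0. Hence a vertex that the path has left never returns. *)
Definition wt S := (\sum_(s in S) s)%N.

Lemma wtU1 s S : s \notin S -> wt (s |: S) = (s + wt S)%N.
Proof. by move=> ns; rewrite /wt big_setU1. Qed.

Lemma wt_step p l : asc (rcons p l) ->
  (wt (cham p l.+1) < wt (cham (rcons p l) l.+1))%N.
Proof.
rewrite asc_rcons => /andP[lt _].
rewrite cham_rcons_eq (chamS p (lo l)) !wtU1 ?cham_notin ?ltn_add2r //.
by rewrite inE wactK -leqNgt.
Qed.

Lemma wt_mono p q h : asc (p ++ q) -> (wt (cham p h) <= wt (cham (p ++ q) h))%N.
Proof.
elim/last_ind: q => [|q l IH]; first by rewrite cats0.
rewrite -rcons_cat => aq; apply: leq_trans (IH _) _.
  by move: aq; rewrite asc_rcons => /andP[].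
have [->|ne] := eqVneq h l.+1; first exact/ltnW/wt_step.
by rewrite cham_rcons.
Qed.

Lemma tiles_cat p q T : T \in tiles p -> T \in tiles (p ++ q).
Proof.
move=> /tilesP[p1 [l [p2 [-> tT]]]]; apply/tilesP.
by exists p1, l, (p2 ++ q); rewrite -catA.
Qed.

(** A vertex of an intermediate path either survives to the final path or is removed by a letter,
    and then it is the left corner of the tile of that letter. *)
Lemma cham_removed p q h : asc (p ++ q) ->
  cham p h = cham (p ++ q) h \/ exists2 T, T \in tiles (p ++ q) & left T = cham p h.
Proof.
elim: q p => [|l q IH] p aq; first by left; rewrite cats0.
have [->|ne] := eqVneq h l.+1.
  have [T tT Ti] := tile_at_exists aq.
  by right; exists T => //; have [_ -> _ _] := tile_atE tT.
by rewrite -[cham p h](cham_rcons p ne) -cat_rcons; apply: IH; rewrite cat_rcons.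
Qed.

Lemma tiles_vertices i T v : T \in tiles i -> v \in vertices T ->
  exists p q h, [/\ i = p ++ q, (h <= n)%N & v = cham p h].
Proof.
move=> /tilesP[p [l [q [-> /tile_atE[e1 e2 e3 e4]]]]].
have ltl : (l.+1 < n)%N := ltn_ord (hi l).
rewrite !inE e1 e2 e3 e4 => /orP[/orP[/orP[]|]|] /eqP->.
- by exists p, (l :: q), l; split=> //; lia.
- by exists p, (l :: q), l.+1; split=> //; lia.
- by exists (rcons p l), q, l.+1; split; rewrite ?cat_rcons //; lia.
- by exists p, (l :: q), l.+2.
Qed.

Lemma in_left_boundary h : (h <= n)%N -> cham [::] h \in left_boundary n.
Proof.
move=> le; have le' : (h < n.+1)%N by [].
by apply/imsetP; exists (Ordinal le') => //; apply/setP=> y; rewrite !inE wpos_nil.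
Qed.

Lemma left_boundaryP v :
  reflect (exists2 h, (h <= n)%N & v = cham [::] h) (v \in left_boundary n).
Proof.
apply: (iffP imsetP) => [[m _ ->]|[h le ->]].
  exists m; first by rewrite -ltnS.
  by apply/setP=> y; rewrite !inE.
have le' : (h < n.+1)%N by [].
by exists (Ordinal le') => //; apply/setP=> y; rewrite !inE wpos_nil.
Qed.

Lemma reduced_pos i y : reduced i -> wpos i y = rev_ord y.
Proof. by move=> ri; apply: (can_inj (wactK i)); rewrite wposK ri.2 rev_ordK. Qed.

Lemma right_boundaryP i v : reduced i ->
  reflect (exists2 h, (h <= n)%N & v = cham i h) (v \in right_boundary n).
Proof.
move=> ri; apply: (iffP imsetP) => [[m _ ->]|[h le ->]].
  exists (n - m)%N; first exact: leq_subr.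
  apply/setP=> y; rewrite !inE reduced_pos //=.
  by have := ltn_ord y; have := ltn_ord m; lia.
have le' : (n - h < n.+1)%N by rewrite ltnS leq_subr.
exists (Ordinal le') => //; apply/setP=> y; rewrite !inE reduced_pos //=.
by have := ltn_ord y; lia.
Qed.

(** The roots of an ascending word are distinct, so the root of a tile recovers the position of its
    letter. *)
Lemma tiles_root_inj i T T' : asc i -> T \in tiles i -> T' \in tiles i ->
  T.1 = T'.1 -> T = T'.
Proof.
move=> ai /tilesP[p [l [q [e tT]]]] /tilesP[p' [l' [q' [e' tT']]]] eT.
have /andP[/eqP r1 /eqP s1] := tT; have /andP[/eqP r2 /eqP s2] := tT'.
have szp : size p = size p'.
  apply/eqP; rewrite -(nth_uniq (val T.1) _ _ (asc_uniq ai)) ?size_roots.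
  - by rewrite {1}e e' !nth_roots -r1 -r2 eT.
  - by rewrite e size_cat /=; lia.
  - by rewrite e' size_cat /=; lia.
have /eqP := e; rewrite e'.
rewrite eqseq_cat // => /andP[/eqP ep /eqP[el _]].
by rewrite [T]surjective_pairing [T']surjective_pairing eT -!/(low _) s1 s2 ep el.
Qed.

Lemma tiles_root i (r : proot n) : reduced i -> exists2 T, T \in tiles i & T.1 = r.
Proof.
move=> ri; have := reduced_root ri (valP r); rewrite -surjective_pairing.
move=> /roots_split[p [l [q [e er]]]].
exists (r, cham p l) => //; apply/tilesP; exists p, l, q; split=> //.
by rewrite /tile_at er !eqxx.
Qed.

Lemma tiles_Vset_left i v : reduced i -> v \in Vset (tiles i) ->
  v \notin right_boundary n -> exists2 T, T \in tiles i & left T = v.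
Proof.
move=> ri; rewrite inE => /andP[nl /bigcupP[T Ti vT]] nr.
have [p [q [h [e le ev]]]] := tiles_vertices Ti vT.
have := reduced_asc ri; rewrite e => ap.
case: (cham_removed h ap) => [e'|[T' T'i e']]; last by exists T'; rewrite ?ev.
case/negP: nr; apply/(right_boundaryP _ ri); exists h => //.
by rewrite e -e'.
Qed.

Lemma wt_lt_tile i T : asc i -> T \in tiles i -> (wt (left T) < wt (right T))%N.
Proof.
move=> ai /tilesP[p [l [q [e /tile_atE[_ -> -> _]]]]]; apply: wt_step.
by move: ai; rewrite e -cat_rcons => /asc_cat.
Qed.

End Chambers.

(* b tells whether the label of the edge is larger than the fixed a. *)
Definition edge_ok (b lower upper : bool) : bool :=
  if b then lower ==> upper else upper ==> lower.

Definition corners_ok (bs bt u l r o : bool) : bool :=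
  [&& edge_ok bs u l, edge_ok bt l o, edge_ok bt u r, edge_ok bs r o &
      (bs == bt) ==> r ==> l].

(** Every condition is an implication between two memberships, with direction fixed by the labels;
    such conditions are stable under union and intersection. *)
Lemma corners_okU bs bt u l r o u' l' r' o' :
  corners_ok bs bt u l r o -> corners_ok bs bt u' l' r' o' ->
  corners_ok bs bt (u || u') (l || l') (r || r') (o || o').
Proof. by move: bs bt u l r o u' l' r' o'; do 10!case=> //. Qed.

Lemma corners_okI bs bt u l r o u' l' r' o' :
  corners_ok bs bt u l r o -> corners_ok bs bt u' l' r' o' ->
  corners_ok bs bt (u && u') (l && l') (r && r') (o && o').
Proof. by move: bs bt u l r o u' l' r' o'; do 10!case=> //. Qed.

(** * Regions and their lattice structure *)

Section Regions.
Variable n : nat.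
Implicit Types (p q i j : word n) (l m : 'I_n.-1) (x y s t : 'I_n).
Implicit Types (S v : vertex n) (T : tile n) (P : {set tile n}).
Implicit Types (a : 'I_n.-1) (E : {set vertex n}).

Definition fundamental a : vertex n := [set s : 'I_n | (a < s)%N].

Definition region_at a E T : bool :=
  corners_ok ((val T.1).1 \in fundamental a) ((val T.1).2 \in fundamental a)
    (low T \in E) (left T \in E) (right T \in E) (Defs.top T \in E).

(* The sets of vertices E such that the product of the x_v^-1, v in E, is a
   monomial of W_a. *)
Definition regions P a : {set {set vertex n}} :=
  [set E : {set vertex n} | [&& E \subset Vset P, E :&: right_boundary n == [set fundamental a]
             & [forall T in P, region_at a E T]]].

Lemma regionsP P a E :
  reflect [/\ E \subset Vset P, E :&: right_boundary n = [set fundamental a]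
            & forall T, T \in P -> region_at a E T] (E \in regions P a).
Proof.
rewrite inE; apply: (iffP and3P) => -[h1 /eqP h2 h3]; split=> //.
  by move=> T TP; apply: (forall_inP h3).
by apply/forall_inP.
Qed.

Lemma regionsU P a E E' :
  E \in regions P a -> E' \in regions P a -> E :|: E' \in regions P a.
Proof.
move=> /regionsP[h1 h2 h3] /regionsP[h1' h2' h3']; apply/regionsP; split.
- by rewrite subUset h1.
- by rewrite setIUl h2 h2' setUid.
- move=> T TP; rewrite /region_at !in_setU.
  by apply: corners_okU; [apply: h3|apply: h3'].
Qed.

Lemma regionsI P a E E' :
  E \in regions P a -> E' \in regions P a -> E :&: E' \in regions P a.
Proof.
move=> /regionsP[h1 h2 h3] /regionsP[h1' h2' h3']; apply/regionsP; split.
- by rewrite (subset_trans _ h1) // subsetIl.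
- by rewrite setIIl h2 h2' setIid.
- move=> T TP; rewrite /region_at !in_setI.
  by apply: corners_okI; [apply: h3|apply: h3'].
Qed.

Lemma region_fundamental P a E : E \in regions P a -> fundamental a \in E.
Proof.
case/regionsP=> _ e _; have : fundamental a \in [set fundamental a] by rewrite set11.
by rewrite -e inE => /andP[].
Qed.

Lemma region_right P a E v : E \in regions P a -> v \in E ->
  v \in right_boundary n -> v = fundamental a.
Proof.
by case/regionsP=> _ e _ vE vr; apply/set1P; rewrite -e inE vE.
Qed.

Lemma tiles_notin i T : T \in tiles i ->
  ((val T.1).1 \notin low T) /\ ((val T.1).2 \notin low T).
Proof.
move=> /tilesP[p [l [q [_ /andP[/eqP-> /eqP->]]]]] /=.
by rewrite cham_notin inE wactK /= -leqNgt.
Qed.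

Lemma fundamental_mono a s t : (s < t)%N ->
  s \in fundamental a -> t \in fundamental a.
Proof. by rewrite !inE => lt /ltn_trans->. Qed.

(** An edge that enters [fundamental a] from below has a label above a, and an edge that leaves it
    upwards has a label at most a. It is never the left corner of a tile, because s > a implies t >
    a, and as a right corner it has the two labels on different sides of a. *)
Lemma region_at_fundamental a T :
  (val T.1).1 \notin low T -> (val T.1).2 \notin low T ->
  region_at a [set fundamental a] T.
Proof.
case: T => -[[s t] /= lt] S; rewrite /low /= => ns nt.
have mono := fundamental_mono (a := a) lt.
rewrite /region_at /low /left /right /Defs.top /= !in_set1.
have [e|ne1] := eqVneq S (fundamental a).
  have -> : (s |: S == fundamental a) = false.
    by apply/eqP => e2; move: ns; rewrite e -e2 setU11.
  have -> : (t |: S == fundamental a) = false.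
    by apply/eqP => e2; move: nt; rewrite e -e2 setU11.
  have -> : (s |: (t |: S) == fundamental a) = false.
    by apply/eqP => e2; move: ns; rewrite e -e2 setU11.
  by rewrite -e (negPf ns) (negPf nt).
have [e|ne2] := eqVneq (s |: S) (fundamental a).
  have sf : s \in fundamental a by rewrite -e setU11.
  move: (mono sf); rewrite -e in_setU1 (negPf nt) orbF => /eqP ets.
  by rewrite ets ltnn in lt.
have nst : s != t by rewrite -val_eqE /= ltn_eqF.
have [e|ne3] := eqVneq (t |: S) (fundamental a).
  have -> : (s |: (t |: S) == fundamental a) = false.
    by apply/eqP => e2; move: (setU11 s (t |: S)); rewrite e2 -e in_setU1 (negPf nst) (negPf ns).
  by rewrite -e !in_setU1 eqxx (negPf nst) (negPf ns).
have [e|ne4] := eqVneq (s |: (t |: S)) (fundamental a).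
  by rewrite -e !in_setU1 !eqxx orbT.
by rewrite /corners_ok /edge_ok; do 2!case: (_ \in _).
Qed.

Lemma fundamental_right a : fundamental a \in right_boundary n.
Proof.
apply/imsetP; exists (inord a.+1) => //; apply/setP=> s; rewrite !inE inordK //.
by have := ltn_ord (hi a) => /=; lia.
Qed.

Lemma fundamental_not_left a : fundamental a \notin left_boundary n.
Proof.
apply/negP => /imsetP[m _ /setP e].
have := e (hi a); have := e (lo a); rewrite !inE /= ltnn ltnSn.
by move=> /esym/negbT; rewrite -leqNgt => le /esym lt; lia.
Qed.

(** The left corner passes its membership down the edge s if s is at most a; otherwise t > s is
    above a as well and membership passes up the edge t. Thus a path that meets E is followed by one
    that meets E, in a vertex common to both. *)
Lemma region_flow a E p l T : tile_at p l T -> region_at a E T ->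
  cham p l.+1 \in E -> (cham p l \in E) || (cham p l.+2 \in E).
Proof.
move=> tT; have [e1 e2 _ e4] := tile_atE tT; rewrite /region_at e1 e2 e4.
have mono := fundamental_mono (a := a) (valP T.1).
by move: mono; do 2!case: (_ \in fundamental a) => //=; rewrite /corners_ok /edge_ok /=;
  case: (cham p l.+1 \in E) => //; do !case: (_ \in E) => //; move=> /(_ isT).
Qed.

(** The last letter creates the vertex [fundamental a] of the right boundary. All other vertices of
    the path before it, except the left corner of the last tile, are on the right boundary and hence
    outside E; that corner is outside E too, by [region_flow]. Going back letter by letter, no
    earlier path meets E. *)
Lemma regions_ends_dual i a : reduced i -> ends_dual i a ->
  regions (tiles i) a = [set [set fundamental a]].
Proof.
move=> ri [i' ei]; have ai := reduced_asc ri.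
set b := rev_ord a in ei; have lt_b : (b.+2 <= n)%N := ltn_ord (hi b).
have fE : fundamental a = cham i b.+1.
  apply/setP=> y; rewrite !inE reduced_pos //=.
  by have := ltn_ord y; have := ltn_ord a; lia.
have [Tb Tbat Tbi] : exists2 T, tile_at i' b T & T \in tiles i.
  by rewrite ei -cats1; apply: tile_at_exists; rewrite cats1 -ei.
have fV : fundamental a \in Vset (tiles i).
  rewrite inE fundamental_not_left; apply/bigcupP; exists Tb => //.
  by have [_ _ e _] := tile_atE Tbat; rewrite fE ei -e !inE eqxx ?orbT.
apply/setP=> E; rewrite in_set1; apply/idP/eqP => [EG|->]; last first.
  apply/regionsP; split; first by rewrite sub1set.
    by apply/setIidPl; rewrite sub1set fundamental_right.
  by move=> T /tiles_notin[]; apply: region_at_fundamental.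
have [EV _ Eok] := regionsP _ _ _ EG.
have right_only h : (h <= n)%N -> cham i h \in E -> h = b.+1.
  move=> le hE; rewrite -(card_cham i le) -(@card_cham _ i b.+1) ?(ltnW lt_b) // -fE.
  congr #|pred_of_set _|; apply: region_right EG hE _.
  by apply/(right_boundaryP _ ri); exists h.
have last_none h : (h <= n)%N -> cham i' h \notin E.
  move=> le; apply/negP=> hE; have [eh|ne] := eqVneq h b.+1.
    have := region_flow Tbat (Eok _ Tbi); rewrite -eh hE => /(_ isT).
    have [n1 n2] : b != b.+1 :> nat /\ b.+2 != b.+1 by lia.
    rewrite eh -(cham_rcons i' n1) -(cham_rcons i' n2) -ei.
    by case/orP=> /right_only; rewrite ?(ltnW (ltnW lt_b)) ?lt_b => /(_ isT); lia.
  by case/eqP: (ne); apply: right_only; rewrite // ei cham_rcons.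
(* Only the vertex at height l + 1 is lost by the letter l; its membership would pass to one of its
   neighbours, which the next path keeps. *)
have none q p h : i' = p ++ q -> (h <= n)%N -> cham p h \notin E.
  elim: q p h => [|l q IH] p h; first by rewrite cats0 => <-; apply: last_none.
  move=> ei' le; have ei'' : i' = rcons p l ++ q by rewrite cat_rcons.
  have lt_l : (l.+2 <= n)%N := ltn_ord (hi l).
  have [->|ne] := eqVneq h l.+1; last by rewrite -(cham_rcons p ne) IH.
  have [T Tat Ti] : exists2 T, tile_at p l T & T \in tiles i.
    rewrite ei -cats1 ei' -catA cat_cons; apply: tile_at_exists.
    by rewrite -cat_cons catA -ei' cats1 -ei.
  apply/negP=> /(region_flow Tat (Eok _ Ti)).
  have [n1 n2] : l != l.+1 :> nat /\ l.+2 != l.+1 by lia.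
  rewrite -(cham_rcons p n1) -(cham_rcons p n2).
  by rewrite (negPf (IH _ _ ei'' (ltnW (ltnW lt_l)))) (negPf (IH _ _ ei'' lt_l)).
apply/setP=> v; rewrite in_set1; apply/idP/eqP => [vE|->]; last exact: region_fundamental EG.
have /setDP[/bigcupP[T Ti vT] _] := subsetP EV v vE.
have [p [q [h [e le ev]]]] := tiles_vertices Ti vT.
case/lastP: q e => [|q c] e.
  rewrite ev fE; rewrite cats0 in e; rewrite -e in ev *; congr cham.
  by apply: right_only; rewrite // -ev.
have : i' = p ++ q.
  by move: e; rewrite ei -rcons_cat => /eqP; rewrite eqseq_rcons => /andP[/eqP].
by move=> /none /(_ le); rewrite -ev vE.
Qed.

End Regions.

(* Given a set of vertices that fits outside the hexagon, HA e and HB e tell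
   whether it extends to a region, in the tilings before and after the flip, when
   the inner vertex is in it iff e. The set contains p tails of the arrows into the
   inner vertex and q heads of those out of it. *)
Variant hex_spec (HA HB : bool -> bool) (p q : nat) : Prop :=
| HexNone of (forall e, HA e = false) & (forall e, HB e = false)
| HexEven eA eB of (forall e, HA e = (e == eA)) & (forall e, HB e = (e == eB)) &
    p = q & (eA + eB)%N = q
| HexUp eB of (forall e, HA e) & (forall e, HB e = (e == eB)) & p = q.+1 & eB = q :> nat
| HexDown eA of (forall e, HB e) & (forall e, HA e = (e == eA)) & q = p.+1 & eA = p :> nat.

Lemma hex_specC HA HB p q : hex_spec HA HB p q -> hex_spec HB HA q p.
Proof.
case=> [h1 h2|eA eB h1 h2 h3 h4|eB h1 h2 h3 h4|eA h1 h2 h3 h4].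
- exact: HexNone.
- by apply: (HexEven h2 h1); rewrite // addnC h4.
- exact: HexDown h1 h2 h3 h4.
- exact: HexUp h1 h2 h3 h4.
Qed.

Section HexagonBits.
Variables (bs bt bu : bool) (b0 s st stu u tu : bool).

(** The six bits are the memberships of the boundary vertices of the hexagon, named by the labels
    added to S. The bit e belongs to the inner vertex, S with t before the flip and S with s and u
    after it. *)
Definition hexA e := [&& corners_ok bs bt b0 s e st, corners_ok bs bu e st tu stu &
                         corners_ok bt bu b0 e u tu].
Definition hexB e := [&& corners_ok bs bu b0 s u e, corners_ok bs bt u e tu stu &
                         corners_ok bt bu s st e stu].

End HexagonBits.

(** A finite check. The hypotheses on the bits say that the labels s < t < u cross the threshold a
    at most once; [out] stands for the conditions outside the hexagon, which both tilings share. *)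
Lemma hex_specP bs bt bu b0 s st stu u tu (out : bool) :
  bs ==> bt -> bt ==> bu ->
  hex_spec (fun e => out && hexA bs bt bu b0 s st stu u tu e)
           (fun e => out && hexB bs bt bu b0 s st stu u tu e)
           (s + tu) (st + u).
Proof.
case: out; last by move=> _ _; apply: HexNone.
case: bs; case: bt; case: bu => // _ _; case: b0; case: s; case: st; case: stu;
  case: u; case: tu; by [ apply: HexNone => -[]
  | apply: (@HexEven _ _ _ _ true true) => // -[]
  | apply: (@HexEven _ _ _ _ true false) => // -[]
  | apply: (@HexEven _ _ _ _ false true) => // -[]
  | apply: (@HexEven _ _ _ _ false false) => // -[]
  | apply: (@HexUp _ _ _ _ true) => // -[]
  | apply: (@HexUp _ _ _ _ false) => // -[]
  | apply: (@HexDown _ _ _ _ true) => // -[]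
  | apply: (@HexDown _ _ _ _ false) => // -[] ].
Qed.

(** * Hexagon flips: vertices, exchange graph and regions *)

Section Hexagons.
Variable n : nat.
Implicit Types (p q i j : word n) (l m : 'I_n.-1) (x y s t u : 'I_n).
Implicit Types (S v : vertex n) (T : tile n) (P : {set tile n}).
Implicit Types (a : 'I_n.-1) (D E : {set vertex n}).

(** The tiles of both tilings of the hexagon have their corners among these eight vertices. Coding
    them by bits turns all equalities between corners into computations, see [cube_eq]. *)
Definition cube s t u S (b1 b2 b3 : bool) : vertex n :=
  [set x | [|| b1 && (x == s), b2 && (x == t), b3 && (x == u) | x \in S]].

(** O consists of the tiles outside the hexagon. The inner vertices occur neither in O nor on the
    boundary, so changing their membership in a set affects the conditions of the three hexagon
    tiles only. *)
Record flip (O P P' : {set tile n}) (s t u : 'I_n) (S : vertex n)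
    (st su tu : proot n) : Prop := Flip {
  flip_st : val st = (s, t);
  flip_su : val su = (s, u);
  flip_tu : val tu = (t, u);
  flip_notin : [&& s \notin S, t \notin S & u \notin S];
  flip_old : P = [set (st, S); (su, t |: S); (tu, S)] :|: O;
  flip_new : P' = [set (su, S); (st, u |: S); (tu, s |: S)] :|: O;
  flip_roots : forall T, T \in O -> T.1 \notin [set st; su; tu];
  flip_oldv : forall T, T \in O -> cube s t u S false true false \notin vertices T;
  flip_newv : forall T, T \in O -> cube s t u S true false true \notin vertices T;
  flip_oldb : cube s t u S false true false \notin left_boundary n :|: right_boundary n;
  flip_newb : cube s t u S true false true \notin left_boundary n :|: right_boundary n }.

(** A vertex of size h can only occur at height h of a path, where [wt] never decreases along the
    word. A value of [wt] strictly between those before and after r thus excludes v from all paths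
    outside r. *)
Lemma wt_gap p r q h v : asc (p ++ r ++ q) -> (h <= n)%N -> #|v| = h ->
  (wt (cham p h) < wt v < wt (cham (p ++ r) h))%N ->
  (forall p1 p2 h', p = p1 ++ p2 -> (h' <= n)%N -> v != cham p1 h') /\
  (forall q1 q2 h', q = q1 ++ q2 -> (h' <= n)%N -> v != cham (p ++ r ++ q1) h').
Proof.
move=> apq le cv /andP[lt1 lt2]; split=> [p1 p2|q1 q2] h' e le'; apply/eqP => ev.
  have eh : h' = h by rewrite -cv ev card_cham.
  move: lt1; rewrite ltnNge ev eh e wt_mono //.
  by apply: asc_cat (r ++ q) _; rewrite -e.
have eh : h' = h by rewrite -cv ev card_cham.
move: lt2; rewrite ltnNge ev eh catA wt_mono //.
by apply: (@asc_cat _ _ q2); rewrite -!catA -e.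
Qed.

Fixpoint tiles_from p q : {set tile n} :=
  if q is l :: q' then [set T | tile_at p l T] :|: tiles_from (rcons p l) q'
  else set0.

Lemma tiles_fromP p q T :
  reflect (exists q1 l q2, q = q1 ++ l :: q2 /\ tile_at (p ++ q1) l T)
          (T \in tiles_from p q).
Proof.
elim: q p => [|l q IH] p /=.
  by rewrite inE; apply: ReflectF => -[[|? ?]] [? [? []]].
rewrite !inE; apply: (iffP orP) => [[tT|/IH[q1 [l' [q2 [-> tT]]]]]|].
- by exists [::], l, q; rewrite cats0.
- by exists (l :: q1), l', q2; split; rewrite // -cat_rcons.
- case=> -[|l1 q1] [l' [q2 [/= [-> e] tT]]]; first by left; rewrite cats0 in tT.
  by right; apply/IH; exists q1, l', q2; rewrite cat_rcons.
Qed.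

Lemma tiles_fromE i : tiles i = tiles_from [::] i.
Proof. by apply/setP=> T; apply/tilesP/tiles_fromP. Qed.

Lemma tiles_from_cat p q q' :
  tiles_from p (q ++ q') = tiles_from p q :|: tiles_from (p ++ q) q'.
Proof.
elim: q p => [|l q IH] p /=; first by rewrite set0U cats0.
by rewrite IH setUA cat_rcons.
Qed.

Lemma tile_at1 p l (r : proot n) : val r = (wact p (lo l), wact p (hi l)) ->
  [set T | tile_at p l T] = [set (r, cham p l)].
Proof.
move=> e; apply/setP=> -[r' S']; rewrite !inE /tile_at /low /= -e.
by rewrite (inj_eq val_inj) xpair_eqE.
Qed.

Lemma eq_tiles_from p p' q : wact p =1 wact p' -> tiles_from p q = tiles_from p' q.
Proof.
elim: q p p' => //= l q IH p p' e; congr (_ :|: _).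
  by apply/setP=> T; rewrite !inE /tile_at !e (eq_cham e).
by apply: IH => x; rewrite !wact_rcons e.
Qed.

Lemma tiles_from_vertices p q T v : T \in tiles_from p q -> v \in vertices T ->
  exists q1 q2 h, [/\ q = q1 ++ q2, (h <= n)%N & v = cham (p ++ q1) h].
Proof.
move=> /tiles_fromP[q1 [l [q2 [-> /tile_atE[e1 e2 e3 e4]]]]].
have ltl : (l.+1 < n)%N := ltn_ord (hi l).
rewrite !inE e1 e2 e3 e4 => /orP[/orP[/orP[]|]|] /eqP->.
- by exists q1, (l :: q2), l; split=> //; lia.
- by exists q1, (l :: q2), l.+1; split=> //; lia.
- by exists (rcons q1 l), q2, l.+1; split; rewrite ?cat_rcons // -?rcons_cat //; lia.
- by exists q1, (l :: q2), l.+2.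
Qed.

Lemma braid_flip p q l m : l.+1 = m :> nat -> asc (p ++ [:: l; m; l] ++ q) ->
  reduced (p ++ [:: l; m; l] ++ q) ->
  forall st su tu : proot n,
  val st = (wact p (lo l), wact p (hi l)) ->
  val su = (wact p (lo l), wact p (hi m)) ->
  val tu = (wact p (hi l), wact p (hi m)) ->
  exists O, flip O (tiles (p ++ [:: l; m; l] ++ q)) (tiles (p ++ [:: m; l; m] ++ q))
    (wact p (lo l)) (wact p (hi l)) (wact p (hi m)) (cham p l) st su tu.
Proof.
move=> adj ai ri st su tu est esu etu.
have aj : asc (p ++ [:: m; l; m] ++ q).
  apply: move_asc ai; right; exists st, su, tu, p, q, l, m.
  by split=> //; left.
set s := wact p (lo l) in est esu *; set t := wact p (hi l) in est etu *.
set u := wact p (hi m) in esu etu *; set S := cham p l.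
have lt_st : (s < t)%N by have := valP st; rewrite est.
have lt_tu : (t < u)%N by have := valP tu; rewrite etu.
have lt3 : (l.+3 <= n)%N by have := ltn_ord (hi m); rewrite /= -adj.
have eS : cham (p ++ [:: m]) l = S.
  by rewrite cats1 cham_rcons //; lia.
have eS2 : cham (p ++ [:: l; m]) l = S.
  by rewrite -cat_rcons cats1 !cham_rcons //; lia.
have esS : cham p l.+1 = s |: S by rewrite (chamS p (lo l)).
have estS : cham p l.+2 = t |: (s |: S) by rewrite -esS (chamS p (hi l)).
have etS : cham (p ++ [:: l]) l.+1 = t |: S by rewrite cats1 cham_rcons_eq.
have euS : cham (p ++ [:: m; l]) l.+1 = u |: S.
  rewrite -cat_rcons cats1 cham_rcons_eq wact_rcons (sigma_adj adj).
  by rewrite -eS cats1.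
have euS' : cham (p ++ [:: l; m; l]) l.+1 = u |: S.
  rewrite -!cat_rcons cats0 cham_rcons_eq !wact_rcons !(sigma_adj adj).
  by rewrite -eS2 -!cat_rcons cats0.
have etuS : cham (p ++ [:: l; m; l]) l.+2 = t |: (u |: S).
  by rewrite -euS' (chamS _ (hi l)) wact_cat /= !(sigma_adj adj).
have nS : [&& s \notin S, t \notin S & u \notin S].
  by rewrite !inE !wactK /= -!leqNgt; lia.
have [ns nt nu] := and3P nS.
have tS : cube s t u S false true false = t |: S by apply/setP=> y; rewrite !inE.
have suS : cube s t u S true false true = s |: (u |: S).
  by apply/setP=> y; rewrite !inE.
have nus : s \notin u |: S.
  by rewrite in_setU1 negb_or ns -val_eqE /= andbT; lia.
have nts : s \notin t |: S.
  by rewrite in_setU1 negb_or ns -val_eqE /= andbT; lia.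
have ntu : t \notin u |: S.
  by rewrite in_setU1 negb_or nt -val_eqE /= andbT; lia.
(* The old inner vertex has height l + 1, where the braid takes S with s to S with u; the new one
   has height l + 2, where it takes S with s, t to S with t, u. In both cases s < t < u gives the
   strict inequalities. *)
have [|||old1 old2] := @wt_gap p [:: l; m; l] q l.+1 (t |: S) ai; first by lia.
- by rewrite -etS card_cham //; lia.
- by rewrite esS euS' !wtU1 // ltn_add2r; lia.
have [|||new1 new2] := @wt_gap p [:: l; m; l] q l.+2 (s |: (u |: S)) ai; first by lia.
- by rewrite !cardsU1 nus nu -/S card_cham //; lia.
- by rewrite estS etuS setUCA !wtU1 // ?ltn_add2r ?ltn_add2l; lia.
exists (tiles p :|: tiles_from (p ++ [:: l; m; l]) q).
have Pold T : T \in tiles p :|: tiles_from (p ++ [:: l; m; l]) q ->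
    t |: S \notin vertices T.
  rewrite inE => /orP[] Ti; apply/negP.
    by move=> /(tiles_vertices Ti)[p1 [p2 [h' [e le]]]]; apply/eqP; apply: old1 e le.
  move=> /(tiles_from_vertices Ti)[q1 [q2 [h' [e le]]]]; apply/eqP.
  by rewrite -catA; apply: old2 e le.
have Pnew T : T \in tiles p :|: tiles_from (p ++ [:: l; m; l]) q ->
    s |: (u |: S) \notin vertices T.
  rewrite inE => /orP[] Ti; apply/negP.
    by move=> /(tiles_vertices Ti)[p1 [p2 [h' [e le]]]]; apply/eqP; apply: new1 e le.
  move=> /(tiles_from_vertices Ti)[q1 [q2 [h' [e le]]]]; apply/eqP.
  by rewrite -catA; apply: new2 e le.
have Pi : tiles (p ++ [:: l; m; l] ++ q) =
    [set (st, S); (su, t |: S); (tu, S)] :|: (tiles p :|: tiles_from (p ++ [:: l; m; l]) q).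
  rewrite !tiles_fromE tiles_from_cat tiles_from_cat /= setU0.
  rewrite (tile_at1 est) (@tile_at1 _ _ su) ?wact_rcons ?(sigma_adj adj) //.
  rewrite (@tile_at1 _ _ tu) ?wact_rcons ?(sigma_adj adj) //.
  rewrite -!cats1 -catA eS2 -adj etS.
  by rewrite setUCA !setUA.
have Pj : tiles (p ++ [:: m; l; m] ++ q) =
    [set (su, S); (st, u |: S); (tu, s |: S)] :|: (tiles p :|: tiles_from (p ++ [:: l; m; l]) q).
  rewrite !tiles_fromE tiles_from_cat tiles_from_cat /= setU0.
  have -> : tiles_from (p ++ [:: m; l; m]) q = tiles_from (p ++ [:: l; m; l]) q.
    by apply: eq_tiles_from => x; rewrite !wact_cat /= (sigma_braid adj).
  rewrite (@tile_at1 _ _ tu) ?(sigma_adj adj) //.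
  rewrite (@tile_at1 _ _ su) ?wact_rcons ?(sigma_adj adj) //.
  rewrite (@tile_at1 _ _ st) ?wact_rcons ?(sigma_adj adj) //.
  rewrite -!cats1 -catA eS -adj euS esS.
  apply/setP=> T; rewrite !in_setU !in_set1.
  by case: (T \in _); case: (T \in _); case: (T == _); case: (T == _); case: (T == _).
split=> //.
- move=> T TO; have Ti : T \in tiles (p ++ [:: l; m; l] ++ q) by rewrite Pi inE TO orbT.
  apply/negP => rT; have : T \in [set (st, S); (su, t |: S); (tu, S)].
    have inj := fun T' => @tiles_root_inj _ _ T T' ai Ti.
    move: rT; rewrite !inE => /orP[/orP[]|] /eqP e.
    + by rewrite (inj (st, S)) ?eqxx // Pi !inE eqxx.
    + by rewrite (inj (su, t |: S)) ?eqxx ?orbT // Pi !inE eqxx orbT.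
    + by rewrite (inj (tu, S)) ?eqxx ?orbT // Pi !inE eqxx orbT.
  have := Pold T TO; rewrite !inE /low /left /right /Defs.top.
  by move=> nv /orP[/orP[]|] /eqP eT; rewrite eT /= ?est ?esu ?etu /= eqxx ?orbT in nv.
- by move=> T TO; rewrite tS Pold.
- by move=> T TO; rewrite suS Pnew.
- rewrite tS inE negb_or; apply/andP; split; apply/negP.
    by move=> /left_boundaryP[h' le]; apply/eqP; apply: (old1 [::] p).
  move=> /(right_boundaryP _ ri)[h' le]; apply/eqP.
  by apply: (old2 q [::]); rewrite ?cats0.
- rewrite suS inE negb_or; apply/andP; split; apply/negP.
    by move=> /left_boundaryP[h' le]; apply/eqP; apply: (new1 [::] p).
  move=> /(right_boundaryP _ ri)[h' le]; apply/eqP.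
  by apply: (new2 q [::]); rewrite ?cats0.
Qed.

Definition add (e : bool) v D : {set vertex n} := if e then v |: D else D.

Lemma in_add e v D w : (w \in add e v D) = (e && (w == v)) || (w \in D).
Proof. by case: e; rewrite ?in_setU1. Qed.

(** What the crystal and the mutation have to know about a flip, in a form that is symmetric in the
    two tilings: by [exchangeC] one construction serves both directions of a braid move. The arrows
    at k come from i1, i2 and go to o1, o2, and those at k' are reversed. *)
Record exchange P P' (k k' i1 i2 o1 o2 : vertex n) : Prop := Exchange {
  ex_V : Vset P :\ k = Vset P' :\ k';
  ex_k : k \in Vset P;
  ex_k' : k' \in Vset P';
  ex_kP' : k \notin Vset P';
  ex_k'P : k' \notin Vset P;
  ex_uniq : uniq [:: i1; i2; o1; o2];
  ex_exch : forall v, v \in Vset P :\ k ->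
    exch P v k = ((v == i1) || (v == i2))%:Z - ((v == o1) || (v == o2))%:Z;
  ex_exch' : forall v, v \in Vset P' :\ k' ->
    exch P' v k' = ((v == o1) || (v == o2))%:Z - ((v == i1) || (v == i2))%:Z;
  ex_spec : forall a D, k \notin D -> k' \notin D ->
    hex_spec (fun e => add e k D \in regions P a) (fun e => add e k' D \in regions P' a)
      ((i1 \in D) + (i2 \in D)) ((o1 \in D) + (o2 \in D)) }.

Lemma exchangeC P P' (k k' i1 i2 o1 o2 : vertex n) :
  exchange P P' k k' i1 i2 o1 o2 -> exchange P' P k' k o1 o2 i1 i2.
Proof.
case=> h1 h2 h3 h4 h5 h6 h7 h8 h9; split=> //.
- by rewrite -[_ :: _]/([:: o1; o2] ++ [:: i1; i2]) uniq_catC.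
- by move=> a D nk' nk; apply/hex_specC/h9.
Qed.

Section Flips.
Variables (O P P' : {set tile n}) (s t u : 'I_n) (S : vertex n).
Variables (st su tu : proot n).
Hypothesis F : flip O P P' s t u S st su tu.

Local Notation cb := (cube s t u S).

Lemma flip_lt : (s < t)%N /\ (t < u)%N.
Proof. by have := valP st; have := valP tu; rewrite (flip_st F) (flip_tu F). Qed.

Lemma flip_neq : [/\ s == t = false, t == s = false, s == u = false,
  u == s = false & (t == u = false) /\ (u == t = false)].
Proof.
by have [] := flip_lt; rewrite -!val_eqE /= => h1 h2; do !split; lia.
Qed.

Lemma cube_eq b1 b2 b3 c1 c2 c3 :
  (cb b1 b2 b3 == cb c1 c2 c3) = [&& b1 == c1, b2 == c2 & b3 == c3].
Proof.
have [e1 e2 e3 e4 [e5 e6]] := flip_neq.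
have /and3P[/negPf ns /negPf nt /negPf nu] := flip_notin F.
apply/eqP/and3P => [/setP e|[/eqP-> /eqP-> /eqP->] //].
have := e s; have := e t; have := e u.
by rewrite !inE !eqxx ?e1 ?e2 ?e3 ?e4 ?e5 ?e6 ns nt nu !andbT !andbF !orbF /= => -> -> ->.
Qed.

Let cE : ((S = cb false false false) * (s |: S = cb true false false) *
  (t |: S = cb false true false) * (u |: S = cb false false true))%type.
Proof. by do !split; apply/setP=> y; rewrite !inE. Qed.

Lemma flip_corners :
  [/\ (low (st, S) = cb false false false) /\ (left (st, S) = cb true false false) /\
      (right (st, S) = cb false true false) /\ (Defs.top (st, S) = cb true true false),
      (low (su, t |: S) = cb false true false) /\ (left (su, t |: S) = cb true true false) /\
      (right (su, t |: S) = cb false true true) /\ (Defs.top (su, t |: S) = cb true true true) &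
      (low (tu, S) = cb false false false) /\ (left (tu, S) = cb false true false) /\
      (right (tu, S) = cb false false true) /\ (Defs.top (tu, S) = cb false true true)].
Proof.
rewrite /low /left /right /Defs.top /= (flip_st F) (flip_su F) (flip_tu F) /=.
by do !split; apply/setP=> y; rewrite !inE /=; do 4?case: (_ == _).
Qed.

Lemma flip_corners' :
  [/\ (low (su, S) = cb false false false) /\ (left (su, S) = cb true false false) /\
      (right (su, S) = cb false false true) /\ (Defs.top (su, S) = cb true false true),
      (low (st, u |: S) = cb false false true) /\ (left (st, u |: S) = cb true false true) /\
      (right (st, u |: S) = cb false true true) /\ (Defs.top (st, u |: S) = cb true true true) &
      (low (tu, s |: S) = cb true false false) /\ (left (tu, s |: S) = cb true true false) /\
      (right (tu, s |: S) = cb true false true) /\ (Defs.top (tu, s |: S) = cb true true true)].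
Proof.
rewrite /low /left /right /Defs.top /= (flip_st F) (flip_su F) (flip_tu F) /=.
by do !split; apply/setP=> y; rewrite !inE /=; do 4?case: (_ == _).
Qed.

Lemma flip_rootsne : [/\ st == su = false, st == tu = false & su == tu = false].
Proof.
have [e1 e2 e3 e4 [e5 e6]] := flip_neq.
by split; rewrite -(inj_eq val_inj) ?(flip_st F) ?(flip_su F) ?(flip_tu F) xpair_eqE ?e1 ?e5 ?eqxx
  ?andbF.
Qed.

Lemma flip_rootsO T : T \in O -> [/\ T.1 == st = false, T.1 == su = false & T.1 == tu = false].
Proof.
by move=> TO; have := flip_roots F TO; rewrite !inE !negb_or => /andP[/andP[/negPf->
  /negPf->] /negPf->].
Qed.

Lemma flip_notinO X : [/\ (st, X) \in O = false, (su, X) \in O = false & (tu, X) \in O = false].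
Proof. by split; apply/negP => /flip_rootsO[] /=; rewrite eqxx. Qed.

Lemma sum_flip (G : tile n -> int) :
  \sum_(T in P) G T = G (st, S) + G (su, t |: S) + G (tu, S) + \sum_(T in O) G T.
Proof.
have [n1 n2 n3] := flip_rootsne.
have [m1 m2 m3] := flip_notinO S; have [_ m4 _] := flip_notinO (t |: S).
rewrite (flip_old F) -!setUA big_setU1 ?in_setU ?in_set1 ?xpair_eqE ?n1 ?n2 ?m1 //.
rewrite big_setU1 ?in_setU ?in_set1 ?xpair_eqE ?n3 ?m4 //.
by rewrite big_setU1 ?m3 //= !addrA.
Qed.

Lemma sum_flip' (G : tile n -> int) :
  \sum_(T in P') G T = G (su, S) + G (st, u |: S) + G (tu, s |: S) + \sum_(T in O) G T.
Proof.
have [n1 n2 n3] := flip_rootsne.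
have [_ m1 _] := flip_notinO S; have [m2 _ _] := flip_notinO (u |: S).
have [_ _ m3] := flip_notinO (s |: S).
rewrite (flip_new F) -!setUA.
rewrite big_setU1 ?in_setU ?in_set1 ?xpair_eqE ?[su == st]eq_sym ?n1 ?n3 ?m1 //.
rewrite big_setU1 ?in_setU ?in_set1 ?xpair_eqE ?n2 ?m2 //.
by rewrite big_setU1 ?m3 //= !addrA.
Qed.

Let kA := cb false true false.
Let kB := cb true false true.

Lemma flip_cases T : T \in P -> [\/ T = (st, S), T = (su, t |: S), T = (tu, S) | T \in O].
Proof.
rewrite (flip_old F) inE => /orP[]; last by constructor 4.
by rewrite !inE => /orP[/orP[]|] /eqP->; [constructor 1|constructor 2|constructor 3].
Qed.

Lemma flip_cases' T : T \in P' -> [\/ T = (su, S), T = (st, u |: S), T = (tu, s |: S) | T \in O].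
Proof.
rewrite (flip_new F) inE => /orP[]; last by constructor 4.
by rewrite !inE => /orP[/orP[]|] /eqP->; [constructor 1|constructor 2|constructor 3].
Qed.

Lemma flip_in : [/\ (st, S) \in P, (su, t |: S) \in P, (tu, S) \in P & forall T, T \in O ->
  T \in P].
Proof.
by rewrite (flip_old F); split=> [|||T TO]; rewrite !inE ?eqxx ?TO ?orbT.
Qed.

Lemma flip_in' : [/\ (su, S) \in P', (st, u |: S) \in P', (tu, s |: S) \in P' & forall T,
  T \in O -> T \in P'].
Proof.
by rewrite (flip_new F); split=> [|||T TO]; rewrite !inE ?eqxx ?TO ?orbT.
Qed.

(** The vertices that both tilings share. The six boundary vertices of the hexagon are listed
    because O need not contain them. *)
Let W : {set vertex n} := (\bigcup_(T in O) vertices T) :|: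
  [set cb false false false; cb true false false; cb true true false;
       cb true true true; cb false false true; cb false true true].

Let verts : (\bigcup_(T in P) vertices T = kA |: W) /\ (\bigcup_(T in P') vertices T = kB |: W).
Proof.
have [[a1 [a2 [a3 a4]]] [b1 [b2 [b3 b4]]] [c1 [c2 [c3 c4]]]] := flip_corners.
have [[d1 [d2 [d3 d4]]] [e1 [e2 [e3 e4]]] [f1 [f2 [f3 f4]]]] := flip_corners'.
rewrite (flip_old F) (flip_new F) !bigcup_setU.
rewrite !big_set1 /vertices a1 a2 a3 a4 b1 b2 b3 b4 c1 c2 c3 c4 d1 d2 d3 d4 e1 e2 e3 e4 f1 f2 f3 f4.
rewrite /W; move: (\bigcup_(T in O) _) => Z.
split; apply/setP=> v; rewrite !inE -/kA -/kB.
  do ![case: (v == _); rewrite ?orbT ?orbF //=].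
do ![case: (v == _); rewrite ?orbT ?orbF //=].
Qed.

Let kAW : kA \notin W.
Proof.
rewrite !inE !cube_eq /= !orbF; apply/negP=> /bigcupP[T TO].
by apply/negP/(flip_oldv F).
Qed.

Let kBW : kB \notin W.
Proof.
rewrite !inE !cube_eq /= !orbF; apply/negP=> /bigcupP[T TO].
by apply/negP/(flip_newv F).
Qed.

Let kbd : [/\ kA \notin left_boundary n, kA \notin right_boundary n,
  kB \notin left_boundary n & kB \notin right_boundary n].
Proof.
by have := flip_oldb F; have := flip_newb F; rewrite !inE !negb_or => /andP[-> ->] /andP[-> ->].
Qed.

Let kAkB : kA == kB = false. Proof. by rewrite cube_eq. Qed.

Lemma flip_Vset : [/\ Vset P = kA |: (W :\: left_boundary n) & Vset P' = kB |: (W :\: left_boundary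
  n)].
Proof.
have [e1 e2] := verts; have [n1 _ n2 _] := kbd.
by rewrite /Vset e1 e2 !setDUl; split; congr (_ :|: _); apply/setP=> v; rewrite !inE;
  case: eqP => [->|]; rewrite ?andbF ?n1 ?n2.
Qed.


Let out a D := [&& D \subset W :\: left_boundary n, D :&: right_boundary n == [set fundamental a]
               & [forall T in O, region_at a D T]].

Let region_add a D e T k : k \notin vertices T -> region_at a (add e k D) T = region_at a D T.
Proof.
rewrite /vertices !inE !negb_or => /andP[/andP[/andP[n1 n2] n3] n4].
by rewrite /region_at !in_add ![_ == k]eq_sym (negPf n1) (negPf n2) (negPf n3) (negPf n4) !andbF.
Qed.

Let subset_add (k : vertex n) D e : k \notin D -> k \notin W ->
  (add e k D \subset k |: (W :\: left_boundary n)) = (D \subset W :\: left_boundary n).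
Proof.
move=> nkD nkW; apply/subsetP/subsetP => sub v vD.
  have := sub v; rewrite in_add vD orbT in_setU1 => /(_ isT)/orP[/eqP e1|//].
  by rewrite -e1 vD in nkD.
by move: vD; rewrite in_add in_setU1 => /orP[/andP[_ ->] //|/sub ->]; rewrite orbT.
Qed.

Let right_add (k : vertex n) D e : k \notin right_boundary n ->
  add e k D :&: right_boundary n = D :&: right_boundary n.
Proof.
move=> nk; apply/setP=> v; rewrite !in_setI in_add.
by case: (eqVneq v k) => [->|_]; rewrite ?(negPf nk) ?andbF.
Qed.

Let regions_old a D e : kA \notin D ->
  (add e kA D \in regions P a) = out a D &&
   hexA (s \in fundamental a) (t \in fundamental a) (u \in fundamental a)
    (cb false false false \in D) (cb true false false \in D) (cb true true false \in D)
    (cb true true true \in D) (cb false false true \in D) (cb false true true \in D) e.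
Proof.
move=> nk; have [eV _] := flip_Vset; have [n1 n2 _ _] := kbd.
have [[a1 [a2 [a3 a4]]] [b1 [b2 [b3 b4]]] [c1 [c2 [c3 c4]]]] := flip_corners.
have nkf : cb false true false \in D = false by apply/negbTE.
have hexE : hexA (s \in fundamental a) (t \in fundamental a) (u \in fundamental a)
    (cb false false false \in D) (cb true false false \in D) (cb true true false \in D)
    (cb true true true \in D) (cb false false true \in D) (cb false true true \in D) e =
  [&& region_at a (add e kA D) (st, S), region_at a (add e kA D) (su, t |: S)
    & region_at a (add e kA D) (tu, S)].
  rewrite /region_at !(a1, a2, a3, a4) !(b1, b2, b3, b4) !(c1, c2, c3, c4).
  rewrite (flip_st F) (flip_su F) (flip_tu F) /= !in_add /kA !cube_eq /= !andbF !andbT /=.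
  by rewrite nkf !orbF.
rewrite hexE inE eV subset_add // right_add // /out -2!andbA; do 2!congr (_ && _).
have [i1 i2 i3 i4] := flip_in.
apply/forall_inP/and4P => [h|[/forall_inP h h1 h2 h3] T /flip_cases[-> //|-> //|-> //|TO]].
  split; try exact: h.
  by apply/forall_inP => T TO; rewrite -(@region_add a D e T kA) ?(flip_oldv F) // h // i4.
by rewrite region_add ?(flip_oldv F) // h.
Qed.

Let regions_new a D e : kB \notin D ->
  (add e kB D \in regions P' a) = out a D &&
   hexB (s \in fundamental a) (t \in fundamental a) (u \in fundamental a)
    (cb false false false \in D) (cb true false false \in D) (cb true true false \in D)
    (cb true true true \in D) (cb false false true \in D) (cb false true true \in D) e.
Proof.
move=> nk; have [_ eV] := flip_Vset; have [_ _ n1 n2] := kbd.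
have [[a1 [a2 [a3 a4]]] [b1 [b2 [b3 b4]]] [c1 [c2 [c3 c4]]]] := flip_corners'.
have nkf : cb true false true \in D = false by apply/negbTE.
have hexE : hexB (s \in fundamental a) (t \in fundamental a) (u \in fundamental a)
    (cb false false false \in D) (cb true false false \in D) (cb true true false \in D)
    (cb true true true \in D) (cb false false true \in D) (cb false true true \in D) e =
  [&& region_at a (add e kB D) (su, S), region_at a (add e kB D) (st, u |: S)
    & region_at a (add e kB D) (tu, s |: S)].
  rewrite /region_at !(a1, a2, a3, a4) !(b1, b2, b3, b4) !(c1, c2, c3, c4).
  rewrite (flip_st F) (flip_su F) (flip_tu F) /= !in_add /kB !cube_eq /= !andbF !andbT /=.
  by rewrite nkf !orbF.
rewrite hexE inE eV subset_add // right_add // /out -2!andbA; do 2!congr (_ && _).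
have [i1 i2 i3 i4] := flip_in'.
apply/forall_inP/and4P => [h|[/forall_inP h h1 h2 h3] T /flip_cases'[-> //|-> //|-> //|TO]].
  split; try exact: h.
  by apply/forall_inP => T TO; rewrite -(@region_add a D e T kB) ?(flip_newv F) // h // i4.
by rewrite region_add ?(flip_newv F) // h.
Qed.

Lemma flip_spec a D : kA \notin D -> kB \notin D ->
  hex_spec (fun e => add e kA D \in regions P a) (fun e => add e kB D \in regions P' a)
      ((cb true false false \in D) + (cb false true true \in D))
      ((cb true true false \in D) + (cb false false true \in D)).
Proof.
move=> nA nB; have [lt1 lt2] := flip_lt.
have [] := @hex_specP (s \in fundamental a) (t \in fundamental a) (u \in fundamental a)
  (cb false false false \in D) (cb true false false \in D) (cb true true false \in D)
    (cb true true true \in D) (cb false false true \in D) (cb false true true \in D) (out a D).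
- exact/implyP/fundamental_mono.
- exact/implyP/fundamental_mono.
- by move=> h1 h2; apply: HexNone => e; rewrite ?regions_old ?regions_new.
- by move=> eA eB h1 h2 h3 h4; apply: (HexEven (eA := eA) (eB := eB)) => // e;
  rewrite ?regions_old ?regions_new.
- by move=> eB h1 h2 h3 h4; apply: (HexUp (eB := eB)) => // e; rewrite ?regions_old ?regions_new.
- by move=> eA h1 h2 h3 h4; apply: (HexDown (eA := eA)) => // e; rewrite ?regions_old ?regions_new.
Qed.

Let exists_flip (Q : pred (tile n)) : (forall T, T \in O -> Q T = false) ->
  [exists T in P, Q T] = [|| Q (st, S), Q (su, t |: S) | Q (tu, S)].
Proof.
move=> nO; have [i1 i2 i3 i4] := flip_in.
apply/exists_inP/or3P => [[T /flip_cases[->|->|->|/nO->] //]|[]]; by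
  [constructor 1|constructor 2|constructor 3|exists (st, S)|exists (su, t |: S)|exists (tu, S)].
Qed.

Let exists_flip' (Q : pred (tile n)) : (forall T, T \in O -> Q T = false) ->
  [exists T in P', Q T] = [|| Q (su, S), Q (st, u |: S) | Q (tu, s |: S)].
Proof.
move=> nO; have [i1 i2 i3 i4] := flip_in'.
apply/exists_inP/or3P => [[T /flip_cases'[->|->|->|/nO->] //]|[]]; by
  [constructor 1|constructor 2|constructor 3|exists (su, S)|exists (st, u |: S)|exists (tu,
    s |: S)].
Qed.

Let notvert (k v w : vertex n) T : k \notin vertices T -> (v == k) || (w == k) ->
  [/\ (v, w) == (left T, right T) = false & orients T v w = false].
Proof.
rewrite /vertices /orients !inE !xpair_eqE !negb_or => /andP[/andP[/andP[n1 n2] n3] n4].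
by case/orP => /eqP->; rewrite (negPf n1) (negPf n2) (negPf n3) (negPf n4) ?andbF.
Qed.

Lemma flip_exch v : v \in Vset P :\ kA -> exch P v kA =
  ((v == cb true false false) || (v == cb false true true))%:Z -
  ((v == cb true true false) || (v == cb false false true))%:Z.
Proof.
rewrite in_setD1 => /andP[nv vV]; have [eV _] := flip_Vset.
have kV : kA \in Vset P by rewrite eV setU11.
have [_ nr _ _] := kbd.
have [[a1 [a2 [a3 a4]]] [b1 [b2 [b3 b4]]] [c1 [c2 [c3 c4]]]] := flip_corners.
rewrite /exch /arrow vV kV (negPf nr) andbF /=.
rewrite !exists_flip; try by
  [move=> T /(flip_oldv F) h; have [] := @notvert _ v kA T h; rewrite ?eqxx ?orbT
  |move=> T /(flip_oldv F) h; have [] := @notvert _ kA v T h; rewrite ?eqxx ?orbT].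
rewrite /orients !inE !(a1, a2, a3, a4) !(b1, b2, b3, b4) !(c1, c2, c3, c4) !xpair_eqE.
rewrite /kA ?[cb _ _ _ == v]eq_sym !cube_eq /= !andbF !andbT !orbF /=.
(* The edge from S to the inner vertex is a right edge of [s,t] and a left edge of [t,u], which
   orient it oppositely, so it carries no arrow. *)
case: (eqVneq v (cb false false false)) => [->|_]; first by rewrite !cube_eq.
case: (eqVneq v (cb true true false)) => [->|_]; first by rewrite !cube_eq.
by case: (v == cb true false false); case: (v == cb false true true);
  case: (v == cb false false true).
Qed.

Lemma flip_exch' v : v \in Vset P' :\ kB -> exch P' v kB =
  ((v == cb true true false) || (v == cb false false true))%:Z -
  ((v == cb true false false) || (v == cb false true true))%:Z.
Proof.
rewrite in_setD1 => /andP[nv vV]; have [_ eV] := flip_Vset.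
have kV : kB \in Vset P' by rewrite eV setU11.
have [_ _ _ nr] := kbd.
have [[a1 [a2 [a3 a4]]] [b1 [b2 [b3 b4]]] [c1 [c2 [c3 c4]]]] := flip_corners'.
rewrite /exch /arrow vV kV (negPf nr) andbF /=.
rewrite !exists_flip'; try by
  [move=> T /(flip_newv F) h; have [] := @notvert _ v kB T h; rewrite ?eqxx ?orbT
  |move=> T /(flip_newv F) h; have [] := @notvert _ kB v T h; rewrite ?eqxx ?orbT].
rewrite /orients !inE !(a1, a2, a3, a4) !(b1, b2, b3, b4) !(c1, c2, c3, c4) !xpair_eqE.
rewrite /kB ?[cb _ _ _ == v]eq_sym !cube_eq /= !andbF !andbT !orbF /=.
(* After the flip it is the edge to the top of the hexagon that is oriented oppositely by its two
   tiles. *)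
case: (eqVneq v (cb true true true)) => [->|_]; first by rewrite !cube_eq.
case: (eqVneq v (cb false false true)) => [->|_]; first by rewrite !cube_eq.
by case: (v == cb true false false); case: (v == cb false true true);
  case: (v == cb true true false).
Qed.

Lemma flip_exchange : exchange P P' kA kB (cb true false false) (cb false true true)
  (cb true true false) (cb false false true).
Proof.
have [e1 e2] := flip_Vset.
have nAW : kA \notin W :\: left_boundary n by rewrite in_setD negb_and kAW orbT.
have nBW : kB \notin W :\: left_boundary n by rewrite in_setD negb_and kBW orbT.
split.
- by rewrite e1 e2 !setU1K.
- by rewrite e1 setU11.
- by rewrite e2 setU11.
- by rewrite e2 in_setU1 kAkB.
- by rewrite e1 in_setU1 eq_sym kAkB.
- by rewrite /= !inE !cube_eq.
- exact: flip_exch.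
- exact: flip_exch'.
- exact: flip_spec.
Qed.

End Flips.

End Hexagons.

(* eA and eB tell whether the inner vertex is in the largest region of maximal
   weight before and after the flip; dA and dB are the weights it contributes. *)
Definition choice (p q : nat) (eA eB : bool) (dA dB : int) : Prop :=
  [\/ p = q /\ (eA + eB)%N = q,
      [/\ p = q.+1, eB = q :> nat & eA = (0 <= dA)] |
      [/\ q = p.+1, eA = p :> nat & eB = (0 <= dB)]].

(** Here x1, x2, x3 are the coordinates at [s,t], [s,u], [t,u], and the bits are indexed as in
    [cube]. A free inner vertex is chosen by the sign of x1 - x3 or x3 - x1, that is, by the
    comparison that decides the minimum m; in each case the identity is linear. *)
Lemma choice_weight_new (x1 x2 x3 : nat) (b100 b011 b110 b001 eA eB : bool) :
  let m := minn x1 x3 in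
  choice (b100 + b011) (b110 + b001) eA eB
     ((x1 + x2 - m)%N%:Z - (x3 + x2 - m)%N%:Z) (x3%:Z - x1%:Z) ->
  (x1 + x2 - m)%N%:Z * (eA%:Z - b100%:Z) + m%:Z * (b011%:Z - b110%:Z)
   + (x3 + x2 - m)%N%:Z * (b001%:Z - eA%:Z) =
  x2%:Z * (b001%:Z - b100%:Z) + x1%:Z * (b011%:Z - eB%:Z) + x3%:Z * (eB%:Z - b110%:Z).
Proof.
move=> m; have [le|lt] := leqP x1 x3; rewrite /m;
  [rewrite (minn_idPl le)|rewrite (minn_idPr (ltnW lt))];
  case=> [[h1 h2]|[h1 h2]|[h1 h2]]; try case: lerP => hd e; move: h1 h2; rewrite ?e; clear m;
    try clear e;
  move: b100 b011 b110 b001 eA eB => [] [] [] [] [] [] //=; lia.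
Qed.

Lemma choice_weight_old (x1 x2 x3 : nat) (b100 b011 b110 b001 eA eB : bool) :
  let m := minn x1 x3 in
  choice (b110 + b001) (b100 + b011) eB eA
     ((x3 + x2 - m)%N%:Z - (x1 + x2 - m)%N%:Z) (x1%:Z - x3%:Z) ->
  m%:Z * (b001%:Z - b100%:Z) + (x1 + x2 - m)%N%:Z * (b011%:Z - eB%:Z)
   + (x3 + x2 - m)%N%:Z * (eB%:Z - b110%:Z) =
  x1%:Z * (eA%:Z - b100%:Z) + x2%:Z * (b011%:Z - b110%:Z) + x3%:Z * (b001%:Z - eA%:Z).
Proof.
move=> m; have [le|lt] := leqP x1 x3; rewrite /m;
  [rewrite (minn_idPl le)|rewrite (minn_idPr (ltnW lt))];
  case=> [[h1 h2]|[h1 h2]|[h1 h2]]; try case: lerP => hd e; move: h1 h2; rewrite ?e; clear m;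
    try clear e;
  move: b100 b011 b110 b001 eA eB => [] [] [] [] [] [] //=; lia.
Qed.

(** The difference y1 - y3 is x1 - x3 plus (b100 + b011) - (b110 + b001), hence changes by at most
    1, and x and y lie on the same closed side of the wall x1 = x3. The same coordinate then
    realizes both minima, and the claim is linear. *)
Lemma choice_rvec_new (x1 x2 x3 y1 y2 y3 : nat) (b000 b111 b100 b011 b110 b001 eA eB : bool) :
  let m := minn x1 x3 in let my := minn y1 y3 in
  choice (b100 + b011) (b110 + b001) eA eB
     ((x1 + x2 - m)%N%:Z - (x3 + x2 - m)%N%:Z) (x3%:Z - x1%:Z) ->
  y1%:Z = x1%:Z + (eB%:Z + b011%:Z - b111%:Z - b001%:Z) ->
  y2%:Z = x2%:Z + (b100%:Z + b001%:Z - eB%:Z - b000%:Z) ->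
  y3%:Z = x3%:Z + (b110%:Z + eB%:Z - b111%:Z - b100%:Z) ->
  [/\ (y1 + y2 - my)%N%:Z = (x1 + x2 - m)%N%:Z + (b100%:Z + eA%:Z - b110%:Z - b000%:Z),
      my%:Z = m%:Z + (b110%:Z + b011%:Z - b111%:Z - eA%:Z) &
      (y3 + y2 - my)%N%:Z = (x3 + x2 - m)%N%:Z + (eA%:Z + b001%:Z - b011%:Z - b000%:Z)].
Proof.
move=> m my ch e1 e2 e3; move: ch; rewrite {}/m {}/my.
case: (leqP x1 x3) => hx; case: (leqP y1 y3) => hy;
  case=> [[h1 h2]|[h1 h2]|[h1 h2]]; try case: lerP => hd e; move: h1 h2 e1 e2 e3;
  rewrite ?e; clear e || idtac;
  move: (nat_of_bool b000) (nat_of_bool b111) (nat_of_bool b100) (nat_of_bool b011)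
        (nat_of_bool b110) (nat_of_bool b001) => * /=; split; lia.
Qed.

Lemma choice_rvec_old (x1 x2 x3 y1 y2 y3 : nat) (b000 b111 b100 b011 b110 b001 eA eB : bool) :
  let m := minn x1 x3 in let my := minn y1 y3 in
  choice (b110 + b001) (b100 + b011) eB eA
     ((x3 + x2 - m)%N%:Z - (x1 + x2 - m)%N%:Z) (x1%:Z - x3%:Z) ->
  y1%:Z = x1%:Z + (b100%:Z + eA%:Z - b110%:Z - b000%:Z) ->
  y2%:Z = x2%:Z + (b110%:Z + b011%:Z - b111%:Z - eA%:Z) ->
  y3%:Z = x3%:Z + (eA%:Z + b001%:Z - b011%:Z - b000%:Z) ->
  [/\ (y1 + y2 - my)%N%:Z = (x1 + x2 - m)%N%:Z + (eB%:Z + b011%:Z - b111%:Z - b001%:Z),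
      my%:Z = m%:Z + (b100%:Z + b001%:Z - eB%:Z - b000%:Z) &
      (y3 + y2 - my)%N%:Z = (x3 + x2 - m)%N%:Z + (b110%:Z + eB%:Z - b111%:Z - b100%:Z)].
Proof.
move=> m my ch e1 e2 e3; move: ch; rewrite {}/m {}/my.
case: (leqP x1 x3) => hx; case: (leqP y1 y3) => hy;
  case=> [[h1 h2]|[h1 h2]|[h1 h2]]; try case: lerP => hd e; move: h1 h2 e1 e2 e3;
  rewrite ?e; clear e || idtac;
  move: (nat_of_bool b000) (nat_of_bool b111) (nat_of_bool b100) (nat_of_bool b011)
        (nat_of_bool b110) (nat_of_bool b001) => * /=; split; lia.
Qed.

(** * Crystal operators *)

Section Crystal.
Variable n : nat.
Implicit Types (i j : word n) (v : vertex n) (T : tile n) (P : {set tile n}).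
Implicit Types (a : 'I_n.-1) (D E : {set vertex n}) (x y : nvec n).

Definition weight P x E : int :=
  \sum_(T in P) (x T.1)%:Z * ((right T \in E)%:Z - (left T \in E)%:Z).

(** Minus the sum of [corner_sign v T] over v in E, see [sum_corner_sign]. *)
Definition corner_sum E T : int :=
  (left T \in E)%:Z + (right T \in E)%:Z - (Defs.top T \in E)%:Z - (low T \in E)%:Z.

Definition rvec P E : {ffun proot n -> int} :=
  [ffun r => \sum_(T in P) (T.1 == r)%:Z * corner_sum E T].

(* E is the largest region of maximal weight; then f_a^* x = x + rvec P E. *)
Definition selected P a x E : Prop :=
  E \in regions P a /\
  forall E', E' \in regions P a ->
    weight P x E' <= weight P x E /\ (weight P x E' = weight P x E -> E' \subset E).

Lemma selected_inj P a x E E' : selected P a x E -> selected P a x E' -> E = E'.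
Proof.
move=> [r1 h1] [r2 h2]; have [l1 s1] := h1 _ r2; have [l2 s2] := h2 _ r1.
have e : weight P x E = weight P x E' by apply/eqP; rewrite eq_le l1 l2.
by apply/eqP; rewrite eqEsubset s1 // s2.
Qed.

Lemma weight_modular P x E E' :
  weight P x (E :|: E') + weight P x (E :&: E') = weight P x E + weight P x E'.
Proof.
rewrite /weight -!big_split; apply: eq_bigr => T _ /=.
rewrite !in_setU !in_setI.
by case: (right T \in E); case: (right T \in E'); case: (left T \in E);
  case: (left T \in E'); ring.
Qed.

(** The vector x belongs to P' and its image under [braid_map] to P; d and d' are the weights
    contributed by the inner vertices k and k'. *)
Record transfer P P' (k k' i1 i2 o1 o2 : vertex n) (st su tu : proot n)
    (d d' : nvec n -> int) : Prop := Transfer {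
  tr_k : forall x D, k \notin D -> weight P x (k |: D) = weight P x D + d x;
  tr_k' : forall x D, k' \notin D -> weight P' x (k' |: D) = weight P' x D + d' x;
  tr_weight : forall x eA eB D, k \notin D -> k' \notin D ->
    choice ((i1 \in D) + (i2 \in D)) ((o1 \in D) + (o2 \in D)) eA eB
      (d (braid_map st su tu x)) (d' x) ->
    weight P (braid_map st su tu x) (add eA k D) = weight P' x (add eB k' D);
  tr_rvec : forall x eA eB D y, k \notin D -> k' \notin D ->
    choice ((i1 \in D) + (i2 \in D)) ((o1 \in D) + (o2 \in D)) eA eB
      (d (braid_map st su tu x)) (d' x) ->
    (forall r, (y r)%:Z = (x r)%:Z + rvec P' (add eB k' D) r) ->
    forall r, (braid_map st su tu y r)%:Z =
              (braid_map st su tu x r)%:Z + rvec P (add eA k D) r }.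

Section Step.
Variables (P P' : {set tile n}) (k k' i1 i2 o1 o2 : vertex n).
Variables (st su tu : proot n) (d d' : nvec n -> int) (a : 'I_n.-1).
Hypotheses (X : exchange P P' k k' i1 i2 o1 o2)
  (Y : transfer P P' k k' i1 i2 o1 o2 st su tu d d').
Variable x : nvec n.
Local Notation z := (braid_map st su tu x).

(** For a fixed trace D outside the inner vertices, both tilings are optimized at once. Where
    [hex_spec] leaves the inner vertex free, it is taken exactly if its contribution is nonnegative,
    so that a tie goes to the larger set. *)
Lemma best_choice D : k \notin D -> k' \notin D ->
  (exists e, add e k D \in regions P a) \/ (exists e, add e k' D \in regions P' a) ->
  exists eA eB,
  [/\ add eA k D \in regions P a, add eB k' D \in regions P' a,
      choice ((i1 \in D) + (i2 \in D)) ((o1 \in D) + (o2 \in D)) eA eB (d z) (d' x),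
      forall e, add e k D \in regions P a ->
        weight P z (add e k D) <= weight P z (add eA k D) /\
        (weight P z (add e k D) = weight P z (add eA k D) -> e ==> eA) &
      forall e, add e k' D \in regions P' a ->
        weight P' x (add e k' D) <= weight P' x (add eB k' D) /\
        (weight P' x (add e k' D) = weight P' x (add eB k' D) -> e ==> eB)].
Proof.
move=> nk nk'; case: (ex_spec X a nk nk') => [h1 h2|eA eB h1 h2 h3 h4|eB h1 h2 h3 h4|eA h1 h2 h3
  h4].
- by case=> -[e]; rewrite ?h1 ?h2.
- move=> _; exists eA, eB; rewrite h1 h2 !eqxx; split=> //; first by constructor 1.
    by move=> e; rewrite h1 => /eqP->; rewrite implybb.
  by move=> e; rewrite h2 => /eqP->; rewrite implybb.
- move=> _; exists (0 <= d z), eB; rewrite h1 h2 eqxx; split=> //; first by constructor 2.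
    move=> e _; have h := tr_k Y z nk.
    by case: (lerP 0 (d z)) => hd; case: e => /=; rewrite ?h ?lerDl ?gerDl ?(ltW hd);
      split=> // /eqP; rewrite -subr_eq0 addrC addKr => /eqP e0; rewrite e0 ltxx in hd.
  by move=> e; rewrite h2 => /eqP->; rewrite implybb.
- move=> _; exists eA, (0 <= d' x); rewrite h1 h2 eqxx; split=> //; first by constructor 3.
    by move=> e; rewrite h2 => /eqP->; rewrite implybb.
  move=> e _; have h := tr_k' Y x nk'.
  by case: (lerP 0 (d' x)) => hd; case: e => /=; rewrite ?h ?lerDl ?gerDl ?(ltW hd);
      split=> // /eqP; rewrite -subr_eq0 addrC addKr => /eqP e0; rewrite e0 ltxx in hd.
Qed.

Lemma addD1 v E : E = add (v \in E) v (E :\ v).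
Proof.
apply/setP=> w; rewrite in_add in_setD1.
by case: (eqVneq w v) => [->|]; rewrite ?andbT ?andbF ?orbF.
Qed.

(** The optimal extensions of a trace D have equal weights on both sides, so maximality is
    transported with the trace of E'. A maximizer E2 on the side of P has its trace in D by the
    choice of E'; what remains is the inner vertex. *)
Lemma crystal_step E' y : selected P' a x E' ->
  (forall r, (y r)%:Z = (x r)%:Z + rvec P' E' r) ->
  exists2 E, selected P a z E &
    forall r, (braid_map st su tu y r)%:Z = (z r)%:Z + rvec P E r.
Proof.
move=> [rE' maxE'] yE; set D := E' :\ k'.
have nk' : k' \notin D by rewrite !inE eqxx.
have nk : k \notin D.
  rewrite in_setD1 negb_and; apply/orP; right; apply/negP => kE'.
  by case/regionsP: rE' => /subsetP/(_ _ kE'); rewrite (negPf (ex_kP' X)).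
have [|eA [eB [rA rB ch maxA maxB]]] := best_choice nk nk'.
  by right; exists (k' \in E'); rewrite -addD1.
have eBE : eB = (k' \in E').
  have [l1 s1] := maxE' _ rB; have := maxB (k' \in E'); rewrite -addD1 => /(_ rE')[l2 s2].
  have e : weight P' x E' = weight P' x (add eB k' D) by apply/eqP; rewrite eq_le l1 l2.
  have := s2 e; have /subsetP := s1 (esym e); move=> /(_ k'); rewrite in_add eqxx andbT.
  by case: (k' \in E'); case: (eB) => // /(_ isT).
have E'D : E' = add eB k' D by rewrite eBE -addD1.
have wE : weight P z (add eA k D) = weight P' x E' by rewrite E'D; apply: (tr_weight Y).
exists (add eA k D); last by apply: (tr_rvec Y) ch _ => //; rewrite -E'D.
split=> // E2 r2; set D2 := E2 :\ k.
have nk2 : k \notin D2 by rewrite !inE eqxx.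
have nk2' : k' \notin D2.
  rewrite in_setD1 negb_and; apply/orP; right; apply/negP => kE2.
  by case/regionsP: r2 => /subsetP/(_ _ kE2); rewrite (negPf (ex_k'P X)).
have [|eA2 [eB2 [rA2 rB2 ch2 maxA2 maxB2]]] := best_choice nk2 nk2'.
  by left; exists (k \in E2); rewrite -addD1.
have := maxA2 (k \in E2); rewrite -addD1 => /(_ r2)[l1 s1].
have [l2 s2] := maxE' _ rB2.
have w2 := tr_weight Y nk2 nk2' ch2.
have le : weight P z E2 <= weight P z (add eA k D) by rewrite wE (le_trans l1) // w2.
split=> // e.
have e2 : weight P' x (add eB2 k' D2) = weight P' x E'.
  by apply/eqP; rewrite eq_le l2 -wE -e -w2 l1.
have sub : D2 \subset D.
  apply/subsetP => v vD2; have /subsetP := s2 e2; move=> /(_ v); rewrite in_add vD2 orbT.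
  move=> /(_ isT) vE'; rewrite in_setD1 vE' andbT.
  by apply: contraNneq nk2' => <-.
apply/subsetP => v vE2; rewrite in_add.
have [vk|vk] := eqVneq v k; last first.
  by rewrite andbF /=; apply: (subsetP sub); rewrite in_setD1 vk.
rewrite andbT; suff -> : eA by [].
(* If k lies in E2, then D with k is the union of two maximizers. The intersection is a region, so
   by modularity the union has maximal weight as well, and the tie rule of [best_choice] puts k into
   the selected set. *)
have eU : add eA k D :|: E2 = add true k D.
  apply/setP=> w; rewrite in_setU !in_add /=.
  have [->|wk] := eqVneq w k; first by rewrite -vk vE2 orbT.
  rewrite andbF /=; case: (boolP (w \in D)) => //= wD.
  by apply: contraNF wD => wE2; apply: (subsetP sub); rewrite in_setD1 wk.
have rU := regionsU rA r2; have rI := regionsI rA r2.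
have mod := weight_modular P z (add eA k D) E2.
have bound E3 : E3 \in regions P a -> weight P z E3 <= weight P z (add eA k D).
  move=> r3; have nk3 : k \notin E3 :\ k by rewrite !inE eqxx.
  have nk3' : k' \notin E3 :\ k.
    rewrite in_setD1 negb_and; apply/orP; right; apply/negP => kE3.
    by case/regionsP: r3 => /subsetP/(_ _ kE3); rewrite (negPf (ex_k'P X)).
  have [|eA3 [eB3 [rA3 rB3 ch3 maxA3 maxB3]]] := best_choice nk3 nk3'.
    by left; exists (k \in E3); rewrite -addD1.
  have := maxA3 (k \in E3); rewrite -addD1 => /(_ r3)[l3 _].
  by rewrite (le_trans l3) // (tr_weight Y nk3 nk3' ch3) wE; have [] := maxE' _ rB3.
have bU := bound _ rU; have bI := bound _ rI.
rewrite eU in rU bU mod.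
have [_ s3] := maxA true rU.
apply: (implyP (s3 _)) => //; move: mod bU bI; rewrite e; clear.
by move: (weight P z (add true k D)) (weight P z (add eA k D)) (weight P z (_ :&: _)) => *; lia.
Qed.

End Step.

Section FlipTransfer.
Variables (O P P' : {set tile n}) (s t u : 'I_n) (S : vertex n).
Variables (st su tu : proot n).
Hypothesis F : flip O P P' s t u S st su tu.
Local Notation cb := (cube s t u S).
Local Notation kA := (cb false true false).
Local Notation kB := (cb true false true).

Lemma weight_old x e D : kA \notin D ->
  weight P x (add e kA D) =
  (x st)%:Z * (e%:Z - (cb true false false \in D)%:Z) +
  (x su)%:Z * ((cb false true true \in D)%:Z - (cb true true false \in D)%:Z) +
  (x tu)%:Z * ((cb false false true \in D)%:Z - e%:Z) + weight O x D.
Proof.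
move=> /negPf nk; rewrite /weight (sum_flip F).
have [[a1 [a2 [a3 a4]]] [b1 [b2 [b3 b4]]] [c1 [c2 [c3 c4]]]] := flip_corners F.
rewrite a2 a3 b2 b3 c2 c3 /= !in_add !(cube_eq F) /= !andbF !andbT nk !orbF /=.
congr (_ + _); apply: eq_bigr => T TO.
have := flip_oldv F TO; rewrite /vertices !inE !negb_or => /andP[/andP[/andP[_ n2] n3] _].
by rewrite !in_add ![_ == kA]eq_sym (negPf n2) (negPf n3) !andbF.
Qed.

Lemma weight_new x e D : kB \notin D ->
  weight P' x (add e kB D) =
  (x su)%:Z * ((cb false false true \in D)%:Z - (cb true false false \in D)%:Z) +
  (x st)%:Z * ((cb false true true \in D)%:Z - e%:Z) +
  (x tu)%:Z * (e%:Z - (cb true true false \in D)%:Z) + weight O x D.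
Proof.
move=> /negPf nk; rewrite /weight (sum_flip' F).
have [[a1 [a2 [a3 a4]]] [b1 [b2 [b3 b4]]] [c1 [c2 [c3 c4]]]] := flip_corners' F.
rewrite a2 a3 b2 b3 c2 c3 /= !in_add !(cube_eq F) /= !andbF !andbT nk !orbF /=.
congr (_ + _); apply: eq_bigr => T TO.
have := flip_newv F TO; rewrite /vertices !inE !negb_or => /andP[/andP[/andP[_ n2] n3] _].
by rewrite !in_add ![_ == kB]eq_sym (negPf n2) (negPf n3) !andbF.
Qed.

Lemma rvec_old e D r : kA \notin D ->
  rvec P (add e kA D) r =
  (st == r)%:Z * ((cb true false false \in D)%:Z + e%:Z - (cb true true false \in D)%:Z
     - (cb false false false \in D)%:Z) +
  (su == r)%:Z * ((cb true true false \in D)%:Z + (cb false true true \in D)%:Z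
     - (cb true true true \in D)%:Z - e%:Z) +
  (tu == r)%:Z * (e%:Z + (cb false false true \in D)%:Z - (cb false true true \in D)%:Z
     - (cb false false false \in D)%:Z) + rvec O D r.
Proof.
move=> /negPf nk; rewrite !ffunE (sum_flip F) /corner_sum.
have [[a1 [a2 [a3 a4]]] [b1 [b2 [b3 b4]]] [c1 [c2 [c3 c4]]]] := flip_corners F.
rewrite !(a1, a2, a3, a4, b1, b2) !(b3, b4, c1, c2, c3, c4) /=.
rewrite !in_add !(cube_eq F) /= !andbF !andbT nk !orbF /=.
congr (_ + _); apply: eq_bigr => T TO; congr (_ * _).
have := flip_oldv F TO; rewrite /vertices !inE !negb_or => /andP[/andP[/andP[n1 n2] n3] n4].
by rewrite !in_add ![_ == kA]eq_sym (negPf n1) (negPf n2) (negPf n3) (negPf n4) !andbF.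
Qed.

Lemma rvec_new e D r : kB \notin D ->
  rvec P' (add e kB D) r =
  (su == r)%:Z * ((cb true false false \in D)%:Z + (cb false false true \in D)%:Z
     - e%:Z - (cb false false false \in D)%:Z) +
  (st == r)%:Z * (e%:Z + (cb false true true \in D)%:Z
     - (cb true true true \in D)%:Z - (cb false false true \in D)%:Z) +
  (tu == r)%:Z * ((cb true true false \in D)%:Z + e%:Z
     - (cb true true true \in D)%:Z - (cb true false false \in D)%:Z) + rvec O D r.
Proof.
move=> /negPf nk; rewrite !ffunE (sum_flip' F) /corner_sum.
have [[a1 [a2 [a3 a4]]] [b1 [b2 [b3 b4]]] [c1 [c2 [c3 c4]]]] := flip_corners' F.
rewrite !(a1, a2, a3, a4, b1, b2) !(b3, b4, c1, c2, c3, c4) /=.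
rewrite !in_add !(cube_eq F) /= !andbF !andbT nk !orbF /=.
congr (_ + _); apply: eq_bigr => T TO; congr (_ * _).
have := flip_newv F TO; rewrite /vertices !inE !negb_or => /andP[/andP[/andP[n1 n2] n3] n4].
by rewrite !in_add ![_ == kB]eq_sym (negPf n1) (negPf n2) (negPf n3) (negPf n4) !andbF.
Qed.

Let rvecO D r : r \in [:: st; su; tu] -> rvec O D r = 0.
Proof.
rewrite !inE ffunE => rh; apply: big1 => T TO.
have [n1 n2 n3] := flip_rootsO F TO.
suff -> : T.1 == r = false by rewrite mul0r.
by apply/negP => /eqP e; rewrite -e in rh; rewrite n1 n2 n3 in rh.
Qed.

Lemma braid_mapE x : let m := minn (x st) (x tu) in
  [/\ braid_map st su tu x st = (x st + x su - m)%N, braid_map st su tu x su = m,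
      braid_map st su tu x tu = (x tu + x su - m)%N &
      forall r, r \notin [:: st; su; tu] -> braid_map st su tu x r = x r].
Proof.
have [n1 n2 n3] := flip_rootsne F.
rewrite /braid_map; split=> [|||r]; rewrite ?ffunE ?eqxx //.
- by rewrite eq_sym n1.
- by rewrite eq_sym n2 eq_sym n3.
- by rewrite !inE !negb_or => /and3P[/negPf-> /negPf-> /negPf->].
Qed.

Let weightO_braid x D : weight O (braid_map st su tu x) D = weight O x D.
Proof.
apply: eq_bigr => T TO; have [_ _ _ -> //] := braid_mapE x.
by have [n1 n2 n3] := flip_rootsO F TO; rewrite !inE n1 n2 n3.
Qed.

Definition delta_old (x : nvec n) : int := (x st)%:Z - (x tu)%:Z.
Definition delta_new (x : nvec n) : int := (x tu)%:Z - (x st)%:Z.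

Lemma transfer_old : transfer P P' kA kB (cb true false false) (cb false true true)
  (cb true true false) (cb false false true) st su tu delta_old delta_new.
Proof.
split.
- move=> x D nk; rewrite -[kA |: D]/(add true kA D) -[X in _ = weight _ _ X + _]/(add false kA D).
  by rewrite !weight_old // /delta_old /=; ring.
- move=> x D nk; rewrite -[kB |: D]/(add true kB D) -[X in _ = weight _ _ X + _]/(add false kB D).
  by rewrite !weight_new // /delta_new /=; ring.
- move=> x eA eB D nA nB; rewrite weight_old // weight_new // weightO_braid.
  have [b1 b2 b3 _] := braid_mapE x.
  rewrite /delta_old /delta_new b1 b2 b3 => ch; congr (_ + _).
  exact: choice_weight_new ch.
- move=> x eA eB D y nA nB ch yE r; rewrite rvec_old //.
  have [b1 b2 b3 b4] := braid_mapE x; have [c1 c2 c3 c4] := braid_mapE y.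
  have [n1 n2 n3] := flip_rootsne F.
  rewrite /delta_old /delta_new b1 b3 in ch.
  have [r1 r2 r3] : [/\ rvec O D st = 0, rvec O D su = 0 & rvec O D tu = 0].
    by split; apply: rvecO; rewrite !inE eqxx ?orbT.
  have [] := choice_rvec_new (y1 := y st) (y2 := y su) (y3 := y tu)
     (b000 := cb false false false \in D) (b111 := cb true true true \in D) ch.
  + by rewrite yE rvec_new // r1 eqxx [su == st]eq_sym [tu == st]eq_sym n1 n2; rewrite /= !(mul0r,
    mul1r); ring.
  + by rewrite yE rvec_new // r2 eqxx [tu == su]eq_sym n1 n3; rewrite /= !(mul0r, mul1r); ring.
  + by rewrite yE rvec_new // r3 eqxx n2 n3; rewrite /= !(mul0r, mul1r); ring.
  rewrite -c1 -c3 -c2 -b1 -b3 -b2 => f1 f2 f3.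
  have [rh|rh] := boolP (r \in [:: st; su; tu]); last first.
    move: (rh); rewrite !inE !negb_or ![r == _]eq_sym => /and3P[/negPf m1 /negPf m2 /negPf m3].
    by rewrite b4 // c4 // yE rvec_new // m1 m2 m3; rewrite /= !(mul0r, mul1r); ring.
  move: rh; rewrite !inE => /or3P[] /eqP->.
  + by rewrite f1 r1 eqxx [su == st]eq_sym [tu == st]eq_sym n1 n2; rewrite /= !(mul0r, mul1r); ring.
  + by rewrite f2 r2 eqxx [tu == su]eq_sym n1 n3; rewrite /= !(mul0r, mul1r); ring.
  + by rewrite f3 r3 eqxx n2 n3; rewrite /= !(mul0r, mul1r); ring.
Qed.

Lemma transfer_new : transfer P' P kB kA (cb true true false) (cb false false true)
  (cb true false false) (cb false true true) st su tu delta_new delta_old.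
Proof.
split.
- exact: tr_k' transfer_old.
- exact: tr_k transfer_old.
- move=> x eB eA D nB nA; rewrite weight_old // weight_new // weightO_braid.
  have [b1 b2 b3 _] := braid_mapE x.
  rewrite /delta_old /delta_new b1 b2 b3 => ch; congr (_ + _).
  exact: choice_weight_old ch.
- move=> x eB eA D y nB nA ch yE r; rewrite rvec_new //.
  have [b1 b2 b3 b4] := braid_mapE x; have [c1 c2 c3 c4] := braid_mapE y.
  have [n1 n2 n3] := flip_rootsne F.
  rewrite /delta_old /delta_new b1 b3 in ch.
  have [r1 r2 r3] : [/\ rvec O D st = 0, rvec O D su = 0 & rvec O D tu = 0].
    by split; apply: rvecO; rewrite !inE eqxx ?orbT.
  have [] := choice_rvec_old (y1 := y st) (y2 := y su) (y3 := y tu)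
     (b000 := cb false false false \in D) (b111 := cb true true true \in D) ch.
  + by rewrite yE rvec_old // r1 eqxx [su == st]eq_sym [tu == st]eq_sym n1 n2; rewrite /= !(mul0r,
    mul1r); ring.
  + by rewrite yE rvec_old // r2 eqxx [tu == su]eq_sym n1 n3; rewrite /= !(mul0r, mul1r); ring.
  + by rewrite yE rvec_old // r3 eqxx n2 n3; rewrite /= !(mul0r, mul1r); ring.
  rewrite -c1 -c3 -c2 -b1 -b3 -b2 => f1 f2 f3.
  have [rh|rh] := boolP (r \in [:: st; su; tu]); last first.
    move: (rh); rewrite !inE !negb_or ![r == _]eq_sym => /and3P[/negPf m1 /negPf m2 /negPf m3].
    by rewrite b4 // c4 // yE rvec_old // m1 m2 m3; rewrite /= !(mul0r, mul1r); ring.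
  move: rh; rewrite !inE => /or3P[] /eqP->.
  + by rewrite f1 r1 eqxx [su == st]eq_sym [tu == st]eq_sym n1 n2; rewrite /= !(mul0r, mul1r); ring.
  + by rewrite f2 r2 eqxx [tu == su]eq_sym n1 n3; rewrite /= !(mul0r, mul1r); ring.
  + by rewrite f3 r3 eqxx n2 n3; rewrite /= !(mul0r, mul1r); ring.
Qed.

End FlipTransfer.
End Crystal.

(** * The increments of the crystal operator are the vectors of the regions *)

Section Directions.
Variable n : nat.
Implicit Types (p q i j : word n) (l m : 'I_n.-1) (v : vertex n) (T : tile n).
Implicit Types (a : 'I_n.-1) (D E : {set vertex n}) (x y : nvec n).

Lemma comm_tiles i j : comm_move i j -> tiles i = tiles j.
Proof.
have far_tile p l m : (l.+1 < m)%N || (m.+1 < l)%N ->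
    [set T | tile_at (rcons p l) m T] = [set T | tile_at p m T].
  move=> far; apply/setP=> T; rewrite !inE /tile_at !wact_rcons.
  have [-> ->] := sigma_far far; rewrite cham_rcons //.
  by apply/eqP => e; move: far; rewrite e; lia.
case=> [p [q [l [m [far -> ->]]]]].
rewrite !tiles_fromE !tiles_from_cat /= !far_tile //; last by rewrite orbC.
rewrite !setU0; congr (_ :|: (_ :|: _)); first exact: setUC.
by apply: eq_tiles_from => x; rewrite !wact_cat /= sigma_comm.
Qed.

Lemma first_difference (A : eqType) (p p' u v u' v' : seq A) b c b' c' :
  b != c -> b' != c' ->
  p ++ b :: u = p' ++ b' :: u' -> p ++ c :: v = p' ++ c' :: v' -> p = p' /\ b = b' /\ c = c'.
Proof.
elim: p p' => [|d p IH] [|d' p'] nbc nbc' //=.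
- by case=> -> _ [-> _].
- by case=> e1 _ [e2 _]; rewrite e1 e2 eqxx in nbc.
- by case=> e1 _ [e2 _]; rewrite -e1 -e2 eqxx in nbc'.
- by case=> -> e1 [e2]; have [-> [-> ->]] := IH p' nbc nbc' e1 e2.
Qed.

(** The first place where the two words differ already shows l and m up to order, and hence the
    three roots. *)
Lemma braid_letters (st su tu : proot n) i j : braid_move st su tu i j ->
  exists p b c (u w : word n), [/\ b != c, i = p ++ b :: u, j = p ++ c :: w &
    let l := if (b < c)%N then b else c in let m := if (b < c)%N then c else b in
    [/\ val st = (wact p (lo l), wact p (hi l)), val su = (wact p (lo l), wact p (hi m))
      & val tu = (wact p (hi l), wact p (hi m))]].
Proof.
case=> p [q [l [m [adj [[-> ->]|[-> ->]] e1 e2 e3]]]].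
  exists p, l, m, ([:: m; l] ++ q), ([:: l; m] ++ q); split=> //.
    by rewrite -val_eqE /=; lia.
  by have -> : (l < m)%N by lia.
exists p, m, l, ([:: l; m] ++ q), ([:: m; l] ++ q); split=> //.
  by rewrite -val_eqE /=; lia.
by have -> : (m < l)%N = false by lia.
Qed.

(** [fstar] leaves a word by one transition and returns by another, each with its own existentially
    quantified roots. Their agreement is needed to treat the pair as a single flip. *)
Lemma braid_move_inj (st su tu st' su' tu' : proot n) i j :
  braid_move st su tu i j -> braid_move st' su' tu' j i -> [/\ st = st', su = su' & tu = tu'].
Proof.
move=> /braid_letters[p [b [c [u [v [bc -> -> [e1 e2 e3]]]]]]].
move=> /braid_letters[p' [b' [c' [u' [v' [bc' ej ei [f1 f2 f3]]]]]]].
have [ep [eb ec]] : p = p' /\ b = c' /\ c = b'.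
  by apply: first_difference ei ej; rewrite // eq_sym.
have lm : (if (b' < c')%N then b' else c') = (if (b < c)%N then b else c) /\
          (if (b' < c')%N then c' else b') = (if (b < c)%N then c else b).
  rewrite eb ec; move: bc'; rewrite -val_eqE /=.
  by case: (ltngtP b' c').
rewrite /= in e1 e2 e3 f1 f2 f3; rewrite lm.1 lm.2 -ep in f1 f2 f3.
by split; apply: val_inj; rewrite /= ?e1 ?e2 ?e3.
Qed.

Lemma comm_not_braid (st su tu : proot n) i j : comm_move i j -> braid_move st su tu i j -> False.
Proof.
case=> p [q [l [m [_ -> ->]]]] [p' [q' [l' [m' [adj e _ _ _]]]]].
have ne : (l' == m') = false by rewrite -val_eqE /=; lia.
(* A commutation keeps the number of occurrences of each letter, a braid move does not. *)
have [] : count_mem l' (p ++ [:: l; m] ++ q) = count_mem l' (p ++ [:: m; l] ++ q).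
  by rewrite !count_cat /=; lia.
by case: e => -[-> ->]; rewrite !count_cat /= !eqxx eq_sym ne; lia.
Qed.

Lemma comm_moveC i j : comm_move i j -> comm_move j i.
Proof.
by case=> p [q [l [m [far -> ->]]]]; exists p, q, m, l; rewrite orbC.
Qed.

Lemma braid_mapK (st su tu : proot n) x : st != su -> st != tu -> su != tu ->
  braid_map st su tu (braid_map st su tu x) = x.
Proof.
move=> /negPf n1 /negPf n2 /negPf n3; apply/ffunP => r; rewrite !ffunE !eqxx.
rewrite [su == st]eq_sym n1 [tu == st]eq_sym n2 [tu == su]eq_sym n3.
have K1 (x1 x2 x3 : nat) : (x1 + x2 - minn x1 x3 + minn x1 x3 -
    minn (x1 + x2 - minn x1 x3) (x3 + x2 - minn x1 x3))%N = x1 by lia.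
have K2 (x1 x2 x3 : nat) : minn (x1 + x2 - minn x1 x3) (x3 + x2 - minn x1 x3) = x2 by lia.
case: (eqVneq r st) => [->|_]; first exact: K1.
case: (eqVneq r su) => [->|_]; first exact: K2.
case: (eqVneq r tu) => [->|_] //.
by rewrite [minn (x st) _]minnC [X in (_ - X)%N]minnC K1.
Qed.

Lemma braid_move_neq (st su tu : proot n) i j : braid_move st su tu i j ->
  [/\ st != su, st != tu & su != tu].
Proof.
case=> p [q [l [m [adj _ e1 e2 e3]]]].
have inj := inj_eq (can_inj (wactK p)).
split; rewrite -(inj_eq val_inj) ?e1 ?e2 ?e3 xpair_eqE !inj -!val_eqE /=; lia.
Qed.

Lemma rvecE i E T : asc i -> T \in tiles i -> rvec (tiles i) E T.1 = corner_sum E T.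
Proof.
move=> ai Ti; rewrite ffunE (bigD1 T) //= eqxx mul1r big1 ?addr0 // => T' /andP[T'i ne].
suff -> : T'.1 == T.1 = false by rewrite mul0r.
by apply: contraNF ne => /eqP e; apply/eqP; apply: tiles_root_inj ai T'i Ti e.
Qed.

(** By [wt], the vertex [fundamental a] is on no path before the last letter. It is thus a corner of
    the last tile only, as its right corner, and the root of that tile is the simple root because
    the word represents w_0. *)
Lemma rvec_ends_dual i a : reduced i -> ends_dual i a ->
  rvec (tiles i) [set fundamental a] = [ffun r => (r == simple_root a)%:Z].
Proof.
move=> ri [i' ei]; have ai := reduced_asc ri.
apply/ffunP => r; have [T Ti <-] := tiles_root r ri; rewrite rvecE // ffunE.
set b := rev_ord a in ei; have lt_b : (b.+2 <= n)%N := ltn_ord (hi b).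
have fE : fundamental a = cham i b.+1.
  apply/setP=> y; rewrite !inE reduced_pos //=.
  by have := ltn_ord y; have := ltn_ord a; lia.
have wlo : wact i' (lo b) = lo a.
  rewrite -[lo b]sigma_hi -wact_rcons -ei ri.2; apply/val_inj => /=.
  by have := ltn_ord a; lia.
have whi : wact i' (hi b) = hi a.
  rewrite -[hi b]sigma_lo -wact_rcons -ei ri.2; apply/val_inj => /=.
  by have := ltn_ord a; lia.
move: Ti; rewrite ei -cats1 tiles_fromE tiles_from_cat -tiles_fromE in_setU /= setU0.
case/orP => [Ti|]; last rewrite inE => Tat.
  have nv v : v \in vertices T -> v == fundamental a = false.
    move=> vT; apply/eqP => ev; have [p [q [h [e le vE]]]] := tiles_vertices Ti vT.
    have eh : h = b.+1.
      by rewrite -(card_cham p le) -vE ev fE card_cham // ltnW.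
    have : asc (p ++ q) by rewrite -e; apply: (@asc_cat _ _ [:: b]); rewrite cats1 -ei.
    move=> /(wt_mono h); rewrite -vE ev fE -e ei eh leqNgt => /negP; apply.
    by apply: wt_step; rewrite -ei.
  rewrite /corner_sum !in_set1 !nv /vertices ?inE ?eqxx ?orbT //=.
  suff -> : T.1 == simple_root a = false by [].
  apply/negP => /eqP eT; have /tilesP[p [l [q [e /andP[/eqP e1 _]]]]] := Ti.
  have := asc_uniq ai; rewrite ei roots_rcons rcons_uniq wlo whi => /andP[/negP + _]; apply.
  by rewrite -[(lo a, hi a)]/(val (simple_root a)) -eT e1 e roots_cat mem_cat /= inE eqxx orbT.
have -> : T.1 = simple_root a.
  by apply: val_inj; case/andP: Tat => /eqP -> _ /=; rewrite wlo whi.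
have [e1 e2 e3 e4] := tile_atE Tat.
rewrite eqxx /corner_sum !in_set1 e1 e2 e3 e4 -ei -fE eqxx.
have ne h : (h <= n)%N -> h != b.+1 -> cham i' h == fundamental a = false.
  move=> le ne; apply/eqP => e; case/eqP: ne.
  by rewrite -(card_cham i' le) e fE card_cham // ltnW.
rewrite (ne b) ?(ne b.+2) ?(ltnW (ltnW lt_b)) //; try lia.
suff -> : cham i' b.+1 == fundamental a = false by [].
apply/eqP => e; have := wt_step (l := b) (p := i'); rewrite -ei -fE e ltnn => /(_ ai).
by [].
Qed.

Lemma transition_move i j x y : transition i j x y -> move i j.
Proof. by case=> [[c _]|[st [su [tu [b _]]]]]; [left|right; exists st, su, tu]. Qed.

Lemma fstar_selected a i x y : fstar a i x y -> reduced i ->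
  exists2 E, selected (tiles i) a x E & forall r, (y r)%:Z = (x r)%:Z + rvec (tiles i) E r.
Proof.
elim=> {i x y} [i x ed ri|i j x x' y' y tr _ IH tr' ri].
  have eR := regions_ends_dual ri ed.
  exists [set fundamental a]; last by move=> r; rewrite rvec_ends_dual // !ffunE.
  by split=> [|E']; rewrite eR ?set11 // inE => /eqP->.
have rj := move_reduced (transition_move tr) ri.
have [E' sE' yE] := IH rj.
case: tr tr' => [[cm xx]|[st [su [tu [br xx]]]]] [[cm' yy]|[st' [su' [tu' [br' yy]]]]].
- by exists E'; rewrite (comm_tiles cm) ?yy -?xx.
- by case: (comm_not_braid (comm_moveC cm) br').
- by case: (comm_not_braid (comm_moveC cm') br).
have [e1 e2 e3] := braid_move_inj br br'; rewrite -{}e1 -{}e2 -{}e3 in br' yy.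
have [n1 n2 n3] := braid_move_neq br.
have xE : x = braid_map st su tu x' by rewrite xx braid_mapK.
rewrite xE yy; case: br => p [q [l [m [adj [[ei ej]|[ei ej]] e1 e2 e3]]]].
  have ai := reduced_asc ri; rewrite ei in ai ri *; rewrite ej in sE' yE.
  have [Ot F] := braid_flip adj ai ri e1 e2 e3.
  have [E s1 s2] := crystal_step (flip_exchange F) (transfer_old F) sE' yE.
  by exists E.
have aj := reduced_asc rj; rewrite ej in aj rj sE' yE; rewrite ei.
have [Ot F] := braid_flip adj aj rj e1 e2 e3.
have [E s1 s2] := crystal_step (exchangeC (flip_exchange F)) (transfer_new F) sE' yE.
by exists E.
Qed.

Lemma move_exchange i j : move i j -> reduced i ->
  tiles i = tiles j \/ exists w w' i1 i2 o1 o2 : vertex n,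
    exchange (tiles i) (tiles j) w w' i1 i2 o1 o2.
Proof.
move=> mv ri; have rj := move_reduced mv ri; case: mv => [cm|]; first by left; apply: comm_tiles.
case=> st [su [tu [p [q [l [m [adj [[ei ej]|[ei ej]] e1 e2 e3]]]]]]]; right.
  have ai := reduced_asc ri; rewrite ei in ai ri *; rewrite ej.
  have [Ot F] := braid_flip adj ai ri e1 e2 e3; do 6!eexists; exact: flip_exchange F.
have aj := reduced_asc rj; rewrite ej in aj rj *; rewrite ei.
have [Ot F] := braid_flip adj aj rj e1 e2 e3.
do 6!eexists; exact: exchangeC (flip_exchange F).
Qed.

Lemma transition_exists i j x : move i j -> exists y, transition i j x y.
Proof.
case=> [c|[st [su [tu b]]]]; first by exists x; left.
by exists (braid_map st su tu x); right; exists st, su, tu.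
Qed.

Lemma fstar_exists a i x : reduced i -> exists y, fstar a i x y.
Proof.
move=> ri; have [j mij ed] := reduced_ends_dual a ri.
elim: mij ed x {ri} => [k ed x|i1 j1 k1 mv _ IH ed x].
  by exists (incr a x); apply: FstarBase.
have [x' tx] := transition_exists x mv; have [y' fy] := IH ed x'.
have [y ty] := transition_exists y' (move_sym mv).
by exists y; apply: FstarMove tx fy ty.
Qed.

(** The vector x is 0 or 1 on each tile and supported where E attains the largest value that the
    term of a region can have there. Then E maximizes the weight term by term, and a region of equal
    weight agrees with E in every term. *)
Lemma region_selected a i E : reduced i -> E \in regions (tiles i) a ->
  exists x, selected (tiles i) a x E.
Proof.
move=> ri rE; have ai := reduced_asc ri.
pose same T := ((val T.1).1 \in fundamental a) == ((val T.1).2 \in fundamental a).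
(* With both labels on one side of a, membership passes from right to left, and the term is at most
   0; otherwise it can be 1. The condition says that E attains this bound. *)
pose c T := if same T then (right T \in E) == (left T \in E)
            else (right T \in E) && (left T \notin E).
pose x : nvec n := [ffun r => nat_of_bool [exists T in tiles i, (T.1 == r) && c T]].
have xE T : T \in tiles i -> x T.1 = c T.
  move=> Ti; rewrite ffunE; congr nat_of_bool; apply/exists_inP/idP => [[T' T'i]|cT].
    by case/andP => /eqP e; rewrite (tiles_root_inj ai T'i Ti e).
  by exists T; rewrite ?eqxx.
have [_ _ okE] := regionsP _ _ _ rE.
have term E' T : E' \in regions (tiles i) a -> T \in tiles i ->
    (x T.1)%:Z * ((right T \in E')%:Z - (left T \in E')%:Z) <=
    (x T.1)%:Z * ((right T \in E)%:Z - (left T \in E)%:Z).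
  move=> /regionsP[_ _ ok'] Ti; rewrite xE // /c.
  have := okE T Ti; have := ok' T Ti; rewrite /region_at -/(same T).
  have := fundamental_mono (a := a) (valP T.1).
  rewrite /same; do 2!case: (_ \in fundamental a) => //=; try by move=> /(_ isT).
  - by rewrite /corners_ok; do 8!case: (_ \in _).
  - by rewrite /corners_ok; do 8!case: (_ \in _).
  - by rewrite /corners_ok; do 8!case: (_ \in _).
exists x; split=> // E' rE'; split; first by apply: ler_sum => T Ti; apply: term.
move=> eW; have [E'V _ ok'] := regionsP _ _ _ rE'.
have eT T : T \in tiles i -> (x T.1)%:Z * ((right T \in E')%:Z - (left T \in E')%:Z) =
    (x T.1)%:Z * ((right T \in E)%:Z - (left T \in E)%:Z).
  move=> Ti; apply/eqP; rewrite eq_sym -subr_eq0; apply/eqP.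
  move: T Ti; apply: psumr_eq0P => [T Ti|]; first by rewrite subr_ge0 term.
  by rewrite sumrB -/(weight _ _ _) -/(weight _ _ _) eW subrr.
apply/subsetP => v.
(* A vertex of E' outside E leads to another one of larger [wt]; the bound n * n makes this
   impossible. *)
have [N] := ubnP (n * n - wt v)%N.
have wtb (w : vertex n) : (wt w <= n * n)%N.
  rewrite /wt -[(n * n)%N](_ : (\sum_(s < n) n = _)%N); last by rewrite sum_nat_const card_ord.
  by rewrite big_mkcond leq_sum // => s _; case: ifP => // _; apply: ltnW.
elim: N v => // N IH v lt vE'; apply/negPn/negP => vE.
have vV := subsetP E'V _ vE'.
have [vr|vr] := boolP (v \in right_boundary n).
  by move: vE; rewrite (region_right rE' vE' vr) (region_fundamental rE).
(* Take the tile with left corner v. Equality of its terms and the conditions on both regions force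
   its right corner to lie in E' and not in E. *)
have [T Ti eT'] := tiles_Vset_left ri vV vr.
have rT : right T \in E -> False.
  move=> rTE; have := eT T Ti; rewrite xE // /c -/(same T) rTE eT' (negPf vE) vE' /=.
  case: ifP => [sm _|_ ]; last by case: (_ \in _).
  by have := okE T Ti; rewrite /region_at /corners_ok -/(same T) sm rTE eT' (negPf vE) !andbF.
have rT' : right T \in E'.
  apply/negPn/negP => nr; have := ok' T Ti; have := eT T Ti.
  rewrite xE // /c /region_at /corners_ok -/(same T) eT' vE' (negPf vE) (negPf nr).
  have -> : right T \in E = false by apply/negP.
  have := fundamental_mono (a := a) (valP T.1); rewrite /same.
  do 2!case: (_ \in fundamental a) => //=; try by move=> /(_ isT).
  by case: (low T \in E'); case: (Defs.top T \in E').
apply/rT/IH => //; have := wt_lt_tile ai Ti; rewrite eT'.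
move: lt (wtb v) (wtb (right T)); move: (n * n)%N (wt v) (wt (right T)); clear.
by move=> *; lia.
Qed.

Lemma RstarE a i d : reduced i ->
  Rstar a i d <-> exists2 E, E \in regions (tiles i) a & d = rvec (tiles i) E.
Proof.
move=> ri; split=> [[x [y [f ->]]]|[E rE ->]].
  have [E [rE _] yE] := fstar_selected f ri; exists E => //.
  by apply/ffunP => r; rewrite ffunE yE addrC addKr.
have [x sE] := region_selected ri rE; have [y f] := fstar_exists a x ri.
exists x, y; split=> //; have [E' sE' yE] := fstar_selected f ri.
by apply/ffunP => r; rewrite ffunE yE addrC addKr (selected_inj sE sE').
Qed.

(** Along the sweep, each letter creates one vertex, the right corner of its tile, and the relation
    of the tile expresses its value by the values at the three older corners. *)
Lemma corner_zero i (e : vertex n -> int) : reduced i ->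
  (forall v, v \in left_boundary n -> e v = 0) ->
  (forall T, T \in tiles i -> e (left T) + e (right T) - e (Defs.top T) - e (low T) = 0) ->
  forall v, v \in Vset (tiles i) -> e v = 0.
Proof.
move=> ri e0 eT v; rewrite inE => /andP[_ /bigcupP[T Ti vT]].
have [p [q [h [ei le ->]]]] := tiles_vertices Ti vT.
have ai := reduced_asc ri; clear T Ti vT v.
elim/last_ind: p q h ei le => [|p l IH] q h ei le; first exact/e0/in_left_boundary.
have ei' : i = p ++ l :: q by rewrite ei cat_rcons.
have [->|ne] := eqVneq h l.+1; last by rewrite cham_rcons // (IH _ _ ei').
have [T Tat Ti] := tile_at_exists (etrans (congr1 _ (esym ei')) ai).
have := eT T; rewrite ei' Ti => /(_ isT); have [-> -> -> ->] := tile_atE Tat.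
have lt_l : (l.+2 <= n)%N := ltn_ord (hi l).
by rewrite !(IH _ _ ei') ?add0r ?subr0 //; lia.
Qed.

Lemma rvec_inj i a E E' : reduced i -> E \in regions (tiles i) a ->
  E' \in regions (tiles i) a -> rvec (tiles i) E = rvec (tiles i) E' -> E = E'.
Proof.
move=> ri /regionsP[EV _ _] /regionsP[E'V _ _] eR.
pose e v : int := (v \in E)%:Z - (v \in E')%:Z.
have nl (F : {set vertex n}) v : F \subset Vset (tiles i) -> v \in left_boundary n ->
  v \in F = false.
  by move=> sub vl; apply/negP => vF; have := subsetP sub _ vF; rewrite inE vl.
have e0 : forall v, v \in Vset (tiles i) -> e v = 0.
  apply: (@corner_zero i e ri) => [v vl|T Ti]; first by rewrite /e (nl E v EV vl) (nl E' v E'V vl).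
  have := congr1 (fun f : {ffun proot n -> int} => f T.1) eR.
  rewrite !rvecE ?(reduced_asc ri) // => h.
  have -> : e (left T) + e (right T) - e (Defs.top T) - e (low T) =
      corner_sum E T - corner_sum E' T by rewrite /corner_sum /e; ring.
  by rewrite h subrr.
apply/setP=> v; have [vV|vV] := boolP (v \in Vset (tiles i)).
  by have := e0 v vV; rewrite /e; do 2!case: (_ \in _).
by apply/idP/idP => [/(subsetP EV)|/(subsetP E'V)]; rewrite (negPf vV).
Qed.

End Directions.

(* f becomes g when a ring morphism ev of R to L is extended to the field of
   fractions K; the domain of definition is the localization of R at the kernel
   of ev, so that ev need not be injective. *)
Section Extension.
Variables (R : comNzRingType) (K L : fieldType).
Variables (io : {rmorphism R -> K}) (ev : {rmorphism R -> L}).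
Hypothesis io_inj : injective io.

Definition extends_to (f : K) (g : L) : Prop :=
  exists a b : R, [/\ ev b != 0, f * io b = io a & g * ev b = ev a].

Lemma extends_uniq f g1 g2 : extends_to f g1 -> extends_to f g2 -> g1 = g2.
Proof.
move=> [a1 [b1 [n1 f1 e1]]] [a2 [b2 [n2 f2 e2]]].
have : a1 * b2 = a2 * b1 by apply: io_inj; rewrite !rmorphM -f1 -f2; ring.
move=> /(congr1 ev); rewrite !rmorphM -e1 -e2 => e.
apply: (mulIf (mulf_neq0 n1 n2)); rewrite mulrA e; ring.
Qed.

Lemma extends_ring p : extends_to (io p) (ev p).
Proof. by exists p, 1; rewrite !rmorph1 !mulr1 oner_neq0. Qed.

Lemma extends1 : extends_to 1 1.
Proof. by have := extends_ring 1; rewrite !rmorph1. Qed.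

Lemma extends0 : extends_to 0 0.
Proof. by have := extends_ring 0; rewrite !rmorph0. Qed.

Lemma extendsD f1 f2 g1 g2 : extends_to f1 g1 -> extends_to f2 g2 ->
  extends_to (f1 + f2) (g1 + g2).
Proof.
move=> [a1 [b1 [n1 F1 e1]]] [a2 [b2 [n2 F2 e2]]].
exists (a1 * b2 + a2 * b1), (b1 * b2); rewrite !rmorphD !rmorphM.
by rewrite mulf_neq0 // -F1 -F2 -e1 -e2; split=> //; ring.
Qed.

Lemma extendsM f1 f2 g1 g2 : extends_to f1 g1 -> extends_to f2 g2 ->
  extends_to (f1 * f2) (g1 * g2).
Proof.
move=> [a1 [b1 [n1 F1 e1]]] [a2 [b2 [n2 F2 e2]]].
exists (a1 * a2), (b1 * b2); rewrite !rmorphM.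
by rewrite mulf_neq0 // -F1 -F2 -e1 -e2; split=> //; ring.
Qed.

Lemma extendsV f g : g != 0 -> extends_to f g -> extends_to f^-1 g^-1.
Proof.
move=> ng [a [b [nb F e]]]; have na : ev a != 0 by rewrite -e mulf_neq0.
have nf : f != 0.
  apply: contraNneq na => f0; move: F; rewrite f0 mul0r -(rmorph0 io).
  by move=> /io_inj <-; rewrite rmorph0.
by exists b, a; rewrite na -F -e !mulKf.
Qed.

Lemma extendsX f g n : extends_to f g -> extends_to (f ^+ n) (g ^+ n).
Proof.
by move=> fg; elim: n => [|n IH]; rewrite ?expr0 ?exprS; [apply: extends1|apply: extendsM].
Qed.

Lemma extendsXz f g (n : int) : g != 0 -> extends_to f g -> extends_to (f ^ n) (g ^ n).
Proof.
move=> ng fg; case: n => n; first exact: extendsX.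
by apply: extendsV (extendsX _ fg); rewrite expf_neq0.
Qed.

Lemma extends_sum (A : Type) (r : seq A) (P : pred A) F G :
  (forall i, P i -> extends_to (F i) (G i)) ->
  extends_to (\sum_(i <- r | P i) F i) (\sum_(i <- r | P i) G i).
Proof.
move=> h; apply: (big_ind2 (fun x y => extends_to x y)) => //; first exact: extends0.
by move=> *; apply: extendsD.
Qed.

Lemma extends_prod (A : Type) (r : seq A) (P : pred A) F G :
  (forall i, P i -> extends_to (F i) (G i)) ->
  extends_to (\prod_(i <- r | P i) F i) (\prod_(i <- r | P i) G i).
Proof.
move=> h; apply: (big_ind2 (fun x y => extends_to x y)) => //; first exact: extends1.
by move=> *; apply: extendsM.
Qed.

End Extension.

(** * Substitution into rational functions *)

Section Substitution.
Variable k : fieldType.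

Section Relation.
Variables (I J : finType) (z : I -> ratfun k J).
Local Notation mp := (mpoly.mpoly #|I| k).

Definition eval_at : {rmorphism mp -> ratfun k J} :=
  mpoly.mmap ((@tofrac (mpoly.mpoly #|J| k)) \o @mpoly.mpolyC #|J| k) (fun m : 'I_#|I| =>
    z (enum_val m)).

Definition subst_rel (f : ratfun k I) (g : ratfun k J) : Prop :=
  extends_to (@tofrac mp) eval_at f g.

Lemma tofrac_inj : injective (@tofrac mp).
Proof. by move=> p q /eqP; rewrite tofrac_eq => /eqP. Qed.

Lemma subst_const c : subst_rel (const I c) (const J c).
Proof.
rewrite -[const J c](_ : eval_at (mpoly.mpolyC _ c) = _); first exact: extends_ring.
exact: mpoly.mmapC.
Qed.

Lemma subst_var i : subst_rel (var k i) (z i).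
Proof.
rewrite -[z i](_ : eval_at (mpoly.mpolyX k (mpoly.mnm1 (enum_rank i))) = _).
  exact: extends_ring.
by rewrite [LHS]mpoly.mmapX mpoly.mmap1U enum_rankK.
Qed.

Lemma repr_frac (f : ratfun k I) :
  f * tofrac (frac (generic_quotient.repr f)).2 = tofrac (frac (generic_quotient.repr f)).1.
Proof.
set r := generic_quotient.repr f.
have -> : f = \pi_(ratfun k I)%qT r by rewrite generic_quotient.reprK.
unlock tofrac; rewrite -[LHS]FracField.pi_mul.
apply/generic_quotient.eqmodP; apply/eqP.
by rewrite /= /FracField.mulf /= !numden_Ratio ?oner_neq0 ?mulr1 ?mul1r ?denom_ratioP // mulrC.
Qed.

Lemma rcomp_subst f g : (forall p, p != 0 -> eval_at p != 0) ->
  subst_rel f g -> rcomp f z = g.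
Proof.
move=> inj; apply: (extends_uniq tofrac_inj).
have nd := inj _ (denom_ratioP (generic_quotient.repr f)).
exists (frac (generic_quotient.repr f)).1, (frac (generic_quotient.repr f)).2.
by split; rewrite ?repr_frac // /rcomp divfK.
Qed.

End Relation.

(** Substituting y recovers p from its value at z, which is therefore nonzero. Only z becomes
    injective here and nothing is assumed on the kernel of y, so two mutually inverse maps can be
    treated in turn without circularity. *)
Lemma eval_at_inj (I J : finType) (z : I -> ratfun k J) (y : J -> ratfun k I) :
  (forall i, subst_rel y (z i) (var k i)) -> forall p, p != 0 -> eval_at z p != 0.
Proof.
move=> yz p; apply: contraNneq => p0.
suff : subst_rel y (eval_at z p) (tofrac p).
  by rewrite p0 => /(extends_uniq (@tofrac_inj _) (extends0 _ _)) e0; apply/eqP/(@tofrac_inj I);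
    rewrite -e0 rmorph0.
rewrite {2}[p]mpoly.mpolyE rmorph_sum; apply: extends_sum => m _ /=.
rewrite -mpoly.mul_mpolyC rmorphM mpoly.mpolyXE_id rmorph_prod.
apply: extendsM; first exact: subst_const.
apply: extends_prod => i _; rewrite rmorphXn; apply: extendsX.
by have := yz (enum_val i); rewrite /var enum_valK.
Qed.

End Substitution.

(** The factors combine by (1 + x^-1) / (1 + x) = x^-1. In the unbalanced cases one factor is left
    over: 1 + x^-1 is the sum over a free inner vertex before the flip, and (1 + x)^-1 cancels the
    sum 1 + x over a free one after it. *)
Lemma hex_sum (K : fieldType) (x : K) HA HB p q : x != 0 -> 1 + x != 0 ->
  hex_spec HA HB p q ->
  \sum_(e : bool | HB e) x ^+ e * (1 + x^-1) ^+ p * (1 + x)^-1 ^+ q =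
  \sum_(e : bool | HA e) x^-1 ^+ e.
Proof.
move=> nx n1x.
have -> : 1 + x^-1 = (1 + x) / x by field.
have K0 m : ((1 + x) / x) ^+ m * (1 + x)^-1 ^+ m = x^-1 ^+ m.
  by rewrite -exprMn; congr (_ ^+ _); field; apply/andP.
case=> [h1 h2|eA eB h1 h2 -> h4|eB h1 h2 -> h4|eA h1 h2 -> h4].
- by rewrite !big_pred0.
- rewrite (big_pred1 eB) // (big_pred1 eA) // -h4 -mulrA K0 exprD mulrCA -exprMn.
  by rewrite divff // expr1n mulr1.
- rewrite (big_pred1 eB) // (eq_bigl xpredT) // big_bool /= expr1 expr0 h4.
  rewrite exprSr mulrA -mulrA [_ / x * _]mulrC mulrA -[_ * _ * _^-1 ^+ q]mulrA K0.
  by rewrite -exprMn divff // expr1n mul1r mulrDl divff // mul1r.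
- rewrite [RHS](big_pred1 eA) // (eq_bigl xpredT) // big_bool /= expr1 expr0 h4.
  rewrite -!mulrDl exprS [_^-1 * _]mulrC mulrA -[_ * _ * _ ^+ p]mulrA K0.
  by rewrite mulrAC [x + 1]addrC divff // mul1r.
Qed.

(** * Mutations and the potential *)

Section Mutations.
Variables (n : nat) (K : fieldType).
Implicit Types (v w : vertex n) (P : {set tile n}) (a : 'I_n.-1) (D E : {set vertex n}).
Implicit Types (X Y : vertex n -> K).

Lemma prod_at (A : K) D w :
  \prod_(v in D) (if v == w then A else 1) = A ^+ (w \in D).
Proof.
have [wD|wD] := boolP (w \in D).
  rewrite (bigD1 w) //= eqxx big1 ?mulr1 // => v /andP[_ /negPf->] //.
by rewrite big1 // => v vD; case: eqVneq => // e; rewrite -e vD in wD.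
Qed.

Lemma sum_add v (R : {set {set vertex n}}) (F : {set vertex n} -> K) :
  \sum_(E in R) F E =
  \sum_(D : {set vertex n} | v \notin D) \sum_(e : bool | add e v D \in R) F (add e v D).
Proof.
rewrite (partition_big (fun E => E :\ v) (fun D => v \notin D)) /=; last first.
  by move=> E _; rewrite !inE eqxx.
apply: eq_bigr => D nD.
rewrite (reindex_onto (fun e => add e v D) (fun E => v \in E)) /=; last first.
  by move=> E /andP[_ /eqP <-]; rewrite -addD1.
apply: eq_bigl => e; rewrite in_add eqxx andbT (negPf nD) orbF eqxx andbT.
suff -> : add e v D :\ v == D by rewrite andbT.
apply/eqP/setP => w.
by rewrite in_setD1 in_add; case: eqVneq => [->|_]; rewrite ?(negPf nD) ?andbF.
Qed.

(** [mutation] for values X in an arbitrary field and on all vertices, so that mutations can be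
    iterated and substituted into. The last branch is meant for the new inner vertex. *)
Definition mutval P X (w v : vertex n) : K :=
  if v \in Vset P then X v * (1 + X w ^ (- sgz (exch P v w))) ^ (- exch P v w)
  else (X w)^-1.

Section Exchange.
Variables (P P' : {set tile n}) (w w' i1 i2 o1 o2 : vertex n).
Hypothesis C : exchange P P' w w' i1 i2 o1 o2.
Variable X : vertex n -> K.
Hypotheses (nX : forall v, X v != 0) (n1X : 1 + X w != 0).

Let x := X w.

Lemma oneDV_neq0 : 1 + x^-1 != 0.
Proof.
have -> : 1 + x^-1 = (1 + x) / x by field; exact: nX.
by rewrite mulf_neq0 ?invr_eq0 ?nX.
Qed.

(** For e = 0 the base is 1 + 1, which may be 0 in K, but it only occurs with exponent 0. *)
Lemma oneDX_neq0 (e : int) : 1 + x ^ (- sgz e) != 0 \/ e = 0.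
Proof.
case: sgzP => [->|_|_]; first by right.
  by left; rewrite exprN1 oneDV_neq0.
by left; rewrite opprK expr1z.
Qed.

Lemma mutval_neq0 v : mutval P X w v != 0.
Proof.
rewrite /mutval; case: ifP => _; last by rewrite invr_eq0 nX.
rewrite mulf_neq0 //; case: (oneDX_neq0 (exch P v w)) => [ne|->].
  exact: expfz_neq0.
by rewrite oppr0 expr0z oner_neq0.
Qed.

Lemma mutvalE v : v \in Vset P :\ w -> (mutval P X w v)^-1 =
  (X v)^-1 * ((if v == i1 then 1 + x^-1 else 1) * (if v == i2 then 1 + x^-1 else 1)) *
  ((if v == o1 then (1 + x)^-1 else 1) * (if v == o2 then (1 + x)^-1 else 1)).
Proof.
move=> vV; have := vV; rewrite in_setD1 => /andP[_ vP].
rewrite /mutval vP (ex_exch C vV) invfM invr_expz opprK -/x.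
have := ex_uniq C; rewrite /= !inE !negb_or => /and4P[/and3P[n1 n2 n3] /andP[n4 n5] n6 _].
have [e1|_] := eqVneq v i1.
  by rewrite e1 (negPf n1) (negPf n2) (negPf n3) /= subr0 !mulr1 exprN1 expr1z.
have [e1|_] := eqVneq v i2.
  by rewrite e1 (negPf n4) (negPf n5) /= subr0 !mulr1 mul1r exprN1 expr1z.
have [e1|_] := eqVneq v o1.
  by rewrite e1 (negPf n6) /= sub0r !mulr1 opprK expr1z exprN1.
by case: eqVneq => _ /=; rewrite ?sub0r ?subr0 ?mulr1 ?mul1r ?opprK ?expr1z ?exprN1 ?expr0z ?mulr1.
Qed.

(** Both sums are grouped by the trace D outside the inner vertices. For fixed D the mutation
    multiplies the monomial of D by one power of 1 + x^-1 and one of (1 + x)^-1, counting the arrows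
    that meet D, and [hex_sum] applies. *)
Lemma potential_mutation a :
  \sum_(E in regions P' a) \prod_(v in E) (mutval P X w v)^-1 =
  \sum_(E in regions P a) \prod_(v in E) (X v)^-1.
Proof.
rewrite (sum_add w') [RHS](sum_add w).
(* A trace that contains the inner vertex of the other tiling extends to no region. *)
rewrite (bigID (fun D : {set vertex n} => w \notin D)) /= [X in _ + X]big1 ?addr0; last first.
  move=> D /andP[_]; rewrite negbK => wD; rewrite big1 // => e /regionsP[/subsetP sub _ _].
  by have := sub w; rewrite in_add wD orbT (negPf (ex_kP' C)) => /(_ isT).
rewrite [RHS](bigID (fun D : {set vertex n} => w' \notin D)) /= [X in _ = _ + X]big1 ?addr0;
  last first.
  move=> D /andP[_]; rewrite negbK => wD; rewrite big1 // => e /regionsP[/subsetP sub _ _].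
  by have := sub w'; rewrite in_add wD orbT (negPf (ex_k'P C)) => /(_ isT).
rewrite (eq_bigl (fun D : {set vertex n} => (w \notin D) && (w' \notin D))); last by move=> D;
  rewrite andbC.
apply: eq_bigr => D /andP[nw nw'].
have prodw (F : vertex n -> K) v e : v \notin D ->
    \prod_(u in add e v D) F u = F v ^+ e * \prod_(u in D) F u.
  by move=> nv; case: e; rewrite /= ?mul1r // big_setU1.
have spec := ex_spec C a nw nw'.
have [/existsP[e0 he0]|none] := boolP [exists e, add e w' D \in regions P' a]; last first.
  have h2 e : add e w' D \in regions P' a = false.
    by apply/negP => h; move/negP: none; apply; apply/existsP; exists e.
  rewrite [LHS]big1; last by move=> e; rewrite h2.
  case: spec => [h1 _|eA eB _ h _ _|eB _ h _ _|eA h _ _ _].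
  - by rewrite [RHS]big1 // => e; rewrite h1.
  - by have := h eB; rewrite h2 eqxx.
  - by have := h eB; rewrite h2 eqxx.
  - by have := h true; rewrite h2.
have DV : D \subset Vset P :\ w.
  rewrite (ex_V C); apply/subsetP => v vD; case/regionsP: he0 => /subsetP/(_ v) + _ _.
  rewrite in_add vD orbT in_setD1 => /(_ isT) ->; rewrite andbT.
  by apply: contraNneq nw' => <-.
under eq_bigr => e _ do rewrite prodw //.
under [RHS]eq_bigr => e _ do rewrite prodw //.
rewrite -[RHS]mulr_suml -(hex_sum (nX w) n1X spec) mulr_suml; apply: eq_bigr => e _.
have -> : (mutval P X w w')^-1 = x by rewrite /mutval (negPf (ex_k'P C)) invrK.
rewrite (eq_bigr _ (fun v vD => mutvalE (subsetP DV v vD))) !big_split /= !prod_at.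
rewrite !exprD -/x.
move: (x ^+ e) (\prod_(i in D) (X i)^-1) ((1 + x^-1) ^+ (i1 \in D)) ((1 + x^-1) ^+ (i2 \in D))
  ((1 + x)^-1 ^+ (o1 \in D)) ((1 + x)^-1 ^+ (o2 \in D)).
by clear => *; ring.
Qed.

End Exchange.

Lemma mutval_inverse P P' (w w' i1 i2 o1 o2 : vertex n) X v :
  exchange P P' w w' i1 i2 o1 o2 -> (forall v, X v != 0) -> 1 + X w' != 0 ->
  v \in Vset P' -> mutval P (mutval P' X w') w v = X v.
Proof.
move=> C nX n1X vP'; rewrite {1}/mutval.
have ew : mutval P' X w' w = (X w')^-1 by rewrite /mutval (negPf (ex_kP' C)).
have [vP|vP] := boolP (v \in Vset P); last first.
  have -> : v = w'.
    apply/eqP/negPn/negP => ne; have : v \in Vset P' :\ w' by rewrite in_setD1 ne.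
    by rewrite -(ex_V C) in_setD1 (negPf vP) andbF.
  by rewrite ew invrK.
have vw : v != w by apply: contraTneq vP' => ->; exact: ex_kP' C.
have vD : v \in Vset P :\ w by rewrite in_setD1 vw.
have vD' : v \in Vset P' :\ w' by rewrite -(ex_V C).
have e : exch P v w = - exch P' v w' by rewrite (ex_exch C vD) (ex_exch' C vD') opprB.
rewrite ew /mutval vP' e sgzN !opprK exprz_inv.
case: (oneDX_neq0 nX n1X (exch P' v w')) => [ne|->]; last by rewrite oppr0 !expr0z !mulr1.
by rewrite -mulrA -expfzDr // addNr expr0z mulr1.
Qed.

End Mutations.

Section Potential.
Variables (n : nat) (k : fieldType).
Implicit Types (i j : word n) (v w : vertex n) (T : tile n) (P : {set tile n}).
Implicit Types (a : 'I_n.-1) (D E : {set vertex n}).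

Lemma var_neq0 (I : finType) (v : I) : var k v != 0.
Proof.
rewrite /var -[0](rmorph0 (@tofrac (mpoly.mpoly #|I| k))) tofrac_eq.
apply/eqP => /(congr1 (mpoly.mcoeff (mpoly.mnm1 (enum_rank v))))/eqP.
by rewrite mpoly.mcoeffX eqxx mpoly.mcoeff0 oner_eq0.
Qed.

Lemma var1_neq0 (I : finType) (v : I) : 1 + var k v != 0.
Proof.
rewrite /var -[1](rmorph1 (@tofrac (mpoly.mpoly #|I| k))) -rmorphD.
rewrite -[0](rmorph0 (@tofrac (mpoly.mpoly #|I| k))) tofrac_eq.
apply/eqP => /(congr1 (mpoly.mcoeff mpoly.mnm0))/eqP.
rewrite mpoly.mcoeffD mpoly.mcoeff1 eqxx mpoly.mcoeffX mpoly.mcoeff0.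
suff -> : mpoly.mnm1 (enum_rank v) == mpoly.mnm0 = false by rewrite addr0 oner_eq0.
apply/eqP => /(congr1 (fun m : mpoly.multinom _ => m (enum_rank v))).
by rewrite mpoly.mnm1E eqxx mpoly.mnm0E.
Qed.

Lemma xcoord_neq0 P v : xcoord k P v != 0.
Proof. by rewrite /xcoord; case: insubP => [u _ _|_]; [exact: var_neq0|exact: oner_neq0]. Qed.

Lemma xcoordE P (v : xvertex P) : xcoord k P (val v) = var k v.
Proof. by rewrite /xcoord valK. Qed.

Definition xmono P E : ratfun k (xvertex P) := \prod_(v in E) (xcoord k P v)^-1.

Definition potential P a : ratfun k (xvertex P) := \sum_(E in regions P a) xmono P E.

Lemma mutationE P P' (w w' i1 i2 o1 o2 : vertex n) (v : xvertex P') :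
  exchange P P' w w' i1 i2 o1 o2 -> mutation k P v = mutval P (xcoord k P) w (val v).
Proof.
move=> C; rewrite /mutation /mutval; case: pickP => [u nu|none].
  have -> : w = val u.
    apply/eqP/negPn/negP => ne; have : val u \in Vset P :\ w.
      by rewrite in_setD1 (valP u) eq_sym ne.
    by rewrite (ex_V C) in_setD1 (negPf nu) andbF.
  by rewrite xcoordE.
by have := none (exist _ w (ex_k C)); rewrite /= (ex_kP' C).
Qed.

Lemma xcoord1_neq0 P v : v \in Vset P -> 1 + xcoord k P v != 0.
Proof.
move=> vP; rewrite -[v]/(val (exist _ v vP : xvertex P)) xcoordE; exact: var1_neq0.
Qed.

Lemma extends_mutval (R : comNzRingType) (K L : fieldType) (io : {rmorphism R -> K})
    (ev : {rmorphism R -> L}) (P : {set tile n}) (w v : vertex n) X Y :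
  injective io -> (forall u, Y u != 0) -> 1 + Y w != 0 ->
  (forall u, u \in Vset P -> extends_to io ev (X u) (Y u)) -> w \in Vset P ->
  extends_to io ev (mutval P X w v) (mutval P Y w v).
Proof.
move=> inj nY n1Y XY wP; rewrite /mutval; case: ifP => vP; last first.
  by apply: (extendsV inj); [exact: nY|exact: XY].
apply: extendsM; first exact: XY.
case: (oneDX_neq0 nY n1Y (exch P v w)) => [ne|->]; last first.
  by rewrite !oppr0 !expr0z; apply: extends1.
apply: (extendsXz inj) ne _; apply: extendsD; first exact: extends1.
by apply: (extendsXz inj); [exact: nY|exact: XY].
Qed.

Lemma subst_mutation P P' (w w' i1 i2 o1 o2 : vertex n) v :
  exchange P P' w w' i1 i2 o1 o2 -> v \in Vset P' ->
  subst_rel (@mutation n k P P') (xcoord k P' v) (mutval P (xcoord k P) w v).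
Proof.
move=> C vP'; rewrite -[v]/(val (exist _ v vP' : xvertex P')) -(mutationE _ C) xcoordE.
exact: subst_var.
Qed.

(** Mutating back undoes the mutation by [mutval_inverse], as the signs of the exchange matrix and
    x_k are both inverted; this is the inverse substitution for [eval_at_inj]. *)
Lemma mutation_inj P P' (w w' i1 i2 o1 o2 : vertex n) :
  exchange P P' w w' i1 i2 o1 o2 ->
  forall p, p != 0 -> eval_at (@mutation n k P P') p != 0.
Proof.
move=> C; have C' := exchangeC C.
apply: (@eval_at_inj _ _ _ _ (@mutation n k P' P)) => v.
rewrite (mutationE _ C) -xcoordE.
have nX := xcoord_neq0 P'; have n1X := xcoord1_neq0 (ex_k' C).
have e := mutval_inverse C nX n1X (valP v).
rewrite -e.
apply: (@extends_mutval _ _ _ _ _ P w (val v) (xcoord k P) (mutval P' (xcoord k P') w')).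
- exact: tofrac_inj.
- exact: (@mutval_neq0 _ _ P' w' _ nX n1X).
- rewrite /mutval (negPf (ex_kP' C)); exact: (@oneDV_neq0 _ _ w' _ nX n1X).
- by move=> u uP; apply: (subst_mutation C' uP).
- exact: ex_k C.
Qed.

Lemma region_sub P a E v : E \in regions P a -> v \in E -> v \in Vset P.
Proof. by case/regionsP => /subsetP sub _ _; apply: sub. Qed.

Lemma subst_potential P (J : finType) (z : xvertex P -> ratfun k J) (Z : vertex n -> ratfun k J) a :
  (forall v, Z v != 0) ->
  (forall v, v \in Vset P -> subst_rel z (xcoord k P v) (Z v)) ->
  subst_rel z (potential P a) (\sum_(E in regions P a) \prod_(v in E) (Z v)^-1).
Proof.
move=> nZ sZ; apply: extends_sum => E rE; apply: extends_prod => v vE.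
by apply: (extendsV (@tofrac_inj _ _)); [exact: nZ|apply: sZ; apply: region_sub rE vE].
Qed.

Lemma rcomp_potential P P' (w w' i1 i2 o1 o2 : vertex n) a :
  exchange P P' w w' i1 i2 o1 o2 ->
  rcomp (potential P' a) (@mutation n k P P') = potential P a.
Proof.
move=> C; apply: rcomp_subst; first exact: mutation_inj C.
rewrite /potential /xmono -(potential_mutation C (xcoord_neq0 P) (xcoord1_neq0 (ex_k C))).
apply: (@subst_potential P' _ (@mutation n k P P') (mutval P (xcoord k P) w) a) => [|v vP].
  exact: (@mutval_neq0 _ _ P w _ (xcoord_neq0 P) (xcoord1_neq0 (ex_k C))).
exact: subst_mutation C vP.
Qed.

Lemma rcomp_potential_id P a : rcomp (potential P a) (@mutation n k P P) = potential P a.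
Proof.
have mE (v : xvertex P) : mutation k P v = var k v.
  rewrite /mutation; case: pickP => [u|_]; last exact: xcoordE.
  by rewrite (valP u).
have sub v : v \in Vset P -> subst_rel (@mutation n k P P) (xcoord k P v) (xcoord k P v).
  move=> vP; rewrite -[v]/(val (exist _ v vP : xvertex P)) xcoordE -{2}mE.
  exact: subst_var.
apply: rcomp_subst.
  apply: (@eval_at_inj _ _ _ _ (@mutation n k P P)) => v.
  by rewrite mE -{2}(mE v); apply: subst_var.
exact: (@subst_potential P _ _ (xcoord k P) a (xcoord_neq0 P) sub).
Qed.

Lemma potential_ends_dual P a : regions P a = [set [set fundamental a]] ->
  potential P a = (xcoord k P (fundamental a))^-1.
Proof. by move=> e; rewrite /potential e big_set1 /xmono big_set1. Qed.

(** The two conditions determine W: moves lead from i to a word ending in n - a, where the value is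
    prescribed, and the sum over regions is transported by the same mutations. *)
Lemma GHKK_potentialE (F : word n -> {set tile n}) W :
  (forall i, reduced i -> F i = tiles i) -> is_GHKK_potential W ->
  forall i a, reduced i -> W i a = potential (F i) a.
Proof.
move=> FE [Wmove Wbase] i a ri; have [j mij ed] := reduced_ends_dual a ri.
elim: mij ed ri => [{i j}i ed ri|i1 i2 i3 mv mvs IH ed ri].
  rewrite Wbase // potential_ends_dual // FE //; exact: regions_ends_dual.
have r2 := move_reduced mv ri; rewrite (Wmove _ _ _ ri r2 mv) IH //.
case: (move_exchange mv ri) => [e| [w [w' [x1 [x2 [y1 [y2 C]]]]]]].
  have -> : F i2 = F i1 by rewrite !FE.
  exact: rcomp_potential_id.
by apply: (@rcomp_potential _ _ w w' x1 x2 y1 y2); rewrite !FE.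
Qed.

End Potential.

(** * The chamber ansatz *)

Section ChamberAnsatz.
Variables (n : nat) (i : word n) (P : {set tile n}).
Hypotheses (ri : reduced i) (PE : P = tiles i).
Implicit Types (v w : vertex n) (T : tile n) (r : proot n) (a : 'I_n.-1) (E : {set vertex n}).

Lemma corner_signE v T : T \in P -> corner_sign v T =
  (v == Defs.top T)%:Z + (v == low T)%:Z - (v == left T)%:Z - (v == right T)%:Z.
Proof.
rewrite PE => /tiles_notin[ns nt]; have lt := valP T.1.
have nst : (val T.1).1 == (val T.1).2 = false by apply/negbTE; rewrite -val_eqE neq_ltn lt.
have nts : (val T.1).2 == (val T.1).1 = false by rewrite eq_sym.
have dist (A B : vertex n) x : (x \in A) != (x \in B) -> A == B = false.
  by move=> ne; apply/eqP => e; rewrite e eqxx in ne.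
rewrite /corner_sign !inE.
have [->|n1] := eqVneq v (left T).
  have -> : left T == right T = false.
    by apply: (dist _ _ (val T.1).1); rewrite !inE eqxx nst (negPf ns).
  have -> : left T == Defs.top T = false.
    by apply: (dist _ _ (val T.1).2); rewrite !inE eqxx nts (negPf nt) ?orbT.
  have -> // : left T == low T = false.
    by apply: (dist _ _ (val T.1).1); rewrite !inE eqxx (negPf ns).
have [->|n2] := eqVneq v (right T).
  have -> : right T == Defs.top T = false.
    by apply: (dist _ _ (val T.1).1); rewrite !inE eqxx nst (negPf ns).
  have -> // : right T == low T = false.
    by apply: (dist _ _ (val T.1).2); rewrite !inE eqxx (negPf nt).
have [->|n3] := eqVneq v (Defs.top T).
  have -> // : Defs.top T == low T = false.
    by apply: (dist _ _ (val T.1).1); rewrite !inE eqxx (negPf ns).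
by case: eqVneq.
Qed.

Lemma sum_corner_sign E T : T \in P -> \sum_(v in E) corner_sign v T = - corner_sum E T.
Proof.
have sumd w : \sum_(v in E) (v == w)%:Z = (w \in E)%:Z.
  have [wE|wE] := boolP (w \in E).
    by rewrite (bigD1 w) //= eqxx big1 ?addr0 // => v /andP[_ /negPf->].
  by rewrite big1 // => v vE; case: eqVneq => // e; rewrite -e vE in wE.
move=> TP; under eq_bigr => v _ do rewrite corner_signE //.
by rewrite !sumrB !big_split /= !sumd /corner_sum; ring.
Qed.

(* v is inverted by (s, t) if it separates t from s; these vertices give the
   exponents of the inverse of the matrix of CA. *)
Definition inverted r : {set vertex n} :=
  [set v in Vset P | ((val r).1 \notin v) && ((val r).2 \in v)].

(** For r = (p, q) the indicator is the product of a function of the membership of p and one of q.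
    Its mixed difference over a tile [s,t] vanishes unless s, t are p, q, and since s < t and p < q
    this means s = p and t = q. *)
Lemma corner_inverted r T : T \in P -> corner_sum (inverted r) T = (T.1 == r)%:Z.
Proof.
case: T => -[[s t] /= lt1] S; case: r => -[p q] /= lt2.
set T : tile n := (exist _ (s, t) lt1, S); set r : proot n := exist _ (p, q) lt2.
move=> TP; have := TP; rewrite PE => /tiles_notin[ns nt].
have inv c : c \in vertices T -> (c \in inverted r) = ((val r).1 \notin c) && ((val r).2 \in c).
  move=> cT; rewrite !inE; case: (boolP (c \in left_boundary n)) => [|_] /=.
    (* [inverted] excludes the left boundary, but nothing is lost: an initial segment containing the
       larger label contains the smaller one. *)
    case/imsetP => m _ ->; rewrite !inE; apply/esym/negP => /andP[/negP + lt]; apply.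
    exact: ltn_trans (valP r) lt.
  by rewrite (_ : c \in _) //; apply/bigcupP; exists T.
rewrite /corner_sum !inv /vertices ?inE ?eqxx ?orbT //.
rewrite /left /right /Defs.top /low in ns nt *.
have -> : (T.1 == r) = (s == p) && (t == q) by rewrite -(inj_eq val_inj) /= xpair_eqE.
rewrite /T /r /= in ns nt *; clear -lt1 lt2 ns nt.
have nst : s == t = false by rewrite -val_eqE /=; lia.
have npq : p == q = false by rewrite -val_eqE /=; lia.
have [e1|n1] := eqVneq s p.
  rewrite -e1 in npq *; rewrite (negPf ns) nst /=.
  have [e2|n2] := eqVneq t q; first by rewrite -e2 (negPf nt) ?[t == s]eq_sym ?nst ?eqxx.
  by rewrite ?[q == s]eq_sym ?npq; case: (q \in S).
have [e1|n2] := eqVneq p t.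
  have ltq : (t < q)%N by rewrite -e1.
  rewrite e1 (negPf nt) /=.
  have -> : q == s = false by rewrite -val_eqE /=; lia.
  by case: (q \in S).
have [e2|n3] := eqVneq q s.
  by rewrite e2 ?[t == s]eq_sym ?nst (negPf ns); case: (p \in S).
have [e2|n4] := eqVneq q t; first by rewrite e2 (negPf nt); case: (p \in S).
by case: (p \in S); case: (q \in S).
Qed.

(** The other one-sided inverse. As a function of v, the difference of the two sides vanishes on the
    left boundary and satisfies every tile relation by [corner_inverted], so that [corner_zero]
    applies. *)
Lemma inverted_corner v w : v \in Vset P -> w \in Vset P ->
  \sum_(T in P) (v \in inverted T.1)%:Z * corner_sign w T = - (v == w)%:Z.
Proof.
move=> vV wV; have ai := reduced_asc ri.
pose e u : int := \sum_(T in P) (u \in inverted T.1)%:Z * corner_sign w T + (u == w)%:Z.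
suff e0 : e v = 0 by apply/eqP; rewrite -addr_eq0 -/(e v) e0.
rewrite PE in vV; move: v vV; apply: (@corner_zero _ i e ri).
  move=> u ul; rewrite /e big1 ?add0r; last first.
    by move=> T TP; rewrite !inE ul mul0r.
  by case: eqVneq => // eu; move: wV; rewrite !inE -eu ul.
move=> T; rewrite -PE => TP; rewrite /e.
have -> : forall A B C D a b c d : int,
    (A + a) + (B + b) - (C + c) - (D + d) = (A + B - C - D) + (a + b - c - d) by move=> *; ring.
rewrite -big_split -!sumrB /=.
have -> : \sum_(T' in P) ((left T \in inverted T'.1)%:Z * corner_sign w T' +
     (right T \in inverted T'.1)%:Z * corner_sign w T' -
     (Defs.top T \in inverted T'.1)%:Z * corner_sign w T' -
     (low T \in inverted T'.1)%:Z * corner_sign w T') = corner_sign w T.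
  transitivity (\sum_(T' in P) (T.1 == T'.1)%:Z * corner_sign w T').
    by apply: eq_bigr => T' T'P; rewrite -corner_inverted // /corner_sum; ring.
  rewrite (bigD1 T) //= eqxx mul1r big1 ?addr0 // => T' /andP[T'P ne].
  case: eqVneq => [eT|_]; last by rewrite mul0r.
  by move: T'P TP ne; rewrite PE => T'P TP; rewrite (tiles_root_inj ai T'P TP) ?eqxx.
by rewrite corner_signE // ![_ == w]eq_sym; ring.
Qed.

Section Field.
Variable K : fieldType.

Lemma expfz_sum (x : K) (A : finType) (Q : pred A) (f : A -> int) : x != 0 ->
  \prod_(b | Q b) x ^ f b = x ^ (\sum_(b | Q b) f b).
Proof.
move=> nx; apply: (big_ind2 (fun y m => y = x ^ m)) => // y1 m1 y2 m2 -> ->.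
by rewrite expfzDr.
Qed.

Definition CAv (z : proot n -> K) v : K := \prod_(T in P) z T.1 ^ corner_sign v T.

Lemma CAv_neq0 (z : proot n -> K) v : (forall r, z r != 0) -> CAv z v != 0.
Proof. by move=> nz; apply/prodf_neq0 => T _; apply: expfz_neq0. Qed.

Lemma prod_roots (F : proot n -> K) : \prod_r F r = \prod_(T in P) F T.1.
Proof.
rewrite PE; transitivity (\prod_(r in [set T.1 | T in tiles i]) F r).
  apply: eq_bigl => r; apply/esym/imsetP.
  by have [T Ti <-] := tiles_root r ri; exists T.
rewrite big_imset //= => T T' Ti T'i; exact: tiles_root_inj (reduced_asc ri) Ti T'i.
Qed.

Lemma prod_rvec (z : proot n -> K) E : (forall r, z r != 0) ->
  \prod_r z r ^ rvec P E r = \prod_(v in E) (CAv z v)^-1.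
Proof.
move=> nz; rewrite prod_roots /CAv.
under [RHS]eq_bigr => v _ do rewrite -prodfV.
rewrite exchange_big /=; apply: eq_bigr => T TP.
under eq_bigr => v _ do rewrite invr_expz.
rewrite expfz_sum // sumrN sum_corner_sign // opprK; congr (_ ^ _).
by rewrite PE rvecE ?(reduced_asc ri) // -PE.
Qed.

Definition CAinv (y : vertex n -> K) r : K := \prod_(v in inverted r) (y v)^-1.

Lemma CAinv_neq0 (y : vertex n -> K) r : (forall v, y v != 0) -> CAinv y r != 0.
Proof. by move=> ny; apply/prodf_neq0 => v _; rewrite invr_eq0. Qed.

Lemma CAvK (z : proot n -> K) r : (forall r, z r != 0) -> CAinv (CAv z) r = z r.
Proof.
move=> nz; rewrite /CAinv -prod_rvec // (bigD1 r) //= big1 ?mulr1.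
  have [T Ti <-] := tiles_root r ri.
  by rewrite PE rvecE ?(reduced_asc ri) // corner_inverted ?PE // eqxx expr1z.
move=> r' /negPf ne; have [T Ti e] := tiles_root r' ri; rewrite -e.
by rewrite PE rvecE ?(reduced_asc ri) // corner_inverted ?PE // e ne expr0z.
Qed.

Lemma CAinvK (y : vertex n -> K) v : (forall v, y v != 0) -> v \in Vset P ->
  CAv (CAinv y) v = y v.
Proof.
move=> ny vV; rewrite /CAv.
transitivity (\prod_(T in P) \prod_(w in Vset P) y w ^ (- ((w \in inverted T.1)%:Z * corner_sign v
  T))).
  apply: eq_bigr => T TP; rewrite /CAinv.
  rewrite (big_morph (fun x => x ^ corner_sign v T) (fun x y => expfzMl x y _) (exp1rz _ _)).
  rewrite [RHS](bigID (fun w => w \in inverted T.1)) /= [X in _ * X]big1 ?mulr1; last first.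
    by move=> w /andP[_ /negPf ->]; rewrite mul0r oppr0 expr0z.
  rewrite [LHS](eq_bigl (fun w => (w \in Vset P) && (w \in inverted T.1))); last first.
    by move=> w; rewrite /inverted in_set; case: (w \in Vset P).
  by apply: eq_bigr => w /andP[_ ->]; rewrite mul1r exprz_inv.
rewrite exchange_big /= (bigD1 v) //= [A in _ * A]big1 ?mulr1.
  by rewrite expfz_sum // sumrN inverted_corner // eqxx opprK expr1z.
move=> w; case/andP=> wV /negPf ne.
by rewrite expfz_sum // sumrN inverted_corner // ne oppr0 expr0z.
Qed.

End Field.
End ChamberAnsatz.

(** * Comparison of the two sums and the Laurent expansion *)

Section Assembly.
Variables (n : nat) (k : fieldType) (i : word n) (P : {set tile n}).
Hypotheses (ri : reduced i) (PE : P = tiles i).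
Implicit Types (v w : vertex n) (r : proot n) (a : 'I_n.-1) (E : {set vertex n}).

Local Notation z := (@var k (proot n)).
Local Notation X := (xcoord k P).
Local Notation dual := (CAinv P X).

Let nz r : z r != 0. Proof. exact: var_neq0. Qed.
Let nX v : X v != 0. Proof. exact: xcoord_neq0. Qed.

Lemma subst_CA v : v \in Vset P -> subst_rel (@CA n P _ z) (X v) (CAv P z v).
Proof.
move=> vP; rewrite -[v]/(val (exist _ v vP : xvertex P)) xcoordE; exact: subst_var.
Qed.

Lemma subst_CA_dual r : subst_rel (@CA n P _ z) (dual r) (z r).
Proof.
rewrite -[z r](CAvK ri PE) //; apply: extends_prod => v; rewrite inE => /andP[vV _].
by apply: (extendsV (@tofrac_inj _ _)); [apply: CAv_neq0|apply: subst_CA].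
Qed.

Lemma CA_dual (v : xvertex P) : CA dual v = var k v.
Proof. by rewrite -xcoordE -(CAinvK ri PE nX (valP v)). Qed.

Lemma subst_dual r : subst_rel dual (z r) (dual r).
Proof. exact: subst_var. Qed.

Lemma dual_inj p : p != 0 -> eval_at dual p != 0.
Proof. by move: p; apply: (@eval_at_inj _ _ _ _ (@CA n P _ z)) => r; apply: subst_CA_dual. Qed.

Lemma CA_inj p : p != 0 -> eval_at (@CA n P _ z) p != 0.
Proof.
move: p; apply: (@eval_at_inj _ _ _ _ dual) => v; rewrite -CA_dual.
apply: extends_prod => T _; apply: (extendsXz (@tofrac_inj _ _)).
  by apply: CAinv_neq0.
exact: subst_var.
Qed.

(** [rho] sums over a set of vectors; by [rvec_inj] distinct regions give distinct ones, so no
    multiplicity is lost. *)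
Lemma rhoE a : rho k a i = \sum_(E in regions P a) mono k (rvec P E).
Proof.
rewrite /rho -big_enum /=.
have -> : Rstar a i = [set` [seq rvec P E | E <- enum (regions P a)]]%classic.
  apply/seteqP; split=> d; rewrite /= RstarE // PE.
    by move=> [E rE ->]; apply/mapP; exists E; rewrite ?mem_enum.
  by move=> /mapP[E]; rewrite mem_enum => rE ->; exists E.
rewrite -fsbig_seq ?big_map //.
rewrite map_inj_in_uniq ?enum_uniq // => E E'; rewrite !mem_enum PE.
exact: rvec_inj.
Qed.

Lemma monoE E : mono k (rvec P E) = \prod_(v in E) (CAv P z v)^-1.
Proof. exact: (prod_rvec ri PE). Qed.

Lemma rho_potential a : rho k a i = rcomp (potential k P a) (@CA n P _ z).
Proof.
apply/esym/rcomp_subst; first exact: CA_inj.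
rewrite rhoE (eq_bigr _ (fun E _ => monoE E)).
apply: subst_potential; last exact: subst_CA.
by move=> v; apply: CAv_neq0.
Qed.

Lemma potential_rho a : rcomp (rho k a i) dual = potential k P a.
Proof.
apply: rcomp_subst; first exact: dual_inj.
rewrite rhoE; apply: extends_sum => E rE.
have -> : xmono k P E = \prod_r dual r ^ rvec P E r.
  rewrite (prod_rvec ri PE) => [|r]; last exact: CAinv_neq0.
  apply: eq_bigr => v vE; rewrite (CAinvK ri PE nX) //; exact: region_sub rE vE.
apply: extends_prod => r _; apply: (extendsXz (@tofrac_inj _ _)).
  exact: CAinv_neq0.
exact: subst_dual.
Qed.

Definition expo E : {ffun xvertex P -> int} := [ffun v => - (val v \in E)%:Z].

Lemma xmono_expo E : E \subset Vset P -> xmono k P E = mono k (expo E).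
Proof.
move=> sub; rewrite /mono /xmono.
transitivity (\prod_(v in Vset P) (X v) ^ (- (v \in E)%:Z)).
  rewrite [RHS](bigID (fun v => v \in E)) /= [Y in _ = _ * Y]big1 ?mulr1; last first.
    by move=> v /andP[_ /negPf->]; rewrite oppr0 expr0z.
  apply: eq_big => [v|v vE]; last by rewrite vE exprN1.
  by case: (boolP (v \in E)) => [/(subsetP sub) ->|]; rewrite ?andbF.
rewrite big_sub /=; apply: eq_bigr => v _.
by rewrite ffunE xcoordE.
Qed.

Lemma potential_laurent :
  exists (s : seq {ffun xvertex P -> int}) (c : {ffun xvertex P -> int} -> k),
     laurent_expansion (\sum_a potential k P a) s c /\
     (forall e, e \in s ->
        [/\ e != [ffun=> 0], c e = 0 \/ c e = 1 &
            forall u, e u = 0 \/ e u = -1]).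
Proof.
pose A := (\bigcup_a regions P a).
have sub E : E \in A -> E \subset Vset P.
  by move=> /bigcupP[a _ /regionsP[]].
exists [seq expo E | E <- enum A], (fun=> 1); split; last first.
  move=> e /mapP[E]; rewrite mem_enum => EA ->; split; last 2 first.
  - by right.
  - by move=> v; rewrite ffunE; case: (_ \in _); [right|left].
  (* No region is empty: the coordinate of [fundamental a] has exponent -1, and the monomial is not
     constant. *)
  have /bigcupP[a _ rE] := EA; have fE := region_fundamental rE.
  have fV := subsetP (sub _ EA) _ fE.
  apply/eqP => /ffunP/(_ (exist _ (fundamental a) fV)).
  by rewrite !ffunE /= fE.
split.
  rewrite map_inj_in_uniq ?enum_uniq // => E E'; rewrite !mem_enum => EA E'A /ffunP e.
  apply/setP => v; have [vV|vV] := boolP (v \in Vset P).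
    have := e (exist _ v vV); rewrite !ffunE /=.
    by case: (v \in E); case: (v \in E').
  by apply/idP/idP => [/(subsetP (sub _ EA))|/(subsetP (sub _ E'A))]; rewrite (negPf vV).
rewrite big_map big_enum /=.
transitivity (\sum_(E in A) xmono k P E).
  (* The unique vertex of a region on the right boundary tells a, so different W_a have no monomial
     in common and all coefficients stay 1. *)
  apply/esym/partition_disjoint_bigcup => a b ne.
  apply/pred0P => E /=; apply/negP => /andP[ra rb].
  have := region_right ra (region_fundamental rb) (fundamental_right b).
  move=> /setP e; case/eqP: ne; apply/val_inj => /=.
  have := e (hi a); have := e (hi b); rewrite !inE /= !ltnS !leqnn.
  by move=> /esym le1 le2; apply/eqP; rewrite eqn_leq le1 le2.
apply: eq_bigr => E /sub EV; rewrite xmono_expo //.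
by rewrite /const mpoly.mpolyC1 rmorph1 mul1r.
Qed.

End Assembly.

(** * Geometry of tilings *)

Lemma angle_diff (F : realFieldType) (z x y m : F) : m != 0 ->
  z - (x * 2 + 1) * z / (m * 2) - (z - (y * 2 + 1) * z / (m * 2)) = (y - x) * z / m.
Proof. by move=> m0; field. Qed.

Lemma angleE (F : realFieldType) (z x m : F) : m != 0 ->
  z - (x * 2 + 1) * z / (m * 2) = z * ((m - x - 2^-1) / m).
Proof. by move=> m0; field. Qed.

Lemma natr_double (F : realFieldType) m : (m.*2)%:R = m%:R * 2 :> F.
Proof. by rewrite -muln2 natrM. Qed.

Section Plane.
Variables (n : nat) (R : realType).
Implicit Types (s t x : 'I_n) (S v : vertex n) (T : tile n) (P : {set tile n}).
Implicit Types (p q : 'rV[R]_2).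

Definition px p : R := p ord0 ord0.
Definition py p : R := p ord0 ord_max.

Lemma rV2P p q : px p = px q -> py p = py q -> p = q.
Proof.
move=> eX eY; apply/rowP => i; have [->|->] : i = ord0 \/ i = ord_max by
  case: i => -[|[|//]] lt; [left|right]; apply/val_inj.
- exact: eX.
- exact: eY.
Qed.

Lemma pxD p q : px (p + q) = px p + px q. Proof. exact: mxE. Qed.
Lemma pyD p q : py (p + q) = py p + py q. Proof. exact: mxE. Qed.
Lemma pxZ a p : px (a *: p) = a * px p. Proof. exact: mxE. Qed.
Lemma pyZ a p : py (a *: p) = a * py p. Proof. exact: mxE. Qed.

(** Minus the usual determinant: directions are numbered clockwise, so this is positive on the pair
    s < t. *)
Definition det2 p q : R := px q * py p - py q * px p.

Definition hvec : 'rV[R]_2 := \row_j (if j == 0 then 1 else 0).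

Lemma px_hvec : px hvec = 1. Proof. exact: mxE. Qed.
Lemma py_hvec : py hvec = 0. Proof. exact: mxE. Qed.

Definition theta s : R := pi - (s.*2.+1)%:R * pi / (n.*2)%:R.

Lemma px_dir s : px (dir R s) = cos (theta s). Proof. exact: mxE. Qed.
Lemma py_dir s : py (dir R s) = sin (theta s). Proof. exact: mxE. Qed.

Lemma theta_lt s t : (s < t)%N -> 0 < theta s - theta t < pi.
Proof.
move=> lt; have n0 : 0 < n%:R :> R by rewrite ltr0n; have := ltn_ord s; lia.
have pi0 := pi_gt0 R.
have -> : theta s - theta t = (t%:R - s%:R) * pi / n%:R.
  rewrite /theta; have nz := lt0r_neq0 n0; generalize (pi : R) => z.
  by rewrite -!natr1 !natr_double angle_diff.
have lt' : s%:R < t%:R :> R by rewrite ltr_nat.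
have tn : t%:R < n%:R :> R by rewrite ltr_nat.
have s0 : 0 <= s%:R :> R by rewrite ler0n.
apply/andP; split; first by rewrite divr_gt0 // mulr_gt0 // subr_gt0.
by rewrite ltr_pdivrMr // mulrC ltr_pM2l //; lra.
Qed.

Lemma theta_pos s : 0 < theta s < pi.
Proof.
have n0 : 0 < n%:R :> R by rewrite ltr0n; have := ltn_ord s; lia.
have pi0 := pi_gt0 R.
have -> : theta s = pi * ((n%:R - s%:R - 2^-1) / n%:R).
  rewrite /theta; have nz := lt0r_neq0 n0; generalize (pi : R) => z.
  by rewrite -[_.*2.+1%:R]natr1 !natr_double angleE.
have sn : s%:R + 1 <= n%:R :> R by rewrite natr1 ler_nat ltn_ord.
have s0 : 0 <= s%:R :> R by rewrite ler0n.
apply/andP; split; first by rewrite mulr_gt0 // divr_gt0 //; lra.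
by rewrite gtr_pMr // ltr_pdivrMr //; lra.
Qed.

Lemma py_dir_gt0 s : 0 < py (dir R s).
Proof. by rewrite py_dir sin_gt0_pi // theta_pos. Qed.

Lemma det2_gt0 s t : (s < t)%N -> 0 < det2 (dir R s) (dir R t).
Proof.
move=> lt; rewrite /det2 !px_dir !py_dir.
have := sin_gt0_pi (theta_lt lt); rewrite sinB; lra.
Qed.

Lemma det2D p q r : det2 (p + q) r = det2 p r + det2 q r.
Proof. by rewrite /det2 pxD pyD; ring. Qed.
Lemma det2Dr p q r : det2 r (p + q) = det2 r p + det2 r q.
Proof. by rewrite /det2 pxD pyD; ring. Qed.
Lemma det2Z a p r : det2 (a *: p) r = a * det2 p r.
Proof. by rewrite /det2 pxZ pyZ; ring. Qed.
Lemma det2Zr a p r : det2 r (a *: p) = a * det2 r p.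
Proof. by rewrite /det2 pxZ pyZ; ring. Qed.
Lemma det2pp p : det2 p p = 0.
Proof. by rewrite /det2; ring. Qed.

Lemma det2_sum (A : finType) (Q : pred A) (F : A -> 'rV[R]_2) r :
  det2 (\sum_(b | Q b) F b) r = \sum_(b | Q b) det2 (F b) r.
Proof.
apply: (big_morph (fun p => det2 p r)) => [p q|]; first exact: det2D.
by rewrite -[0](scale0r 0) det2Z mul0r.
Qed.

Definition co1 s t p := det2 p (dir R t) / det2 (dir R s) (dir R t).
Definition co2 s t p := det2 (dir R s) p / det2 (dir R s) (dir R t).

Lemma co_basis s t p : (s < t)%N ->
  p = co1 s t p *: dir R s + co2 s t p *: dir R t.
Proof.
move=> /det2_gt0 /lt0r_neq0; rewrite /co1 /co2 /det2 => nd.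
by apply: rV2P; rewrite ?pxD ?pyD ?pxZ ?pyZ; field.
Qed.

Lemma co1_basis s t a b : (s < t)%N -> co1 s t (a *: dir R s + b *: dir R t) = a.
Proof.
by move=> /det2_gt0 /lt0r_neq0 nd; rewrite /co1 det2D !det2Z det2pp mulr0 addr0 mulfK.
Qed.

Lemma co2_basis s t a b : (s < t)%N -> co2 s t (a *: dir R s + b *: dir R t) = b.
Proof.
by move=> /det2_gt0 /lt0r_neq0 nd; rewrite /co2 det2Dr !det2Zr det2pp mulr0 add0r mulfK.
Qed.

(** All directions point strictly upwards, so the horizontal vector lies clockwise of both. Moving
    east decreases the first tile coordinate and increases the second, that is, it enters a tile
    through left edges and leaves it through right ones. *)
Lemma co1_hvec s t : (s < t)%N -> co1 s t hvec < 0.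
Proof.
move=> lt; rewrite /co1 pmulr_llt0 ?invr_gt0 ?det2_gt0 // /det2 px_hvec py_hvec.
by have := py_dir_gt0 t; lra.
Qed.

Lemma co2_hvec s t : (s < t)%N -> 0 < co2 s t hvec.
Proof.
move=> lt; rewrite /co2 divr_gt0 ?det2_gt0 // /det2 px_hvec py_hvec.
by have := py_dir_gt0 s; lra.
Qed.

Lemma co1D s t p q : co1 s t (p + q) = co1 s t p + co1 s t q.
Proof. by rewrite /co1 det2D mulrDl. Qed.
Lemma co2D s t p q : co2 s t (p + q) = co2 s t p + co2 s t q.
Proof. by rewrite /co2 det2Dr mulrDl. Qed.
Lemma co1Z s t a p : co1 s t (a *: p) = a * co1 s t p.
Proof. by rewrite /co1 det2Z mulrA. Qed.
Lemma co2Z s t a p : co2 s t (a *: p) = a * co2 s t p.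
Proof. by rewrite /co2 det2Zr mulrA. Qed.

Definition tx T p := co1 (val T.1).1 (val T.1).2 (p - pos R (low T)).
Definition ty T p := co2 (val T.1).1 (val T.1).2 (p - pos R (low T)).

Lemma tile_coords T p : p = pos R (low T) + tx T p *: dir R (val T.1).1 + ty T p *: dir R (val
  T.1).2.
Proof. by rewrite -addrA -(co_basis _ (valP T.1)) addrC subrK. Qed.

Lemma txE T a b : tx T (pos R (low T) + a *: dir R (val T.1).1 + b *: dir R (val T.1).2) = a.
Proof. by rewrite -[X in tx T X]addrA /tx [pos _ _ + _]addrC addrK co1_basis // (valP T.1). Qed.

Lemma tyE T a b : ty T (pos R (low T) + a *: dir R (val T.1).1 + b *: dir R (val T.1).2) = b.
Proof. by rewrite -[X in ty T X]addrA /ty [pos _ _ + _]addrC addrK co2_basis // (valP T.1). Qed.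

Lemma txh T p e : tx T (p + e *: hvec) = tx T p + e * co1 (val T.1).1 (val T.1).2 hvec.
Proof. by rewrite /tx [p + _ - _]addrAC [LHS]co1D co1Z. Qed.

Lemma tyh T p e : ty T (p + e *: hvec) = ty T p + e * co2 (val T.1).1 (val T.1).2 hvec.
Proof. by rewrite /ty [p + _ - _]addrAC [LHS]co2D co2Z. Qed.

Lemma in_tileE T p : in_tile T p <-> (0 <= tx T p <= 1) && (0 <= ty T p <= 1).
Proof.
split=> [[a [b [[a0 a1] [b0 b1] ->]]]|/andP[/andP[a0 a1] /andP[b0 b1]]].
  by rewrite txE tyE a0 a1 b0 b1.
by exists (tx T p), (ty T p); split=> //; exact: tile_coords.
Qed.

Lemma posU s S : s \notin S -> pos R (s |: S) = pos R S + dir R s.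
Proof. by move=> sS; rewrite /pos big_setU1 //= addrC. Qed.

Definition ok_tile T := (val T.1).1 \notin low T /\ (val T.1).2 \notin low T.

Lemma pos_vertices T : ok_tile T -> let F a b := pos R (low T) + a *: dir R (val T.1).1 + b *: dir
  R (val T.1).2 in
  [/\ pos R (low T) = F 0 0, pos R (left T) = F 1 0, pos R (right T) = F 0 1 & pos R (Defs.top T) =
    F 1 1].
Proof.
move=> [s1 s2] F; have lt : (val T.1).1 != (val T.1).2 by rewrite neq_ltn (valP T.1).
rewrite /F /left /right /Defs.top !scale1r !scale0r !addr0 !posU //.
  by split=> //; rewrite addrAC.
by rewrite !inE negb_or lt.
Qed.

Definition ledges T : {set edge n} := [set (low T, left T); (left T, Defs.top T)].
Definition redges T : {set edge n} := [set (low T, right T); (right T, Defs.top T)].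

Lemma edgesE T : edges T = ledges T :|: redges T.
Proof. by apply/setP => e; rewrite !inE -!orbA. Qed.

Lemma in_edge_coords T e p : ok_tile T -> e \in edges T -> in_edge e p -> exists c : R,
  [\/ [/\ e = (low T, left T), tx T p = c & ty T p = 0],
      [/\ e = (left T, Defs.top T), tx T p = 1 & ty T p = c],
      [/\ e = (low T, right T), tx T p = 0 & ty T p = c] |
      [/\ e = (right T, Defs.top T), tx T p = c & ty T p = 1]].
Proof.
move=> /pos_vertices[e0 e1 e2 e3] + + ; pose F a b := pos R (low T) + a *: dir R (val T.1).1 +
  b *: dir R (val T.1).2.
have H c a b a' b' : (1 - c) *: F a b + c *: F a' b' =
    F ((1 - c) * a + c * a') ((1 - c) * b + c * b').
  by apply: rV2P; rewrite !(pxD, pyD, pxZ, pyZ); ring.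
rewrite -!/(F _ _) in e0 e1 e2 e3.
rewrite !inE -!orbA => /or4P[] /eqP -> [c [_ ->]]; exists c;
  rewrite /= ?e1 ?e2 ?e3 1?[pos R (low T)]e0 H txE tyE;
  [constructor 1|constructor 2|constructor 3|constructor 4]; by split=> //; ring.
Qed.

Lemma vertices_coords T v : ok_tile T -> v \in vertices T ->
  (tx T (pos R v) = 0 \/ tx T (pos R v) = 1) /\ (ty T (pos R v) = 0 \/ ty T (pos R v) = 1).
Proof.
move=> /pos_vertices[e0 e1 e2 e3]; rewrite !inE -!orbA => /or4P[] /eqP ->.
- by rewrite e0 txE tyE; split; left.
- by rewrite e1 txE tyE; split; [right|left].
- by rewrite e2 txE tyE; split; [left|right].
- by rewrite e3 txE tyE; split; right.
Qed.

Definition mid (e : edge n) : 'rV[R]_2 := 2^-1 *: (pos R e.1 + pos R e.2).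

Lemma mid_coords T : ok_tile T ->
  [/\ (tx T (mid (low T, left T)) = 2^-1 /\ ty T (mid (low T, left T)) = 0),
      (tx T (mid (left T, Defs.top T)) = 1 /\ ty T (mid (left T, Defs.top T)) = 2^-1),
      (tx T (mid (low T, right T)) = 0 /\ ty T (mid (low T, right T)) = 2^-1) &
      (tx T (mid (right T, Defs.top T)) = 2^-1 /\ ty T (mid (right T, Defs.top T)) = 1)].
Proof.
move=> /pos_vertices[e0 e1 e2 e3]; rewrite /mid /= e1 e2 e3.
have H a b c d : 2^-1 *: (pos R (low T) + a *: dir R (val T.1).1 + b *: dir R (val T.1).2 +
   (pos R (low T) + c *: dir R (val T.1).1 + d *: dir R (val T.1).2)) =
   pos R (low T) + ((a + c) / 2) *: dir R (val T.1).1 + ((b + d) / 2) *: dir R (val T.1).2.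
  by apply: rV2P; rewrite !(pxD, pyD, pxZ, pyZ); field.
have H0 c d : 2^-1 *: (pos R (low T) + (pos R (low T) + c *: dir R (val T.1).1 + d *: dir R (val
  T.1).2)) =
   pos R (low T) + (c / 2) *: dir R (val T.1).1 + (d / 2) *: dir R (val T.1).2.
  by apply: rV2P; rewrite !(pxD, pyD, pxZ, pyZ); field.
rewrite !H0 !H !txE !tyE; split; split; by field.
Qed.

Section Tiling.
Variable P : {set tile n}.
Hypothesis tP : is_tiling R P.

Lemma tiling_ok T : T \in P -> ok_tile T. Proof. by case: tP => + _ _ _; apply. Qed.

Lemma interior_inj T T' p : T \in P -> T' \in P ->
  0 < tx T p < 1 -> 0 < ty T p < 1 -> in_tile T' p -> T = T'.
Proof.
move=> TP T'P /andP[a0 a1] /andP[b0 b1] pT'; apply/eqP/negPn/negP => /eqP/eqP ne.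
have pT : in_tile T p by apply/in_tileE; rewrite !ltW.
case: tP => _ _ /(_ _ _ _ TP T'P ne pT pT') + _.
case=> [[v]|[e]]; rewrite inE => /andP[vT _].
  by move=> pv; have [+ _] := vertices_coords (tiling_ok TP) vT; rewrite -pv; case; lra.
move=> /(in_edge_coords (tiling_ok TP) vT)[c] [] [_]; lra.
Qed.


Lemma interior_east T p : 0 < tx T p <= 1 -> 0 <= ty T p < 1 ->
  exists2 d : R, 0 < d & forall e : R, 0 < e < d ->
   (0 < tx T (p + e *: hvec) < 1) /\ (0 < ty T (p + e *: hvec) < 1).
Proof.
move=> /andP[a0 a1] /andP[b0 b1].
have al := co1_hvec (valP T.1); have be := co2_hvec (valP T.1).
set x := co1 _ _ _ in al; set y := co2 _ _ _ in be.
(* The distances at which the first coordinate reaches 0 and the second reaches 1. *)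
exists (Num.min (tx T p / - x) ((1 - ty T p) / y)).
  by rewrite lt_min; apply/andP; split; apply: divr_gt0; rewrite ?oppr_gt0 ?subr_gt0.
move=> e /andP[e0]; have al' : 0 < - x by rewrite oppr_gt0.
rewrite lt_min (ltr_pdivlMr _ _ be) (ltr_pdivlMr _ _ al') => /andP[h1 h2].
rewrite txh tyh -/x -/y.
have h3 : e * x < 0 by rewrite pmulr_rlt0.
have h4 : 0 < e * y by rewrite mulr_gt0.
by rewrite mulrN in h1; split; apply/andP; split; lra.
Qed.

Lemma interior_west T p : 0 <= tx T p < 1 -> 0 < ty T p <= 1 ->
  exists2 d : R, 0 < d & forall e : R, 0 < e < d ->
   (0 < tx T (p + (- e) *: hvec) < 1) /\ (0 < ty T (p + (- e) *: hvec) < 1).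
Proof.
move=> /andP[a0 a1] /andP[b0 b1].
have al := co1_hvec (valP T.1); have be := co2_hvec (valP T.1).
set x := co1 _ _ _ in al; set y := co2 _ _ _ in be.
exists (Num.min ((1 - tx T p) / - x) (ty T p / y)).
  by rewrite lt_min; apply/andP; split; apply: divr_gt0; rewrite ?oppr_gt0 ?subr_gt0.
move=> e /andP[e0]; have al' : 0 < - x by rewrite oppr_gt0.
rewrite lt_min (ltr_pdivlMr _ _ be) (ltr_pdivlMr _ _ al') => /andP[h1 h2].
rewrite txh tyh -/x -/y !mulNr.
have h3 : e * x < 0 by rewrite pmulr_rlt0.
have h4 : 0 < e * y by rewrite mulr_gt0.
by rewrite mulrN in h1; split; apply/andP; split; lra.
Qed.

Lemma near_inj T T' (f : R -> 'rV[R]_2) : T \in P -> T' \in P ->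
  (exists2 d : R, 0 < d & forall e : R, 0 < e < d ->
    (0 < tx T (f e) < 1) /\ (0 < ty T (f e) < 1)) ->
  (exists2 d : R, 0 < d & forall e : R, 0 < e < d ->
    (0 < tx T' (f e) < 1) /\ (0 < ty T' (f e) < 1)) -> T = T'.
Proof.
move=> TP T'P [d d0 hd] [d' d'0 hd'].
have m0 : 0 < Num.min d d' by rewrite lt_min d0 d'0.
pose e : R := Num.min d d' / 2.
have /andP[ed ed'] : (e < d) && (e < d') by rewrite -lt_min /e; lra.
have e0 : 0 < e by rewrite /e; lra.
have := hd' e; have := hd e; rewrite e0 ed ed' /= => /(_ isT)[x1 y1] /(_ isT)[].
move=> /andP[x2 x3] /andP[y2 y3].
by apply: interior_inj x1 y1 _ => //; apply/in_tileE; rewrite !ltW.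
Qed.

Lemma ledge_coords T e : T \in P -> e \in ledges T ->
  0 < tx T (mid e) <= 1 /\ 0 <= ty T (mid e) < 1.
Proof.
move=> TP; have [[a0 b0] [a1 b1] _ _] := mid_coords (tiling_ok TP).
by rewrite !inE => /orP[] /eqP ->; rewrite ?a0 ?b0 ?a1 ?b1; split; apply/andP; split; lra.
Qed.

Lemma redge_coords T e : T \in P -> e \in redges T ->
  0 <= tx T (mid e) < 1 /\ 0 < ty T (mid e) <= 1.
Proof.
move=> TP; have [_ _ [a0 b0] [a1 b1]] := mid_coords (tiling_ok TP).
by rewrite !inE => /orP[] /eqP ->; rewrite ?a0 ?b0 ?a1 ?b1; split; apply/andP; split; lra.
Qed.

Lemma ledge_inj T T' e : T \in P -> T' \in P -> e \in ledges T -> e \in ledges T' -> T = T'.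
Proof.
move=> TP T'P /(ledge_coords TP)[a b] /(ledge_coords T'P)[a' b']; exact: near_inj TP T'P (interior_east a b) (interior_east a' b').
Qed.

Lemma redge_inj T T' e : T \in P -> T' \in P -> e \in redges T -> e \in redges T' -> T = T'.
Proof.
move=> TP T'P /(redge_coords TP)[a b] /(redge_coords T'P)[a' b']; exact: near_inj TP T'P (interior_west a b) (interior_west a' b').
Qed.

(** Points slightly east of the left corner, whose coordinates are (1, 0), are interior to the
    tile. *)
Lemma left_inj T T' : T \in P -> T' \in P -> left T = left T' -> T = T'.
Proof.
move=> TP T'P e; have [_ e1 _ _] := pos_vertices (tiling_ok TP).
have [_ e2 _ _] := pos_vertices (tiling_ok T'P).
have [x1 y1] : tx T (pos R (left T)) = 1 /\ ty T (pos R (left T)) = 0 by rewrite e1 txE tyE.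
have [x2 y2] : tx T' (pos R (left T)) = 1 /\ ty T' (pos R (left T)) = 0 by rewrite e e2 txE tyE.
by apply: near_inj (interior_east (p := pos R (left T)) _ _) (interior_east _ _) => //;
  rewrite ?x1 ?x2 ?y1 ?y2 ?lexx ?ltr01.
Qed.

Lemma redge_east T e d : T \in P -> e \in redges T -> 0 < d -> ~ in_tile T (mid e + d *: hvec).
Proof.
move=> TP; have [_ _ [a0 b0] [a1 b1]] := mid_coords (tiling_ok TP).
have al := co1_hvec (valP T.1); have be := co2_hvec (valP T.1).
rewrite !inE => /orP[] /eqP -> d0 /in_tileE; rewrite txh tyh ?a0 ?b0 ?a1 ?b1 =>
  /andP[/andP[x0 x1] /andP[y0 y1]].
  by move: (mulr_gt0 d0 be) x0; rewrite -(pmulr_rlt0 _ d0) in al; lra.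
by move: (mulr_gt0 d0 be) y1; lra.
Qed.

(** Unless the edge is on the right boundary, there are x < y with x in A or equal to l, and y not
    in A. A horizontal step is a negative multiple of [dir R x] plus a positive one of [dir R y],
    and both coefficients have room for it. *)
Lemma polygon_east (A : {set 'I_n}) l : l \notin A -> A != [set x : 'I_n | (l < x)%N] ->
  exists2 d : R, 0 < d & forall e : R, 0 < e < d -> polygon n (mid (A, l |: A) + e *: hvec).
Proof.
move=> lA nA.
have [x [y [lt x1 y1]]] : exists x y : 'I_n, [/\ (x < y)%N, x \in l |: A & y \notin A].
  case: (boolP (A \subset [set x : 'I_n | (l < x)%N])) => [sA|/subsetPn[x xA]].
    move: nA; rewrite eqEsubset sA /= => /subsetPn[y]; rewrite inE => ly yA.
    by exists l, y; rewrite setU11.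
  rewrite inE -leqNgt leq_eqVlt => /orP[/eqP/val_inj xl|xl]; first by rewrite -xl xA in lA.
  by exists x, l; rewrite inE xA orbT.
(* The coefficients of the midpoint in the Minkowski sum; the one of x is at least 1/2, the one of y
   at most 1/2. *)
pose c0 z : R := if z \in A then 1 else if z == l then 2^-1 else 0.
have c01 z : 0 <= c0 z <= 1 by rewrite /c0; case: ifP => _; [|case: ifP => _]; lra.
have mE : mid (A, l |: A) = \sum_z c0 z *: dir R z.
  rewrite (bigID (mem A)) /= [X in _ + X](bigD1 l) //= [X in _ + (_ + X)]big1; last first.
    by move=> z /andP[zA zl]; rewrite /c0 (negbTE zA) (negbTE zl) scale0r.
  rewrite addr0 {2}/c0 (negbTE lA) eqxx /mid /= posU //.
  rewrite (eq_bigr (dir R)) => [|z zA]; last by rewrite /c0 zA scale1r.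
  by rewrite -/(pos R A); apply: rV2P; rewrite !(pxD, pyD, pxZ, pyZ); field.
have al := co1_hvec lt; have be := co2_hvec lt; have hE := co_basis hvec lt.
set a := co1 _ _ _ in al hE; set b := co2 _ _ _ in be hE.
have cx : 2^-1 <= c0 x by rewrite /c0; move: x1; rewrite !inE; case: (x == l); case: (x \in A) =>
  //= _; lra.
have cy : c0 y <= 2^-1 by rewrite /c0 (negbTE y1); case: ifP => _; lra.
exists (Num.min (2^-1 / - a) (2^-1 / b)).
  by rewrite lt_min; apply/andP; split; apply: divr_gt0; rewrite ?oppr_gt0 // invr_gt0.
move=> e /andP[e0]; have al' : 0 < - a by rewrite oppr_gt0.
rewrite lt_min (ltr_pdivlMr _ _ be) (ltr_pdivlMr _ _ al') => /andP[h1 h2].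
have h3 : e * a < 0 by rewrite pmulr_rlt0.
have h4 : 0 < e * b by rewrite mulr_gt0.
rewrite mulrN in h1.
have xy : y == x = false by apply/negbTE; rewrite -val_eqE /= neq_ltn lt orbT.
exists (fun z => c0 z + e * (if z == x then a else if z == y then b else 0)); split.
  move=> z; have := c01 z; rewrite /unit_itv.
  by case: eqP => [->|_]; [|case: eqP => [->|_]] => /andP[z0 z1]; split; lra.
rewrite mE [in LHS]hE (bigD1 x) //= (bigD1 y) ?xy //= [RHS](bigD1 x) //= [X in _ = _ + X](bigD1 y)
  ?xy //= ?eqxx ?xy.
rewrite [X in _ = _ + (_ + X)](eq_bigr (fun z => c0 z *: dir R z)); last first.
  by move=> z /andP[/negbTE -> /negbTE ->]; rewrite mulr0 addr0.
by apply: rV2P; rewrite !(pxD, pyD, pxZ, pyZ); ring.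
Qed.


(* Finitely many tiles cover the points p + e h, e -> 0. *)
Lemma frequently_tile p (d : R) : 0 < d ->
  (forall e : R, 0 < e < d -> polygon n (p + e *: hvec)) ->
  exists2 T, T \in P & forall c : R, 0 < c -> exists2 e : R, 0 < e < c & in_tile T (p + e *: hvec).
Proof.
move=> d0 hp; apply: contrapT => hn.
have /boolp.choice[F hF] (T : tile n) : exists c : R, T \in P ->
    0 < c /\ forall e : R, 0 < e < c -> ~ in_tile T (p + e *: hvec).
  case: (boolP (T \in P)) => TP; last by exists 1.
  apply: contrapT => hc; apply: hn; exists T => // c c0; apply: contrapT => he.
  by apply: hc; exists c => _; split=> // e e0 pT; apply: he; exists e.
pose c := \big[Num.min/d]_(T in P) F T.
have c0 : 0 < c by rewrite /c; elim/big_ind: _ => // [x y x0 y0|T /hF[]//]; rewrite lt_min x0 y0.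
have cd : c <= d by exact: bigmin_le_id.
have cF T : T \in P -> c <= F T by move=> TP; exact: bigmin_le_cond.
have /hp : 0 < c / 2 < d by lra.
case: tP => _ /(_ (p + (c / 2) *: hvec)) [+ _] _ _ => /[apply] -[T TP].
by have [_ /(_ (c / 2))] := hF T TP; apply; have := cF T TP; lra.
Qed.

Lemma closed_tile T p : (forall c : R, 0 < c -> exists2 e : R,
  0 < e < c & in_tile T (p + e *: hvec)) ->
  in_tile T p.
Proof.
have al := co1_hvec (valP T.1); have be := co2_hvec (valP T.1).
move=> h; apply/in_tileE.
set x := co1 _ _ _ in al; set y := co2 _ _ _ in be.
have H (z w : R) : w != 0 -> 0 < z -> exists2 c, 0 < c & forall e : R, 0 < e < c -> `|e * w| < z.
  move=> w0 z0; exists (z / `|w|); first by rewrite divr_gt0 ?normr_gt0.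
  by move=> e /andP[e0]; rewrite ltr_pdivlMr ?normr_gt0 // normrM (gtr0_norm e0).
have K (w z : R) : w != 0 -> 0 < z -> exists2 e : R, in_tile T (p + e *: hvec) & `|e * w| < z.
  by move=> w0 z0; have [c c0 hc] := H z w w0 z0; have [e /hc ew eT] := h c c0; exists e.
have x0 : x != 0 by rewrite lt_eqF.
have y0 : y != 0 by rewrite gt_eqF.
apply/andP; split; apply/andP; split; rewrite leNgt; apply/negP => lt.
- have [e /in_tileE] := @K x (- tx T p) x0 ltac:(lra).
  rewrite txh tyh -/x -/y ltr_norml => /andP[/andP[]]; lra.
- have [e /in_tileE] := @K x (tx T p - 1) x0 ltac:(lra).
  rewrite txh tyh -/x -/y ltr_norml => /andP[/andP[]]; lra.
- have [e /in_tileE] := @K y (- ty T p) y0 ltac:(lra).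
  rewrite txh tyh -/x -/y ltr_norml => /andP[_ /andP[]]; lra.
- have [e /in_tileE] := @K y (ty T p - 1) y0 ltac:(lra).
  rewrite txh tyh -/x -/y ltr_norml => /andP[_ /andP[]]; lra.
Qed.

(** A tile T' with points arbitrarily close to the east of the midpoint contains the midpoint, which
    T contains too. Their common face through it can only be this edge, as labelled sets, and T'
    lies on its east side. *)
Lemma redge_ledge T (A : {set 'I_n}) (l : 'I_n) : l \notin A -> A != [set x : 'I_n | (l < x)%N] ->
  T \in P -> (A, l |: A) \in redges T -> exists2 T', T' \in P & (A, l |: A) \in ledges T'.
Proof.
move=> lA nA TP eT; set e := (A, l |: A) in eT *.
have [d d0 /(frequently_tile d0)[T' T'P hT']] := polygon_east lA nA.
exists T' => //; have mT' := closed_tile hT'.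
have ne : T' != T.
  apply/eqP => eTT; have [c /andP[c0 _]] := hT' 1 ltr01.
  by rewrite eTT; apply: redge_east TP eT c0.
have [x y] := redge_coords TP eT.
have mT : in_tile T (mid e) by apply/in_tileE; lra.
have [_ _ m2 m3] := mid_coords (tiling_ok TP).
case: tP => _ _ /(_ _ _ _ T'P TP ne mT' mT) + _.
case=> [[v]|[e']]; rewrite inE => /andP[vT' vT].
  have [+ +] := vertices_coords (tiling_ok TP) vT => + + pv; rewrite -pv.
  by move: eT => /set2P[] eE; rewrite -/e eE; [case: m2 => -> ->|case: m3 => -> ->]; lra.
move=> /(in_edge_coords (tiling_ok TP) vT)[c] hc.
suff ee : e' = e.
  rewrite -ee; move: vT'; rewrite edgesE inE => /orP[//|]; rewrite ee => eT'.
  by have [f /andP[f0 _]] := hT' 1 ltr01; move=> /(redge_east T'P eT' f0).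
by move: eT hc => /set2P[] eE; rewrite -/e eE; [case: m2|case: m3] => -> -> [][->] // h1 h2;
  exfalso; clear -h1 h2; lra.
Qed.

(** On the left boundary no tile to the west supplies the labels, and positions alone do not
    determine vertex sets. Here they do: the midpoint is extremal in the polygon, which forces all
    its Minkowski coefficients. *)
Lemma left_ledge (l : 'I_n) : let A := [set x : 'I_n | (x < l)%N] in
  exists2 T, T \in P & (A, l |: A) \in ledges T.
Proof.
move=> A; have lA : l \notin A by rewrite inE ltnn.
have mE : mid (A, l |: A) = pos R A + 2^-1 *: dir R l.
  by rewrite /mid /= posU //; apply: rV2P; rewrite !(pxD, pyD, pxZ, pyZ); field.
have : polygon n (mid (A, l |: A)).
  exists (fun x => if x == l then 2^-1 else if (x < l)%N then 1 else 0); split.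
    by move=> x; case: eqP => _; [|case: ifP => _]; split; lra.
  rewrite mE (bigD1 l) //= eqxx addrC; congr (_ + _); rewrite /pos.
  rewrite [RHS](bigID (mem A)) /= [X in _ = _ + X]big1 ?addr0; last first.
    by move=> x; rewrite inE => /andP[/negbTE -> /negbTE ->]; rewrite scale0r.
  apply: eq_big => [x|x]; rewrite inE.
    by case: ltngtP => //; rewrite ?andbF ?andbT // => xl; rewrite -val_eqE /= ltn_eqF.
  by move=> xl; rewrite xl -val_eqE /= ltn_eqF // scale1r.
case: tP => _ /(_ (mid (A, l |: A))) [+ _] _ _ => /[apply] -[T TP [a [b [ha hb]]]] pE.
exists T => //; have [s1 t1] := tiling_ok TP; have lt := valP T.1.
set s := (val T.1).1 in s1 lt pE *; set t := (val T.1).2 in t1 lt pE *.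
pose c x : R := if x == s then a else if x == t then b else (x \in low T)%:R.
have c01 x : 0 <= c x <= 1.
  case: ha hb => a0 a1 [b0 b1].
  by rewrite /c; case: eqP => _; [|case: eqP => _; [|case: (_ \in _) => /=]]; lra.
have cE : mid (A, l |: A) = \sum_x c x *: dir R x.
  have ts : t == s = false by apply/negbTE; rewrite -val_eqE /= neq_ltn lt orbT.
  rewrite pE (bigD1 s) //= (bigD1 t) /= ?ts // /c !eqxx ts -[LHS]addrA [LHS]addrC -[LHS]addrA;
    congr (_ + (_ + _)).
  rewrite /pos big_mkcond [RHS]big_mkcond; apply: eq_bigr => x _.
  case: (x =P s) => [->|xs] /=; first by rewrite (negbTE s1).
  case: (x =P t) => [->|xt] /=; first by rewrite (negbTE t1).
  by case: (x \in low T); rewrite ?scale1r ?scale0r.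
(* det2 (., dir l) attains its maximum over the polygon on this edge. *)
have cA x : x != l -> c x = (x < l)%N%:R.
  have [fp fn] : (forall x, (x < l)%N -> 0 < det2 (dir R x) (dir R l)) /\
     (forall x, (l < x)%N -> det2 (dir R x) (dir R l) < 0).
    split=> z zl; first exact: det2_gt0.
    by have := det2_gt0 zl; rewrite /det2; lra.
  have E : \sum_(x : 'I_n) ((x < l)%N%:R - c x) * det2 (dir R x) (dir R l) = 0.
    have e1 := congr1 (fun p => det2 p (dir R l)) cE.
    have e2 := congr1 (fun p => det2 p (dir R l)) mE.
    rewrite e1 det2D det2Z det2pp mulr0 addr0 !det2_sum in e2.
    under eq_bigr do rewrite mulrBl.
    rewrite sumrB; apply/eqP; rewrite subr_eq0; apply/eqP.
    rewrite -[RHS](_ : \sum_x det2 (c x *: dir R x) (dir R l) = _); last first.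
      by apply: eq_bigr => z _; rewrite det2Z.
    rewrite e2 [RHS]big_mkcond; apply: eq_bigr => z _.
    by rewrite inE; case: ifP => _; rewrite ?mul1r ?mul0r.
  move=> xl.
  have nn (z : 'I_n) : 0 <= ((z < l)%N%:R - c z) * det2 (dir R z) (dir R l).
    have /andP[z0 z1] := c01 z; case: ltngtP => [zl|zl|/val_inj ->] /=.
    - by apply: mulr_ge0; [lra|exact: ltW (fp z zl)].
    - by apply: mulr_le0; [lra|exact: ltW (fn z zl)].
    - by rewrite det2pp mulr0.
  move/eqP: E; rewrite psumr_eq0 // => /allP /(_ x (mem_index_enum _)) /=.
  rewrite mulf_eq0 subr_eq0 => /orP[/eqP //|]; case: (ltngtP x l) =>
    [/fp|/fn|/val_inj] // h /eqP h0.
  - by rewrite h0 ltxx in h.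
  - by rewrite h0 ltxx in h.
  - by rewrite h eqxx in xl.
have cl : c l = 2^-1.
  have : mid (A, l |: A) = pos R A + c l *: dir R l.
    rewrite cE (bigD1 l) //= addrC; congr (_ + _); rewrite /pos [RHS]big_mkcond [LHS]big_mkcond.
    apply: eq_bigr => x _; rewrite inE; case: eqP => [->|/eqP/cA ->] /=; first by rewrite ltnn.
    by case: ifP => _; rewrite ?scale1r ?scale0r.
  rewrite mE => /addrI/(congr1 py); rewrite !pyZ => /(mulIf (lt0r_neq0 (py_dir_gt0 l))).
  by [].
(* Labels other than s and t have coefficient 0 or 1, so the coefficient 1/2 makes l one of the two
   labels of the tile. *)
have half b' : (b' : bool)%:R != 2^-1 :> R by case: b' => /=; apply/eqP; lra.
have inlow x : x != s -> x != t -> x != l -> (x \in low T) = (x < l)%N.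
  move=> xs xt /cA; rewrite /c (negbTE xs) (negbTE xt).
  by case: (x \in low T); case: (x < l)%N => //= /eqP; rewrite ?oner_eq0 // eq_sym oner_eq0.
have [ls|ls] := eqVneq l s.
  suff <- : low T = A by rewrite ls !inE /left -/s eqxx.
  apply/setP => x; rewrite inE.
  have [->|xs] := eqVneq x s; first by rewrite ls ltnn (negbTE s1).
  have [->|xt] := eqVneq x t; first by rewrite ls (negbTE t1) ltnNge ltnW.
  by rewrite inlow // ls.
have [lt'|lt'] := eqVneq l t; last first.
  by move: cl; rewrite /c (negbTE ls) (negbTE lt') => /eqP; rewrite (negbTE (half _)).
suff <- : left T = A by rewrite lt' /Defs.top !inE /left -/s -/t setUCA eqxx orbT.
apply/setP => x; rewrite !inE -/s.
have [->|xs] /= := eqVneq x s; first by rewrite lt' lt.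
have [->|xt] := eqVneq x t; first by rewrite lt' ltnn (negbTE t1).
by rewrite inlow // lt'.
Qed.

End Tiling.
End Plane.

(** * Sweeping a tiling *)

Section Snakes.
Variable n : nat.
Implicit Types (p w : word n) (l : 'I_n.-1) (x y : 'I_n) (T : tile n) (e : edge n) (S : vertex n).

Definition snake w x : edge n := (cham w x, cham w x.+1).

Lemma tiles_rconsP w l T :
  T \in tiles (rcons w l) <-> T \in tiles w \/ tile_at w l T.
Proof.
split=> [/tilesP[p [m [q [e tT]]]]|[h|h]].
- case: (lastP q) e => [|q' m'].
    by rewrite cats1 => /rcons_inj[-> ->]; right.
  by rewrite -rcons_cons -rcons_cat => /rcons_inj[-> _]; left; apply/tilesP; exists p, m, q'.
- by rewrite -cats1; exact: tiles_cat.
- by apply/tilesP; exists w, l, [::]; rewrite cats1.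
Qed.

Lemma tile_at_ledges w l T : tile_at w l T ->
  ledges T = [set snake w (lo l); snake w (hi l)].
Proof. by move=> /tile_atE[e0 e1 _ e3]; rewrite /ledges e0 e1 e3. Qed.

Lemma tile_at_redges w l T : tile_at w l T ->
  redges T = [set snake (rcons w l) (lo l); snake (rcons w l) (hi l)].
Proof.
move=> /tile_atE[e0 _ e2 e3]; rewrite /redges e0 e2 e3 /snake /=.
by rewrite [cham (rcons w l) l]cham_rcons 1?[cham (rcons w l) l.+2]cham_rcons //; lia.
Qed.

Lemma snake_rcons w l x : x != lo l -> x != hi l -> snake (rcons w l) x = snake w x.
Proof.
by rewrite -!val_eqE /= => h1 h2; rewrite /snake !cham_rcons //.
Qed.

Lemma tile_at_last w l : asc (rcons w l) -> exists2 T, tile_at w l T & T \in tiles (rcons w l).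
Proof. by rewrite -cats1 => /tile_at_exists. Qed.

Lemma left_boundary_edgesP e :
  reflect (exists x, e = snake [::] x) (e \in left_boundary_edges n).
Proof.
have E x : snake [::] x = ([set y : 'I_n | (y < x)%N], [set y : 'I_n | (y <= x)%N]).
  by congr (_, _); apply/setP => y; rewrite !inE.
by apply: (iffP imsetP) => [[x _ ->]|[x ->]]; exists x.
Qed.

Lemma snake_front w x : asc w ->
  snake w x \in left_boundary_edges n \/ exists2 T, T \in tiles w & snake w x \in redges T.
Proof.
elim/last_ind: w => [|w l IH] aw; first by left; apply/left_boundary_edgesP; exists x.
have [T tT Tin] := tile_at_last aw.
have [->|xl] := eqVneq x (lo l).
  by right; exists T; rewrite // (tile_at_redges tT) set21.
have [->|xh] := eqVneq x (hi l).
  by right; exists T; rewrite // (tile_at_redges tT) set22.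
rewrite snake_rcons //; have /IH[] : asc w by move: aw; rewrite -cats1 => /asc_cat.
  by left.
by case=> T' T'w eT'; right; exists T' => //; apply/tiles_rconsP; left.
Qed.

(** A letter removes from the path only the two left edges of its tile. An edge that has been
    reached and is not a left edge of a swept tile is thus still on the path. *)
Lemma front_snake w e : asc w ->
  e \in left_boundary_edges n \/ (exists2 T, T \in tiles w & e \in redges T) ->
  (forall T, T \in tiles w -> e \notin ledges T) -> exists x, e = snake w x.
Proof.
elim/last_ind: w => [|w l IH] aw he hn.
  case: he => [/left_boundary_edgesP //|[T /tilesP[p [m [q []]]]]].
  by case: p.
have [T tT Tin] := tile_at_last aw.
have aw' : asc w by move: aw; rewrite -cats1 => /asc_cat.
have hw : e \in left_boundary_edges n \/ (exists2 T, T \in tiles w & e \in redges T) ->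
    exists x, e = snake (rcons w l) x.
  move=> {}/IH -/(_ aw')[|x ex].
    by move=> T' T'w; apply: hn; apply/tiles_rconsP; left.
  exists x; rewrite snake_rcons //; apply: contraTneq isT => xl.
    by have := hn T Tin; rewrite (tile_at_ledges tT) ex xl set21.
  by have := hn T Tin; rewrite (tile_at_ledges tT) ex xl set22.
case: he => [h|[T' /tiles_rconsP[T'w|tT'] eT']].
- by apply: hw; left.
- by apply: hw; right; exists T'.
by move: eT'; rewrite (tile_at_redges tT') => /set2P[] ->; [exists (lo l)|exists (hi l)].
Qed.

Lemma ledge_front w T e : asc w -> T \in tiles w -> e \in ledges T ->
  e \in left_boundary_edges n \/ exists2 T', T' \in tiles w & e \in redges T'.
Proof.
move=> aw /tilesP[p [l [q [ew tT]]]]; have ap : asc p by move: aw; rewrite ew => /asc_cat.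
have H x : snake p x \in left_boundary_edges n \/ exists2 T',
  T' \in tiles w & snake p x \in redges T'.
  have [|[T' T'p eT']] := snake_front x ap; first by left.
  by right; exists T' => //; rewrite ew; exact: tiles_cat.
by rewrite (tile_at_ledges tT) => /set2P[] ->; exact: H.
Qed.

Lemma setU1_inj (a b : 'I_n) S : a \notin S -> b \notin S -> a |: S = b |: S -> a = b.
Proof. by move=> aS bS e; have := setU11 a S; rewrite e !inE (negbTE aS) orbF => /eqP. Qed.

Lemma redge_not_boundary T e : ok_tile T -> e \in redges T -> e \notin left_boundary_edges n.
Proof.
move=> [s1 t1] eT; apply/negP => /imsetP[x _ ex]; have lt := valP T.1; move: eT.
rewrite ex => /set2P[[h1 h2]|[h1 h2]].
- have := setU11 (val T.1).2 (low T); rewrite -/(right T) -h2 inE => tx.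
  by move: s1; rewrite -h1 inE => /negP; apply; apply: leq_trans lt tx.
- have := setU11 (val T.1).2 (low T); rewrite -/(right T) -h1 inE => tx.
  have : (val T.1).1 \in right T by rewrite -h1 inE; apply: ltn_trans lt tx.
  by rewrite !inE (negbTE s1) orbF -val_eqE /= ltn_eqF.
Qed.

Lemma ledge_notin_redges T e : ok_tile T -> e \in ledges T -> e \notin redges T.
Proof.
move=> [s1 t1] eT; have lt := valP T.1; apply/negP => eT'.
have ne : (val T.1).1 != (val T.1).2 by rewrite -val_eqE /= ltn_eqF.
have a : left T <> right T by move=> E; move/eqP: ne; apply; exact: setU1_inj E.
have b : low T <> right T by move=> E; have := t1; rewrite E setU11.
have c : left T <> low T by move=> E; have := s1; rewrite -E setU11.
move: eT eT' => /set2P[] -> /set2P[] E.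
- exact: a (congr1 snd E).
- exact: b (congr1 fst E).
- exact: c (congr1 fst E).
- exact: a (congr1 fst E).
Qed.

(** It contains s but not t > s. Right boundary vertices are upper sets, hence never left
    corners. *)
Lemma left_not_upper T : ok_tile T -> ~ {in left T, forall y z : 'I_n, (y < z)%N -> z \in left T}.
Proof.
move=> [s1 t1] h; have lt := valP T.1.
have := h _ (setU11 _ _) _ lt; rewrite !inE (negbTE t1) orbF -val_eqE /=.
by rewrite gtn_eqF.
Qed.

Lemma asc_size w : asc w -> (size w <= 'C(n, 2))%N.
Proof.
move=> aw; rewrite -size_roots -card_pairs -(card_uniqP (asc_uniq aw)); apply: subset_leq_card.
by apply/subsetP => r rw; rewrite inE; exact: (allP aw).
Qed.

End Snakes.

Section Sweep.
Variables (n : nat) (R : realType) (P : {set tile n}).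
Hypothesis tP : is_tiling R P.
Implicit Types (p w : word n) (l : 'I_n.-1) (x y : 'I_n) (T : tile n) (e : edge n) (S : vertex n).

Lemma snake_ledge w x : asc w -> {subset tiles w <= P} ->
  cham w x != [set y : 'I_n | (wact w x < y)%N] -> exists2 T, T \in P & snake w x \in ledges T.
Proof.
move=> aw wP nx; have := snake_front x aw; rewrite /snake chamS =>
  -[/imsetP[s _ [e1 e2]]|[T Tw eT]].
  have -> : wact w x = s.
    have : s \in wact w x |: cham w x by rewrite e2 inE.
    by rewrite in_setU1 e1 in_set ltnn orbF => /eqP ->.
  by rewrite e1; exact: (left_ledge tP).
exact: (redge_ledge tP (cham_notin w x) nx (wP _ Tw) eT).
Qed.

(** Each edge of the path off the right boundary is a lower left edge (L) or an upper left edge (U)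
    of a tile. An L directly below a U belongs to the same tile by [left_inj], which can be swept
    next. Without such a pair, neither U nor L occurs, and the path is the right boundary. *)
Lemma sweep_progress w : asc w -> {subset tiles w <= P} ->
  wact w =1 @rev_ord n \/ exists l, asc (rcons w l) /\ {subset tiles (rcons w l) <= P}.
Proof.
move=> aw wP.
pose L x := exists2 T, T \in P & low T = cham w x /\ left T = cham w x.+1.
pose U x := exists2 T, T \in P & left T = cham w x /\ Defs.top T = cham w x.+1.
have LU x : cham w x != [set y : 'I_n | (wact w x < y)%N] -> L x \/ U x.
  by move=> /(snake_ledge aw wP)[T TP /set2P[] [h1 h2]]; [left|right]; exists T.
have [[l [[T TP [h1 h2]] [T' T'P [h1' h2']]]]|nLU] := pselect (exists l, L (lo l) /\ U (hi l)).
  right; exists l; have eT : T = T' by apply: (left_inj tP) => //; rewrite h2 h1'.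
  rewrite -eT in h1' h2'; have [s1 t1] := tiling_ok tP TP; have lt := valP T.1.
  have es : (val T.1).1 = wact w (lo l).
    by apply: (@setU1_inj n _ _ (low T)) => //; rewrite h1 ?cham_notin // -chamS -h2 /left -h1.
  have et : (val T.1).2 = wact w (hi l).
    apply: (@setU1_inj n _ _ (left T)).
    - by rewrite !inE negb_or t1 andbT -val_eqE /= gtn_eqF.
    - by rewrite h1' cham_notin.
    - by rewrite [in RHS]h1' -chamS -h2' /Defs.top /left setUCA.
  have tT : tile_at w l T by rewrite /tile_at h1 -es -et eqxx andbT; case: (val T.1) => ? ? /=.
  split; first by rewrite asc_rcons aw andbT -es -et.
  move=> T0 /tiles_rconsP[/wP //|tT0].
  suff -> : T0 = T by [].
  move: tT0 tT => /andP[/eqP a1 /eqP b1] /andP[/eqP a2 /eqP b2].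
  by case: T0 a1 b1 => r0 S0 /= a1 ->; case: (T) a2 b2 => r S /= a2 ->; congr (_, _);
    apply: val_inj; rewrite /= a1 a2.
left.
(* The edge below a U ends in a left corner, so it is not on the right boundary; not being L, it is
   again U, down to the lowest vertex, which is no left corner. The argument for L goes upwards in
   the same way. *)
have nU m x : x = m :> nat -> ~ U x.
  elim: m x => [|m IH] x xm [T TP [h1 h2]].
    by move: (setU11 (val T.1).1 (low T)); rewrite -/(left T) h1 xm cham0 inE.
  have lm : (m < n.-1)%N by have := ltn_ord x; rewrite xm; case: (n).
  pose l := Ordinal lm; have xl : x = hi l by apply: val_inj; rewrite /= xm.
  have [bd|/LU[Ll|Ul]] := eqVneq (cham w (lo l)) [set y : 'I_n | (wact w (lo l) < y)%N].
  - apply: (left_not_upper (tiling_ok tP TP)); rewrite h1 xl -[cham w _]/(cham w (lo l).+1) chamS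
    bd.
    move=> y yl z yz; rewrite !inE in yl *; case/orP: yl => [/eqP <-|yl]; rewrite ?yz ?orbT //.
    by rewrite (ltn_trans yl yz) orbT.
  - by apply: nLU; exists l; split=> //; rewrite -xl; exists T.
  - by apply: (IH (lo l)).
have nL m x : (n - x = m)%N -> ~ L x.
  elim: m x => [|m IH] x xm [T TP [h1 h2]].
    by have := ltn_ord x; rewrite -subn_gt0 xm.
  have [s1 t1] := tiling_ok tP TP; have lt := valP T.1.
  have [xn|xn] := eqVneq x.+1 n.
    have : (val T.1).2 \in left T by rewrite h2 xn cham_full inE.
    by rewrite !inE (negbTE t1) orbF -val_eqE /= gtn_eqF.
  have lm : (x < n.-1)%N by move: xn (ltn_ord x); move: (nat_of_ord x) => k; clear; lia.
  pose l := Ordinal lm; have xl : x = lo l by apply: val_inj.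
  have [bd|/LU[Lh|Uh]] := eqVneq (cham w (hi l)) [set y : 'I_n | (wact w (hi l) < y)%N].
  - apply: (left_not_upper (tiling_ok tP TP)); rewrite h2 -[cham w _]/(cham w (hi l)) bd.
    by move=> y yl z yz; rewrite !inE in yl *; rewrite (ltn_trans yl yz).
  - by apply: (IH (hi l)) => //; rewrite /= subnS xm.
  - exact: (nU _ (hi l) erefl).
move=> x; have [bd|/LU[/nL|/nU] h] := eqVneq (cham w x) [set y : 'I_n | (wact w x < y)%N];
  last 2 first.
- by case: (h _ erefl).
- by case: (h _ erefl).
have := card_cham w (ltnW (ltn_ord x)); rewrite bd => cx; apply: val_inj => /=.
have : #|[set y : 'I_n | (wact w x < y)%N]| = (n - (wact w x).+1)%N.
  have -> : [set y : 'I_n | (wact w x < y)%N] = ~: [set y : 'I_n | (y < (wact w x).+1)%N].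
    by apply/setP => y; rewrite !inE ltnS -ltnNge.
  by rewrite cardsCs setCK card_ord; congr (_ - _)%N; have :=
    @card_cham n [::] (wact w x).+1 (ltn_ord _).
by rewrite cx => ->; have := ltn_ord (wact w x); clear; lia.
Qed.

Lemma sweep_complete : exists2 w, asc w /\ wact w =1 @rev_ord n & {subset tiles w <= P}.
Proof.
suff H m w : asc w -> {subset tiles w <= P} -> ('C(n, 2) - size w < m)%N ->
    exists2 w, asc w /\ wact w =1 @rev_ord n & {subset tiles w <= P}.
  apply: (H 'C(n, 2).+1 [::]) => //; last by rewrite subn0.
  by move=> T /tilesP[[|? ?] [? [? []]]].
elim: m w => // m IH w aw wP sm.
have [wr|[l [awl wlP]]] := sweep_progress aw wP; first by exists w.
have := asc_size awl; rewrite size_rcons => sw; apply: IH awl wlP _.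
by rewrite size_rcons; move: sm sw; clear; lia.
Qed.

(* This grows along a strip of parallel edges (A, c |: A) from left to right. *)
Definition strip c (A : {set 'I_n}) : nat :=
  #|[set x : 'I_n | (c < x)%N && (x \in A) || (x < c)%N && (x \notin A)]|.

(** From a missing tile, follow the strip of parallel edges to the right. The next tile is missing
    as well, since a left edge of a tile of w is on the left boundary or a right edge of a tile of
    w. At the right boundary this is absurd, because the last edge is a right edge of a tile of
    w. *)
Lemma tiling_sub w : reduced w -> {subset tiles w <= P} -> P = tiles w.
Proof.
move=> rw wP; have aw := reduced_asc rw.
apply/eqP; rewrite eqEsubset; apply/andP; split; apply/subsetP; last by [].
move=> T TP; apply/negPn/negP => Tw.
suff H m T' (l : 'I_n) (A : {set 'I_n}) : (n - strip l A < m)%N -> T' \in P -> T' \notin tiles w ->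
    l \notin A -> (A, l |: A) \in redges T' -> False.
  by apply: (H _ T (val T.1).2 (low T) (ltnSn _)) => //; rewrite ?set21 //; case: (tiling_ok tP TP).
elim: m T' l A {T TP Tw} => // m IH T l A sm TP Tw lA eT.
have okT := tiling_ok tP TP.
have [EA|nA] := eqVneq A [set x : 'I_n | (l < x)%N].
  have ex : (A, l |: A) = snake w (rev_ord l).
    have EA' : cham w (rev_ord l) = A.
      apply/setP => y; rewrite EA !inE (reduced_pos _ rw) /=; have := ltn_ord y; have := ltn_ord l.
      by clear; lia.
    by rewrite /snake chamS rw.2 rev_ordK EA'.
  have := snake_front (rev_ord l) aw; rewrite -ex => -[h|[T' T'w eT']].
    by move: (redge_not_boundary okT eT); rewrite h.
  by move: Tw; rewrite (redge_inj tP TP (wP _ T'w) eT eT') T'w.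
have [T' T'P eT'] := redge_ledge tP lA nA TP eT.
have T'w : T' \notin tiles w.
  apply/negP => T'w; have [h|[T2 T2w eT2]] := ledge_front aw T'w eT'.
    by move: (redge_not_boundary okT eT); rewrite h.
  by move: Tw; rewrite (redge_inj tP TP (wP _ T2w) eT eT2) T2w.
have [s1 t1] := tiling_ok tP T'P; have lt := valP T'.1.
have st : (val T'.1).1 != (val T'.1).2 by rewrite -val_eqE /= ltn_eqF.
have up (A' : {set 'I_n}) (z : 'I_n) : z \in [set x : 'I_n | (l < x)%N && (x \in A') || (x < l)%N
  && (x \notin A')] ->
    z \notin [set x : 'I_n | (l < x)%N && (x \in A) || (x < l)%N && (x \notin A)] ->
    (forall x : 'I_n, x != z -> (x \in A) = (x \in A')) -> (n - strip l A' < m)%N.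
  move=> z1 z2 h; have : (strip l A < strip l A')%N.
    apply: proper_card; apply/properP; split; last by exists z.
    by apply/subsetP => x; have [->|xz] := eqVneq x z; [rewrite (negbTE z2)|rewrite !inE h].
  have : (strip l A' <= n)%N by rewrite -[X in (_ <= X)%N]card_ord max_card.
  by move: sm; clear; lia.
(* If the strip enters by the lower left edge, then l = s and A gains t > l; if by the upper left
   edge, then l = t and A loses s < l. Either way [strip] grows by the element exchanged. *)
case/set2P: eT' => -[e1 e2].
  have el : l = (val T'.1).1 by apply: (setU1_inj lA _) => //;
    rewrite e1 //= -e1 // e2 /left -[T'.2]/(low T') -e1.
  apply: (IH T' l (right T')) => //.
  - apply: (up _ (val T'.1).2).
    + by rewrite !inE el lt eqxx.
    + by rewrite !inE e1 (negbTE t1) el andbF /= ltnNge ltnW.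
    + by move=> x /negbTE xt; rewrite !inE xt e1.
  - by rewrite el !inE (negbTE st).
  - by rewrite el; apply/set2P; right.
have el : l = (val T'.1).2.
  apply: (setU1_inj lA); first by rewrite e1 !inE eq_sym (negbTE st).
  by rewrite e2 e1 /Defs.top /left setUCA.
apply: (IH T' l (low T')) => //.
- apply: (up _ (val T'.1).1).
  + by rewrite !inE el lt s1 orbT.
  + have sl : (val T'.1).1 \in left T' := setU11 _ _.
    by rewrite in_set e1 sl andbF orbF andbT el -leqNgt ltnW.
  + by move=> x /negbTE xs; rewrite e1 !inE xs.
- by rewrite el.
- by rewrite el; apply/set2P; left.
Qed.

(** The second clause says that the swept tiles are closed under passing to a left neighbour, the
    third that B consists of the edges reached but not yet crossed. *)
Definition sweep_inv (B : {set edge n}) (U : {set tile n}) :=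
  [/\ {subset U <= P},
      forall T T' e, T \in U -> T' \in P -> e \in ledges T -> e \in redges T' -> T' \in U &
      forall e, e \in B <->
        (e \in left_boundary_edges n \/ exists2 T, T \in U & e \in redges T) /\
        forall T, T \in U -> e \notin ledges T].

Lemma sweep_inv_redge B U T e : sweep_inv B U -> T \in P -> T \notin U ->
  e \in redges T -> e \notin B.
Proof.
move=> [UP _ hB] TP TU eT; apply/negP => /hB[[h|[T' T'U eT']] _].
  by move: (redge_not_boundary (tiling_ok tP TP) eT); rewrite h.
by move: TU; rewrite (redge_inj tP TP (UP _ T'U) eT eT') T'U.
Qed.

Lemma sweep_inv_edges B U T : sweep_inv B U -> T \in P -> T \notin U ->
  edges T :&: B = ledges T :&: B.
Proof.
move=> I TP TU; apply/setP => e; rewrite edgesE !in_setI in_setU.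
case: (boolP (e \in redges T)) => [eT|]; last by rewrite orbF.
by rewrite (negbTE (sweep_inv_redge I TP TU eT)) !andbF.
Qed.

(** A right edge of an unswept tile is never in B, as it would have to be a right edge of a swept
    tile or lie on the left boundary. Two edges in B are therefore both left edges. *)
Lemma sweep_inv_next B U T : sweep_inv B U ->
  (T \in next_tiles P B U) = [&& T \in P, T \notin U & ledges T \subset B].
Proof.
move=> I; rewrite in_set; case: (boolP (T \in P)) => //= TP; case: (boolP (T \in U)) => //= TU.
rewrite (sweep_inv_edges I TP TU).
have c2 : #|ledges T| = 2.
  rewrite cards2; suff -> : (low T, left T) != (left T, Defs.top T) by [].
  apply/eqP => -[E _]; have [s1 _] := tiling_ok tP TP.
  by have := s1; rewrite E setU11.
apply/eqP/idP => [h|/finset.setIidPl -> //].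
apply/finset.setIidPl/eqP; rewrite eqEcard subsetIl /= c2 h //.
Qed.

Lemma sweep_inv_step B U (L := next_tiles P B U) : sweep_inv B U ->
  sweep_inv ((B :\: (\bigcup_(T in L) edges T)) :|: \bigcup_(T in L) (edges T :\: B)) (U :|: L).
Proof.
move=> I; have [UP down hB] := I.
have LE T : T \in L -> [/\ T \in P, T \notin U & ledges T \subset B].
  by rewrite (sweep_inv_next _ I) => /and3P.
split.
- by move=> T /setUP[/UP //|/LE[]].
- move=> T T' e /setUP[TU|/LE[TP TU sB]] T'P eT eT'; rewrite in_setU.
    by rewrite (down T T' e).
  have /hB[[h|[T2 T2U eT2]] _] := subsetP sB _ eT.
    by move: (redge_not_boundary (tiling_ok tP T'P) eT'); rewrite h.
  by rewrite (redge_inj tP T'P (UP _ T2U) eT' eT2) T2U.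
move=> e; split.
  move/setUP => [/setDP[/hB[h1 h2] eL]|/bigcupP[T TL /setDP[eT eB]]].
    split.
      case: h1 => [|[T TU eT]]; [by left|right; exists T => //].
      by rewrite in_setU TU.
    move=> T /setUP[/h2 //|TL]; apply: contra eL => eT; apply/bigcupP; exists T => //.
    by rewrite edgesE in_setU eT.
  have [TP TU sB] := LE T TL.
  have {}eT : e \in redges T.
    move: eT; rewrite edgesE in_setU => /orP[eT|//]; move: eB.
    by rewrite (subsetP sB _ eT).
  split; first by right; exists T; rewrite // in_setU TL orbT.
  move=> T2 /setUP[T2U|/LE[_ _ sB2]]; apply/negP => eT2.
    by move: TU; rewrite (down T2 T e).
  by move: eB; rewrite (subsetP sB2 _ eT2).
move=> [h1 h2]; apply/setUP.
have old : e \in left_boundary_edges n \/ (exists2 T, T \in U & e \in redges T) ->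
    e \in B :\: \bigcup_(T in L) edges T.
  move=> h; have eB : e \in B by apply/hB; split=> // T TU; apply: h2; rewrite in_setU TU.
  rewrite in_setD eB andbT; apply/negP => /bigcupP[T TL eT]; have [TP TU sB] := LE T TL.
  have : e \in ledges T :&: B by rewrite -(sweep_inv_edges I TP TU) in_setI eT.
  by rewrite in_setI (negbTE (h2 T _)) // in_setU TL orbT.
case: h1 => [h|[T /setUP[TU|TL] eT]].
- by left; apply: old; left.
- by left; apply: old; right; exists T.
right; apply/bigcupP; exists T => //; have [TP TU sB] := LE T TL.
by rewrite in_setD (sweep_inv_redge I TP TU eT) edgesE in_setU eT orbT.
Qed.

Lemma sweep_invP m : sweep_inv (sweep P m).1 (sweep P m).2.
Proof.
elim: m => [|m IH] /=.
  split=> [T|T T' e|e]; rewrite ?inE //; split=> [h|[[//|[T]]]]; rewrite ?inE //.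
  by split=> [|T]; [left|rewrite inE].
by move: IH; case: (sweep P m) => B U /= /sweep_inv_step.
Qed.

Lemma sweep_layer m T : T \in (sweep P m).2 -> exists2 k, (k < m)%N & T \in layer P k.
Proof.
elim: m => [|m IH] /=; first by rewrite inE.
rewrite /layer; case E : (sweep P m) IH => [B U] /= IH /setUP[/IH[k km Tk]|TL].
  by exists k => //; exact: ltnW.
by exists m; rewrite ?E.
Qed.

Lemma sweepS m T : T \in (sweep P m).2 -> T \in (sweep P m.+1).2.
Proof. by rewrite /=; case: (sweep P m) => B U /= TU; rewrite in_setU TU. Qed.

Lemma prefix_swept w : asc w -> {subset tiles w <= P} ->
  exists m, {subset tiles w <= (sweep P m).2}.
Proof.
elim/last_ind: w => [_ _|w l IH aw wP].
  by exists 0%N => T /tilesP[[|? ?] [? [? []]]].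
have aw' : asc w by move: aw; rewrite -cats1 => /asc_cat.
have [|m hm] := IH aw'; first by move=> T Tw; apply: wP; apply/tiles_rconsP; left.
exists m.+1 => T /tiles_rconsP[/hm/sweepS //|tT].
have TP : T \in P by apply: wP; apply/tiles_rconsP; right.
have [TU|TU] := boolP (T \in (sweep P m).2); first exact: sweepS.
have I := sweep_invP m.
suff : T \in next_tiles P (sweep P m).1 (sweep P m).2.
  by rewrite /=; case: (sweep P m) => B U /= TL; rewrite in_setU TL orbT.
rewrite (sweep_inv_next _ I) TP TU; apply/subsetP => e eT.
have [UP down hB] := I; apply/hB; split.
  have [x ex] : exists x, e = snake w x.
    by move: eT; rewrite (tile_at_ledges tT) => /set2P[] ->; [exists (lo l)|exists (hi l)].
  have := snake_front x aw'; rewrite -ex => -[|[T' T'w eT']]; first by left.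
  by right; exists T' => //; exact: hm.
move=> T' T'U; apply/negP => eT'.
by move: TU; rewrite -(ledge_inj tP (UP _ T'U) TP eT' eT) T'U.
Qed.

(** A tile enters a layer only when both its left edges are on the front, so a tile with one of them
    as right edge is in an earlier layer. *)
Lemma ledge_step w T T' e : asc w -> {subset tiles w <= P} -> T \in tiles w -> T' \in P ->
  e \in ledges T -> e \in redges T' -> tile_step P T' T.
Proof.
move=> aw wP Tw T'P eT eT'; have [m hm] := prefix_swept aw wP.
have [k km Tk] := sweep_layer (hm _ Tw); split.
  by apply/set0Pn; exists e; apply/setIP; split; rewrite edgesE; apply/setUP; [right|left].
have I := sweep_invP k; have [UP _ hB] := I.
move: (Tk); rewrite {1}/layer (sweep_inv_next _ I) => /and3P[TP TU /subsetP /(_ _ eT) /hB[[h|[T2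
  T2U eT2]] _]].
  by move: (redge_not_boundary (tiling_ok tP T'P) eT'); rewrite h.
have [k' k'k Tk'] := sweep_layer T2U; exists k', k; split=> //.
by rewrite (redge_inj tP T'P (UP _ T2U) eT' eT2).
Qed.

Lemma tiles_roots w T : T \in tiles w -> val T.1 \in roots w.
Proof.
move=> /tilesP[p [l [q [-> /andP[/eqP -> _]]]]].
by rewrite roots_cat mem_cat /= -map_comp !inE /= eqxx orbT.
Qed.

Lemma roots_tiles w r : asc w -> r \in roots w -> exists2 T, T \in tiles w & val T.1 = r.
Proof.
move=> aw /roots_split[p [l [q [ew ->]]]]; rewrite ew in aw *.
by have [T /andP[/eqP eT _] Tw] := tile_at_exists aw; exists T.
Qed.

(** The sweep only gives P as [tiles j] for some word j. To reach i, the tiles of its prefixes are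
    found in P one by one: all left neighbours of the tile with the next root have earlier roots in
    i, so its lower left edge is on the current path. *)
Lemma tiling_of_tiles i : reduced i ->
  (forall T T', T \in P -> T' \in P -> tile_le P T T' -> root_le i T.1 T'.1) -> P = tiles i.
Proof.
move=> ri ord; have [j [aj wj] jP] := sweep_complete.
have PE := tiling_sub (asc_reduced aj wj) jP; have ai := reduced_asc ri.
apply: (tiling_sub ri); suff H p q : i = p ++ q -> {subset tiles p <= P}.
  by apply: (H i [::]); rewrite cats0.
elim/last_ind: p q => [|p l IH] q; first by move=> _ T /tilesP[[|? ?] [? [? []]]].
rewrite cat_rcons => ei; have {IH} pP := IH _ ei.
have ap : asc p by move: ai; rewrite ei => /asc_cat.
move=> T0 /tiles_rconsP[/pP //|/andP[/eqP r0 /eqP l0]].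
have [T Tj rT] := tiles_root T0.1 (asc_reduced aj wj).
have TP := jP _ Tj; have okT := tiling_ok tP TP.
have szp : index (val T.1) (roots i) = size p.
  rewrite rT r0 -(nth_roots p l q (val T.1)) -ei index_uniq ?asc_uniq // size_roots ei size_cat /=.
  by rewrite -[X in (X < _)%N]addn0 ltn_add2l.
have Tp : val T.1 \notin roots p.
  apply/negP => Tp; have := index_mem (val T.1) (roots p).
  by rewrite Tp size_roots -szp ei roots_cat index_cat Tp ltnn.
(* This one edge suffices: its label s fixes its height on the path, and its lower end is the set of
   the tile. *)
have e1T : (low T, left T) \in ledges T by rewrite set21.
have front : (low T, left T) \in left_boundary_edges n \/
    exists2 T', T' \in tiles p & (low T, left T) \in redges T'.
  have [|[T' T'j eT']] := ledge_front aj Tj e1T; first by left.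
  right; exists T' => //; have T'P := jP _ T'j.
  (* The only use of the compatibility with the order of i: the root of the left neighbour comes no
     later than that of T, and it differs, so it is a root of p. *)
  have := ord _ _ T'P TP (TileLeStep (ledge_step aj jP Tj T'P e1T eT') (TileLeRefl _ _)).
  rewrite /root_le szp => le.
  have ne : val T'.1 != val T.1.
    apply/eqP => /val_inj /(tiles_root_inj aj T'j Tj) eTT.
    by have := ledge_notin_redges okT e1T; rewrite eTT in eT'; rewrite eT'.
  have rT' : val T'.1 \in roots p.
    apply: contraNT ne => nT'; move: le; rewrite ei roots_cat index_cat (negbTE nT') size_roots /=.
    rewrite -[X in (_ <= X)%N]addn0 leq_add2l; case: eqP => // e _.
    by rewrite -e rT r0.
  have [T2 T2p eT2] := roots_tiles ap rT'.
  by rewrite -(tiles_root_inj aj _ T'j (val_inj eT2)) // -PE pP.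
have [|x [ex ex']] := front_snake ap front.
  move=> T2 T2p; apply/negP => eT2; have eTT := ledge_inj tP (pP _ T2p) TP eT2 e1T.
  by move: Tp; rewrite -eTT (tiles_roots T2p).
have xl : x = lo l.
  apply: (can_inj (wactK p)).
  have -> : wact p (lo l) = (val T.1).1 by rewrite rT r0.
  apply: (@setU1_inj n _ _ (low T)); first by rewrite ex cham_notin.
  - by case: okT.
  - by rewrite [in LHS]ex -chamS -ex'.
suff -> : T0 = T by [].
move: rT l0 ex; rewrite xl; case: (T) (T0) => r S [r' S'] /= -> -> ex; congr (_, _).
by rewrite -[S]/(low (r, S)) ex.
Qed.

End Sweep.

Theorem theorem5p6 (n : nat) (hn : (2 <= n)%N) (R : realType)
  (k : fieldType) (hk : [pchar k] =i pred0)
  (T : word n -> {set tile n})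
  (hT : forall i, reduced i -> is_tiling_of R i (T i))
  (W : forall i : word n, 'I_n.-1 -> ratfun k (xvertex (T i)))
  (hW : is_GHKK_potential W)
  (i : word n) (hi : reduced i) :
  (forall a : 'I_n.-1,
     rho k a i = rcomp (W i a) (@CA n (T i) _ (@var k (proot n)))) /\
  (exists D : proot n -> ratfun k (xvertex (T i)),
     is_CA_inverse D /\
     \sum_a W i a = \sum_a rcomp (rho k a i) D) /\
  (exists (s : seq {ffun xvertex (T i) -> int})
          (c : {ffun xvertex (T i) -> int} -> k),
     laurent_expansion (\sum_a W i a) s c /\
     (forall e, e \in s ->
        [/\ e != [ffun=> 0], c e = 0 \/ c e = 1 &
            forall v, e v = 0 \/ e v = -1])).
Proof.
have FE j : reduced j -> T j = tiles j.
  by move=> rj; have [tP ord] := hT _ rj; exact: (tiling_of_tiles tP rj ord).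
have WE j a : reduced j -> W j a = potential k (T j) a := @GHKK_potentialE n k T W FE hW j a.
have PE := FE _ hi.
have sE : \sum_a W i a = \sum_a potential k (T i) a by apply: eq_bigr => a _; exact: WE.
split; last split.
- by move=> a; rewrite WE //; exact: (rho_potential k hi PE a).
- exists (CAinv (T i) (xcoord k (T i))); split; first split.
  + exact: (CA_dual k hi PE).
  + by move=> r; apply: rcomp_subst; [exact: (@CA_inj n k i _ hi PE)|exact: (subst_CA_dual k hi
    PE)].
  + by rewrite sE; apply: eq_bigr => a _; rewrite (potential_rho k hi PE).
- by rewrite sE; exact: (potential_laurent k (T i)).
Qed.
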